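(* Let $L$ be a Sierpinski lattice with a boundary point. Let $R(\lambda)=\lambda(5-\lambda)$, let $\mathcal{J}$ be the Julia set of $R$, and write $\Sigma_4=\bigcup_{m=0}^\infty R^{\circ-m}\{4\}$, $\Sigma_5=\bigcup_{m=0}^\infty R^{\circ-m}\{5\}$, and $\Sigma_6=\{6\}\cup\bigcup_{m=0}^\infty R^{\circ-m}\{3\}$. (a) For $\Delta:\ell^p(L)\to\ell^p(L)$ with $1<p<\infty$, we have $\sigma_p(\Delta)=\Sigma_5\cup\Sigma_6$, $\sigma_c(\Delta)=\mathcal{J}\setminus\Sigma_5$, and $\sigma_r(\Delta)=\emptyset$. (b) For $\Delta:\ell^1(L)\to\ell^1(L)$, we have $\sigma_p(\Delta)=\Sigma_5\cup\Sigma_6$, $\sigma_c(\Delta)=\mathcal{J}\setminus(\Sigma_4\cup\Sigma_5\cup\{0\})$, and $\sigma_r(\Delta)=\{0\}\cup\Sigma_4$.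
   Context: Sierpinski lattice: let $F_0(x)=\frac12x+(\frac14,\frac{\sqrt3}{4})$, $F_1(x)=\frac12x$, $F_2(x)=\frac12x+(\frac12,0)$ on $\mathbb{R}^2$, with fixed points $q_0=(\frac12,\frac{\sqrt3}{2})$, $q_1=(0,0)$, $q_2=(1,0)$. Put $V_0=\{q_0,q_1,q_2\}$ and $V_m=\bigcup_{i=0}^2F_i(V_{m-1})$ for $m\ge1$. For an infinite word $\omega=\omega_1\omega_2\cdots\in\{0,1,2\}^\infty$, the Sierpinski lattice is the infinite graph with vertex set $L=L_\omega=\bigcup_{m=1}^\infty F_{\omega_1}^{-1}\cdots F_{\omega_m}^{-1}(V_m)$, where distinct $x,y\in L$ are neighbours, written $x\sim y$, if $x,y\in F_{\omega_1}^{-1}\cdots F_{\omega_m}^{-1}F_{l_m}F_{l_{m-1}}\cdots F_{l_1}(V_0)$ for some $m\geq 1$ and $l_1,\dots,l_m\in\{0,1,2\}$. Every vertex has four neighbours except a boundary vertex (boundary point), which has exactly two. A boundary point exists (and is then unique) if and only if there are $M\in\mathbb{N}$ and $i\in\{0,1,2\}$ with $\omega_m=i$ for all $m\ge M$. Laplacian: $\Delta f(x)=\sum_{y\sim x}f(y)-4f(x)$ if $x$ is not a boundary point, and $\Delta f(x)=\sum_{y\sim x}2f(y)-4f(x)$ if $x$ is a boundary point. Spectra of $\Delta:\ell^p(L)\to\ell^p(L)$ (with this sign convention): $\sigma_p(\Delta)=\{\lambda\in\mathbb{C}:\lambda+\Delta\text{ is not injective}\}$; $\sigma_c(\Delta)$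 is the set of $\lambda\in\mathbb{C}\setminus\sigma_p(\Delta)$ such that $\lambda+\Delta$ is not surjective and $(\lambda+\Delta)(\ell^p(L))$ is dense in $\ell^p(L)$; $\sigma_r(\Delta)$ is the set of $\lambda\in\mathbb{C}\setminus\sigma_p(\Delta)$ such that $\lambda+\Delta$ is not surjective and $(\lambda+\Delta)(\ell^p(L))$ is not dense in $\ell^p(L)$. The Julia set $\mathcal{J}$ of $R$ is here equivalently $\{x\in\mathbb{C}:\sup_{k\ge0}|R^{\circ k}(x)|<\infty\}$. $R^{\circ k}$ is the $k$-fold iterate and $R^{\circ-m}\{a\}=\{\lambda\in\mathbb{C}:R^{\circ m}(\lambda)=a\}$. *)

(* Defs.v *)
From HB Require Import structures.
From mathcomp Require Import all_boot all_order all_algebra.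
From mathcomp Require Import all_classical all_reals all_analysis.
From mathcomp Require Import complex.

Set Implicit Arguments.
Unset Strict Implicit.
Unset Printing Implicit Defensive.

Import Order.TTheory GRing.Theory Num.Theory.

Local Open Scope classical_set_scope.
Local Open Scope ring_scope.

Section Lattice.
Variable R : realType.

Definition translation (i : 'I_3) : R * R :=
  match val i with
  | 0%N => (4^-1, Num.sqrt 3 / 4)
  | 1%N => (0, 0)
  | _ => (2^-1, 0)
  end.

(* The contractions F_0, F_1, F_2 of the plane. *)
Definition F (i : 'I_3) (x : R * R) : R * R :=
  (2^-1 * x.1 + (translation i).1, 2^-1 * x.2 + (translation i).2).

(* V_0 = {q_0, q_1, q_2}, the fixed points of F_0, F_1, F_2. *)
Definition V0 : set (R * R) := [set (2^-1, Num.sqrt 3 / 2); (0, 0); (1, 0)].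

Fixpoint V (m : nat) : set (R * R) :=
  if m is m'.+1 then \bigcup_(i in [set: 'I_3]) (F i @` V m') else V0.

(* An infinite word w_1 w_2 ... is a function omega with omega k = w_(k+1), so
   that blowup omega m A = F_{w_1}^-1 ( ... (F_{w_m}^-1 A)); each F_i is a
   bijection of the plane, hence inverse images are preimages. *)
Fixpoint blowup (omega : nat -> 'I_3) (m : nat) (A : set (R * R)) :
    set (R * R) :=
  if m is m'.+1 then blowup omega m' (F (omega m') @^-1` A) else A.

Definition lattice (omega : nat -> 'I_3) : set (R * R) :=
  \bigcup_(m in [set m | (1 <= m)%N]) blowup omega m (V m).

(* cell [:: l_1; ...; l_m] = F_{l_m} (F_{l_(m-1)} ( ... (F_{l_1} V_0))) *)
Definition cell (l : seq 'I_3) : set (R * R) :=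
  foldl (fun A i => F i @` A) V0 l.

Definition adjacent (omega : nat -> 'I_3) (x y : R * R) : Prop :=
  x <> y /\
  exists m : nat, (1 <= m)%N /\
  exists l : m.-tuple 'I_3,
    blowup omega m (cell l) x /\ blowup omega m (cell l) y.

Section Laplacian.
Variable omega : nat -> 'I_3.
Local Notation L := (lattice omega).

Definition neighbours (x : L) : set L :=
  [set y : L | adjacent omega (val x) (val y)].

Definition boundary_point (x : L) : Prop := (neighbours x #= `I_2)%card.

(* The sums are over the finite sets of neighbours. *)
Definition laplacian (f : L -> R[i]) (x : L) : R[i] :=
  if `[< boundary_point x >]
  then (\sum_(y \in neighbours x) 2 * f y) - 4 * f x
  else (\sum_(y \in neighbours x) f y) - 4 * f x.

Definition lp_norm (p : R) (f : L -> R[i]) : \bar R :=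
  ((\esum_(x in [set: L]) (Normc.normc (f x) `^ p)%:E) `^ p^-1)%E.

Definition lp (p : R) : set (L -> R[i]) := [set f | (lp_norm p f < +oo)%E].

(* lambda + Delta *)
Definition shifted_laplacian (lambda : R[i]) (f : L -> R[i]) : L -> R[i] :=
  fun x => lambda * f x + laplacian f x.

Definition lp_injective (p : R) (lambda : R[i]) : Prop :=
  set_inj (lp p) (shifted_laplacian lambda).

Definition lp_surjective (p : R) (lambda : R[i]) : Prop :=
  set_surj (lp p) (lp p) (shifted_laplacian lambda).

Definition lp_dense_range (p : R) (lambda : R[i]) : Prop :=
  forall g, lp p g -> forall e : R, 0 < e ->
  exists f, lp p f /\
    (lp_norm p (fun x => (shifted_laplacian lambda f x - g x)%R) < e%:E)%E.

Definition point_spectrum (p : R) : set R[i] :=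
  [set lambda | ~ lp_injective p lambda].

Definition continuous_spectrum (p : R) : set R[i] :=
  [set lambda | [/\ ~ point_spectrum p lambda,
    ~ lp_surjective p lambda & lp_dense_range p lambda]].

Definition residual_spectrum (p : R) : set R[i] :=
  [set lambda | [/\ ~ point_spectrum p lambda,
    ~ lp_surjective p lambda & ~ lp_dense_range p lambda]].

End Laplacian.

Definition decimation (z : R[i]) : R[i] := z * (5 - z).

(* The critical orbit of this quadratic polynomial escapes to infinity, so its
   Julia set is its filled Julia set: the points with bounded orbit. *)
Definition julia : set R[i] :=
  [set z | exists M : R, forall k, Normc.normc (iter k decimation z) <= M].

Definition backward_orbit (a : R[i]) : set R[i] :=
  \bigcup_m [set z | iter m decimation z = a].

Definition Sigma4 : set R[i] := backward_orbit 4.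
Definition Sigma5 : set R[i] := backward_orbit 5.
Definition Sigma6 : set R[i] := 6 |` backward_orbit 3.

End Lattice.

Arguments lattice R omega : clear implicits.
Arguments julia R : clear implicits.
Arguments Sigma4 R : clear implicits.
Arguments Sigma5 R : clear implicits.
Arguments Sigma6 R : clear implicits.

(* Main.v *)
(* Each vertex of L lies in two smallest triangles, except the boundary point,
   which lies in one; so a function on L is a function on the set of flags
   (triangle, corner) that is invariant under an involution.  When l is neither 2,
   5 nor 6, eliminating the midpoint values from (l + Delta) u = g leaves, on the
   lattice of mesh 2, the same equation at R(l) = l (5 - l) (spectral decimation).

   Finitely supported eigenfunctions at 5 and at 6 are thereby transferred to
   Sigma_5 and Sigma_6.  Outside the Julia set J and Sigma_6 the orbit of l
   escapes to the region where a Neumann series inverts l + Delta, unless it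
   meets l = 2, which is treated directly by a contraction.

   J is contained in [0, 5], and outside Sigma_5 the orbit avoids 2, 5 and 6.
   There a kernel function is determined by its values along sequences of
   vertices going to infinity, where it tends to 0; and l is a limit of points
   of Sigma_5, which prevents surjectivity.

   For the density of the range, decimation reduces the approximation of any
   vertex indicator to that of two functions near the boundary point.  For p > 1
   these are equivalent, modulo the range, to multiples of far away copies,
   whose averages have small norm.  For p = 1 the fluxes of far away indicators
   are, modulo the range, multiples by the products of the 3 - R^k(l) of these
   functions, and the products are unbounded unless l = 0 or l is in Sigma_4.
   In these exceptional cases a bounded eigenfunction annihilates the range. *)

Require Import Defs.
From HB Require Import structures.
From mathcomp Require Import all_boot all_order all_algebra.
From mathcomp Require Import finmap.
From mathcomp Require Import all_classical all_reals all_analysis.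
From mathcomp Require Import complex.
From mathcomp Require Import zify ring lra.
Import Order.TTheory GRing.Theory Num.Theory.
Import numFieldNormedType.Exports.
Local Open Scope classical_set_scope.
Local Open Scope ring_scope.
Set Implicit Arguments.
Unset Strict Implicit.
Unset Printing Implicit Defensive.

(** * The lattice as a set of flags *)

(** For [p] other than 2 there is no self-adjointness to lean on, so kernel, surjectivity and
    density of the range are three separate questions. Two relations at the boundary point serve
    twice, as identities for kernel functions and, transposed, as congruences modulo the range. One
    links the value there to that at a midpoint by the factor [(2 - l) / 2]; the other multiplies
    the difference of the two neighbouring values by [5 - l] at each change of scale. Both are
    controlled on the Julia set: its real orbits avoid the interval from 7/5 to 18/5, hence 2, and
    the product of the [5 - R^j(l)] telescopes to [R^k(l) / l].

    For [p = 1] averaging gains nothing. Fluxes change by [(6 - l) / ((2 - l) (5 - l))] per scale,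
    and since [R(l) (6 - R(l)) = l (5 - l) (2 - l) (3 - l)], what is left is exactly [3 - l]. This
    singles out the repelling fixed point 4, where that factor is -1, and 0, where the prefactor [l]
    vanishes.

    Estimates use the [p]-th power of the norm: it is additive over disjoint supports and over the
    splitting of flags into coarse and midpoint flags, at the price of a constant in the triangle
    inequality. *)

(* [(c, i)] stands for corner [i] of the [c]-th smallest triangle.  The base 3
   digits of [c], least significant first, locate the triangle inside larger and
   larger triangles, so that [sub c j] is the [j]-th triangle of the [c]-th
   triangle of twice the size and [lift (c, i)] is the corner [i] of the latter.
   [mate] gives the other triangle at the same vertex; it fixes only [(0, 0)],
   the boundary point. *)
Definition flag := (nat * 'I_3)%type.

Definition sub (c : nat) (j : 'I_3) : nat := (3 * c + j)%N.
Definition parent (c : nat) : nat := (c %/ 3)%N.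
Definition digit (c : nat) : 'I_3 := inord (c %% 3)%N.

Lemma parent_sub c j : parent (sub c j) = c.
Proof. rewrite /parent /sub; have := ltn_ord j; lia. Qed.

Lemma digit_sub c j : digit (sub c j) = j.
Proof.
apply: val_inj; rewrite /digit /sub /= inordK; have := ltn_ord j; lia.
Qed.

Lemma sub_parent c : sub (parent c) (digit c) = c.
Proof. rewrite /sub /parent /digit inordK; lia. Qed.

Lemma sub_inj c j c' j' : sub c j = sub c' j' -> c = c' /\ j = j'.
Proof.
move=> e; split; first by rewrite -(parent_sub c j) e parent_sub.
by rewrite -(digit_sub c j) e digit_sub.
Qed.

Lemma cell_ind (Q : nat -> Prop) :
  Q 0%N -> (forall c j, Q c -> Q (sub c j)) -> forall c, Q c.
Proof.
move=> Q0 Qs c; elim: (c.+1) {-2}c (ltnSn c) => // n IHn [_ //|d] dn.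
rewrite -(sub_parent d.+1); apply/Qs/IHn; rewrite /parent; lia.
Qed.

Definition lift (x : flag) : flag := (sub x.1 x.2, x.2).

(** A corner other than the own digit is a midpoint shared with a sibling cell; the corner equal to
    the digit is a corner of the parent, so the partner is found one scale up. The fuel [n] is
    enough once it exceeds the cell number. *)
Fixpoint mate_rec (n : nat) (x : flag) : flag :=
  if n is n'.+1 then
    if x.2 != digit x.1 then (sub (parent x.1) x.2, digit x.1)
    else if x.1 == 0%N then x
    else lift (mate_rec n' (parent x.1, x.2))
  else x.

Definition mate (x : flag) : flag := mate_rec x.1.+1 x.

Lemma mate_rec_mate n x : (x.1 < n)%N -> mate_rec n x = mate x.
Proof.
rewrite /mate; move: {-1}(x.1.+1) (ltnSn x.1) => m.
elim: n m x => [|n IHn] [|m] [c i] //= cm cn.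
case: ifP => // _; case: eqP => // /eqP c0.
by congr lift; apply: IHn => /=; rewrite /parent; lia.
Qed.

Lemma mate_sub c j i :
  mate (sub c j, i) = if i == j then lift (mate (c, i)) else (sub c i, j).
Proof.
rewrite /mate /= digit_sub parent_sub.
case: (eqVneq i j) => [->|//] /=.
have [s0|sn0] := eqVneq (sub c j) 0%N; last first.
  by rewrite mate_rec_mate //=; move: sn0; rewrite /sub; lia.
have c0 : c = 0%N by rewrite /sub in s0; lia.
have j0 : j = 0 by apply: val_inj; rewrite /sub in s0 => /=; lia.
rewrite c0 j0 /mate /= /digit /=.
by have -> : (0 == inord (0 %% 3) :> 'I_3) by apply/eqP/val_inj; rewrite /= inordK.
Qed.

Lemma mate_lift x : mate (lift x) = lift (mate x).
Proof. by case: x => c i; rewrite {1}/lift mate_sub eqxx. Qed.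

Lemma mate00 : mate (0%N, 0) = (0%N, 0).
Proof.
rewrite /mate /= /digit.
by have -> : (0 == inord (0 %% 3) :> 'I_3) by apply/eqP/val_inj; rewrite /= inordK.
Qed.

Lemma mate_cell0 i : i != 0 -> mate (0%N, i) = (sub 0 i, 0).
Proof. by move=> i0; have := mate_sub 0 0 i; rewrite (negbTE i0). Qed.

Lemma flag_ind (Q : flag -> Prop) :
  (forall i, Q (0%N, i)) -> (forall c i, Q (c, i) -> Q (lift (c, i))) ->
  (forall c i j, i != j -> Q (sub c j, i)) -> forall x, Q x.
Proof.
move=> Q0 Ql Qm [c i]; move: c i; apply: cell_ind => // c j Qc i.
by have [->|ij] := eqVneq i j; [apply: (Ql c j)|apply: Qm].
Qed.

Lemma mateK : involutive mate.
Proof.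
move=> x; elim/flag_ind: x => [i|c i IH|c i j ij].
- have [->|i0] := eqVneq i 0; first by rewrite !mate00.
  by rewrite mate_cell0 // mate_sub eq_sym (negbTE i0).
- by rewrite !mate_lift IH.
- by rewrite mate_sub (negbTE ij) mate_sub eq_sym (negbTE ij).
Qed.

Lemma mate_bij : bijective mate. Proof. exact: inv_bij mateK. Qed.

(** Needed to see that the three corners of a cell are three different vertices. *)
Lemma mate_corner c i j : mate (c, i) = (c, j) -> i = j.
Proof.
move: c i j; apply: cell_ind => [i j|c k IH i j].
  have [->|i0] := eqVneq i 0; first by rewrite mate00 => -[].
  by rewrite mate_cell0 // => -[/(@sub_inj _ _ 0 0)[_ /eqP]]; rewrite (negbTE i0).
rewrite mate_sub; have [->|ik] := eqVneq i k.
  case e: (mate (c, k)) => [d l] [] /= /sub_inj[ed el] jl.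
  by apply: IH; rewrite e ed jl.
by move=> [/sub_inj[_ /eqP]]; rewrite (negbTE ik).
Qed.

(* The third corner, when [i != j]. *)
Definition opp (i j : 'I_3) : 'I_3 := - (i + j).

Lemma I3P (Q : 'I_3 -> Prop) : Q 0 -> Q 1 -> Q (1 + 1) -> forall i, Q i.
Proof.
move=> Q0 Q1 Q2 [[|[|[|//]]] h].
- by have -> : Ordinal h = 0 by apply: val_inj.
- by have -> : Ordinal h = 1 by apply: val_inj.
- by have -> : Ordinal h = 1 + 1 by apply: val_inj.
Qed.

Lemma sum3 (V : nmodType) (f : 'I_3 -> V) :
  \sum_i f i = f 0 + f 1 + f (1 + 1).
Proof.
rewrite !big_ord_recl big_ord0 addr0 addrA.
by do !congr (_ + _); congr f; apply: val_inj.
Qed.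

(** * Functions on flags and the block form of the operator *)

Section Algebra.
Variable K : fieldType.
Implicit Types (u a b : flag -> K) (l : K) (x : flag) (c : nat) (i j k : 'I_3).

Definition inv u := forall x, u (mate x) = u x.

Definition cs u c : K := \sum_i u (c, i).

(* [l + Delta] on functions of flags that are constant on vertices; counting each
   of the two triangles at [x] once takes care of the doubled weights at the
   boundary point. *)
Definition T l u x : K := cs u x.1 + cs u (mate x).1 - (6 - l) * u x.

(* [a] gives the values at the vertices of the lattice of mesh 2, and [b (c, k)]
   the value at the midpoint of the side opposite to corner [k] of its cell [c]. *)
Definition glue a b x : K :=
  if x.2 == digit x.1 then a (parent x.1, x.2)
  else b (parent x.1, opp x.2 (digit x.1)).

Definition res u x : K := u (lift x).
(** The midpoint opposite to corner [k] belongs to the subcells [k + 1] and [k + 2]; it is read in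
    the former, which makes no difference for an invariant [u]. *)
Definition mid u x : K := u (sub x.1 (x.2 + 1), x.2 + (1 + 1)).

Lemma glue_sub a b c j i :
  glue a b (sub c j, i) = if i == j then a (c, i) else b (c, opp i j).
Proof. by rewrite /glue /= digit_sub parent_sub. Qed.

Lemma glue_lift a b x : glue a b (lift x) = a x.
Proof. by case: x => c i; rewrite glue_sub eqxx. Qed.

Lemma res_glue a b : res (glue a b) = a.
Proof. by apply/funext => x; rewrite /res glue_lift. Qed.

Lemma mid_glue a b : mid (glue a b) = b.
Proof.
apply/funext => -[c k]; rewrite /mid glue_sub /=.
by move: k; apply: I3P; rewrite /=; congr (b (_, _)); apply: val_inj.
Qed.

Lemma glue_inj a b a' b' : glue a b = glue a' b' -> a = a' /\ b = b'.
Proof.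
move=> e; split; first by rewrite -(res_glue a b) e res_glue.
by rewrite -(mid_glue a b) e mid_glue.
Qed.

Lemma inv_glue a b : inv a -> inv (glue a b).
Proof.
move=> ia x; rewrite (surjective_pairing x) -(sub_parent x.1) mate_sub.
have [<-|ij] := eqVneq x.2 (digit x.1).
  by rewrite glue_lift ia glue_sub eqxx.
by rewrite !glue_sub eq_sym (negbTE ij) /opp addrC.
Qed.

Lemma inv_res u : inv u -> inv (res u).
Proof. by move=> iu x; rewrite /res -mate_lift iu. Qed.

Lemma glueE u : inv u -> u = glue (res u) (mid u).
Proof.
move=> iu; apply/funext => x; rewrite (surjective_pairing x) -(sub_parent x.1).
move: (parent x.1) (digit x.1) x.2 => c j i.
rewrite glue_sub; have [->//|ij] := eqVneq i j.
have e : mate (sub c j, i) = (sub c i, j) by rewrite mate_sub (negbTE ij).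
have h : u (sub c j, i) = u (sub c i, j) by rewrite -e iu.
rewrite /mid /=; move: i j ij {e} h; apply: I3P; apply: I3P => // _ h;
  (by congr (u (sub c _, _)); apply: val_inj) ||
  (by rewrite h; congr (u (sub c _, _)); apply: val_inj).
Qed.

Lemma csE u c : cs u c = u (c, 0) + u (c, 1) + u (c, 1 + 1).
Proof. by rewrite /cs sum3. Qed.

Lemma oppE : (opp 0 1 = 1 + 1) * (opp 1 0 = 1 + 1) * (opp 0 (1 + 1) = 1) *
  (opp (1 + 1) 0 = 1) * (opp 1 (1 + 1) = 0) * (opp (1 + 1) 1 = 0).
Proof. by do !split; apply: val_inj. Qed.

(** The corners of the subcell [j] are the coarse corner [j] and the two midpoints other than the
    one opposite to it. *)
Lemma cs_glue a b c j : cs (glue a b) (sub c j) = a (c, j) + cs b c - b (c, j).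
Proof.
rewrite !csE !glue_sub; move: j; apply: I3P; rewrite /= ?oppE; ring.
Qed.

Lemma T_inv l u : inv u -> inv (T l u).
Proof. by move=> iu x; rewrite /T mateK iu [_ + cs _ _]addrC. Qed.

(** The two blocks are the equations at coarse vertices and at midpoints. The second involves a
    single coarse cell, so the midpoints can be eliminated cell by cell. *)
Lemma T_glue l a b : inv a ->
  T l (glue a b) =
  glue (fun x => cs b x.1 - b x + (cs b (mate x).1 - b (mate x)) - (4 - l) * a x)
       (fun x => cs a x.1 - a x + cs b x.1 - (5 - l) * b x).
Proof.
move=> ia; apply/funext => x; rewrite (surjective_pairing x) -(sub_parent x.1).
move: (parent x.1) (digit x.1) x.2 => c j i; rewrite /T mate_sub.
have [<-|ij] := eqVneq i j.
  rewrite [RHS](glue_lift _ _ (c, i)) (glue_lift _ _ (c, i)) /= !cs_glue.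
  rewrite -surjective_pairing ia; ring.
rewrite !cs_glue !glue_sub (negbTE ij) /= !csE.
by move: i j ij; apply: I3P; apply: I3P => //= _; rewrite ?oppE; ring.
Qed.

End Algebra.

(** * The [p]-th power of the norm *)

Section Modulus.
Variable R : realType.
Implicit Types z w : R[i].

Definition nrm z : R := Normc.normc z.

Lemma nrm_ge0 z : 0 <= nrm z.
Proof. by case: z => a b; rewrite /nrm /= sqrtr_ge0. Qed.

Lemma nrmD z w : nrm (z + w) <= nrm z + nrm w.
Proof. exact: le_normcD. Qed.

Lemma nrmN z : nrm (- z) = nrm z. Proof. exact: normcN. Qed.

Lemma nrmB z w : nrm (z - w) <= nrm z + nrm w.
Proof. by rewrite -(nrmN w) nrmD. Qed.

Lemma nrmM z w : nrm (z * w) = nrm z * nrm w.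
Proof. exact: Normc.normcM. Qed.

Lemma nrmV z : nrm z^-1 = (nrm z)^-1.
Proof. exact: Normc.normcV. Qed.

Lemma nrm0 : nrm 0 = 0. Proof. exact: Normc.normc0. Qed.

Lemma nrm_eq0 z : nrm z = 0 -> z = 0. Proof. exact: Normc.eq0_normc. Qed.

Lemma nrm_gt0 z : z != 0 -> 0 < nrm z.
Proof.
move=> z0; rewrite lt0r nrm_ge0 andbT.
by apply: contraNneq z0 => /nrm_eq0 ->.
Qed.

Lemma nrm_real (x : R) : nrm (x%:C)%C = `|x|.
Proof. by rewrite /nrm /= expr0n /= addr0 sqrtr_sqr. Qed.

End Modulus.

Section PowerConvexity.
Variables (R : realType) (p : R).
Hypothesis p1 : 1 <= p.

Lemma powR_convex (t a b : R) : 0 <= t <= 1 -> 0 <= a -> 0 <= b ->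
  (t * a + (1 - t) * b) `^ p <= t * a `^ p + (1 - t) * b `^ p.
Proof.
move=> /andP[t0 t1] a0 b0.
have := @convex_powR R p p1 (Itv01 t0 t1) a b.
rewrite /= !convRE; apply; rewrite inE /= in_itv /= ?a0 ?b0 //.
Qed.

(** Convexity at the points [a / t] and [b / (1 - t)]. The free weight [t] is what later keeps the
    constants of a geometric series from compounding. *)
Lemma powRD_le (t a b : R) : 0 < t < 1 -> 0 <= a -> 0 <= b ->
  (a + b) `^ p <= t `^ (1 - p) * a `^ p + (1 - t) `^ (1 - p) * b `^ p.
Proof.
move=> /andP[t0 t1] a0 b0; have t1' : 0 < 1 - t by rewrite subr_gt0.
have h := @powR_convex t (a / t) (b / (1 - t)).
rewrite [t * (a / t)]mulrC [_ * (b / _)]mulrC !divfK ?gt_eqF // in h.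
have {}h : (a + b) `^ p <= t * (a / t) `^ p + (1 - t) * (b / (1 - t)) `^ p.
  by apply: h; rewrite ?(ltW t0) ?(ltW t1) // divr_ge0 // ltW.
apply: le_trans h _.
have e (s c : R) : 0 < s -> 0 <= c -> s * (c / s) `^ p = s `^ (1 - p) * c `^ p.
  move=> s0 c0; have si : 0 <= s^-1 by rewrite invr_ge0 ltW.
  have sp : s^-1 `^ p = (s `^ p)^-1.
    by rewrite -[s^-1]powR_inv1 ?ltW // -powRrM mulN1r powRN.
  rewrite (powRM _ c0 si) sp powRB; last by apply/implyP => _; rewrite gt_eqF.
  by rewrite powRr1 ?ltW // mulrCA mulrC.
by rewrite !e // lerD.
Qed.

End PowerConvexity.

Section Mass.
Variables (R : realType) (p : R).
Hypothesis p1 : 1 <= p.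
Let p0 : 0 < p. Proof. exact: lt_le_trans p1. Qed.
Let p0w : 0 <= p. Proof. exact: ltW. Qed.

Section AnyIndex.
Variable I : choiceType.
Implicit Types (u v : I -> R[i]).

Definition mass u : \bar R := (\esum_(x in [set: I]) (nrm (u x) `^ p)%:E)%E.

Lemma mass_ge0 u : (0 <= mass u)%E.
Proof. by apply: esum_ge0 => x _; rewrite lee_fin powR_ge0. Qed.

Lemma mass_le u v : (forall x, nrm (u x) <= nrm (v x)) -> (mass u <= mass v)%E.
Proof.
move=> uv; apply: le_esum => x _; rewrite lee_fin ge0_ler_powR ?nnegrE ?nrm_ge0 //.
Qed.

Lemma mass_ext u v : (forall x, u x = v x) -> mass u = mass v.
Proof. by move=> /funext ->. Qed.

Lemma esumZ_le (c : R) (a : I -> R) : 0 <= c -> (forall x, 0 <= a x) ->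
  (\esum_(x in [set: I]) (c * a x)%:E <= c%:E * \esum_(x in [set: I]) (a x)%:E)%E.
Proof.
move=> c0 a0; apply: ge_ereal_sup => /= _ [X [finX _] <-].
have -> : (\sum_(x \in X) (c * a x)%:E = c%:E * \sum_(x \in X) (a x)%:E)%E.
  rewrite !fsbig_finite //= ge0_sume_distrr; last by move=> i _; rewrite lee_fin.
  by apply: eq_bigr => i _; rewrite EFinM.
by apply: lee_wpmul2l; rewrite ?lee_fin //; apply: ereal_sup_ubound; exists X.
Qed.

Lemma massZ k u : (mass (fun x => k * u x)%R <= (nrm k `^ p)%:E * mass u)%E.
Proof.
apply: le_trans (esumZ_le _ _); rewrite ?powR_ge0 //; last by move=> x; rewrite powR_ge0.
by apply: le_esum => x _; rewrite nrmM powRM ?nrm_ge0.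
Qed.

Lemma massD_le (t : R) u v : 0 < t < 1 ->
  (mass (fun x => u x + v x)%R <=
   (t `^ (1 - p))%:E * mass u + ((1 - t) `^ (1 - p))%:E * mass v)%E.
Proof.
move=> t01; apply: le_trans (leeD (esumZ_le _ _) (esumZ_le _ _));
  rewrite ?powR_ge0 //; try by move=> x; rewrite powR_ge0.
rewrite -esumD; try by move=> x _; rewrite lee_fin mulr_ge0 ?powR_ge0.
apply: le_esum => x _; rewrite -EFinD lee_fin.
apply: le_trans (powRD_le p1 t01 _ _); rewrite ?nrm_ge0 //.
by rewrite ge0_ler_powR ?nnegrE ?addr_ge0 ?nrm_ge0 ?nrmD.
Qed.

(** This is [2 ^ (p - 1)], the constant of the triangle inequality for [p]-th powers with equal
    weights. *)
Definition quasi : R := 2^-1 `^ (1 - p).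

Lemma quasi_gt0 : 0 < quasi. Proof. by apply: powR_gt0; rewrite invr_gt0. Qed.

Lemma massD u v : (mass (fun x => u x + v x)%R <= quasi%:E * (mass u + mass v))%E.
Proof.
have h : 0 < (2^-1 : R) < 1 by lra.
apply: le_trans (@massD_le _ u v h) _; have -> : 1 - 2^-1 = 2^-1 :> R by lra.
by rewrite ge0_muleDr ?mass_ge0.
Qed.

Lemma mass0 : mass (fun=> 0) = 0%E.
Proof. by apply: esum1 => x _; rewrite nrm0 powR0 // gt_eqF. Qed.

Lemma massN u : mass (fun x => - u x) = mass u.
Proof. by apply: eq_esum => x _; rewrite nrmN. Qed.

Lemma mass_point u x : ((nrm (u x) `^ p)%:E <= mass u)%E.
Proof.
apply: esum_ge; exists [set x]; first by split=> //; exact: finite_set1.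
by rewrite fsbig_set1.
Qed.

Lemma mass_eq0 u : (mass u <= 0)%E -> forall x, u x = 0.
Proof.
move=> u0 x; apply: nrm_eq0; apply: (@powR_eq0_eq0 _ _ p); apply/eqP.
by rewrite eq_le powR_ge0 andbT -lee_fin (le_trans (mass_point u x)).
Qed.

Lemma mass_disjoint u v : (forall x, u x = 0 \/ v x = 0) ->
  mass (fun x => u x + v x) = (mass u + mass v)%E.
Proof.
move=> uv; rewrite /mass -esumD; try by move=> x _; rewrite lee_fin powR_ge0.
apply: eq_esum => x _; rewrite -EFinD; congr EFin.
by have [->|->] := uv x; rewrite nrm0 (powR0 (lt0r_neq0 p0)) ?add0r ?addr0.
Qed.

Lemma mass_perm u (s : I -> I) : bijective s -> mass (fun x => u (s x)) = mass u.
Proof.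
move=> bs; rewrite /mass [RHS](@reindex_esum _ _ _ [set: I] [set: I] s) //.
split=> //; first by move=> x y _ _; exact: (bij_inj bs).
by case: bs => t _ st x _; exists (t x).
Qed.

Lemma mass_inj u (s : I -> I) : injective s -> (mass (fun x => u (s x)) <= mass u)%E.
Proof.
move=> si; rewrite /mass -(@esum_image R I I [set: I] s (fun x => (nrm (u x) `^ p)%:E)); last first.
  by move=> x y _ _; exact: si.
rewrite esum_mkcond; apply: le_esum => x _.
by case: ifP => // _; rewrite lee_fin powR_ge0.
Qed.

Definition bounded_op (B : (I -> R[i]) -> (I -> R[i])) :=
  exists2 C : R, 0 <= C & forall u, (mass (B u) <= C%:E * mass u)%E.

Lemma bounded_id : bounded_op id.
Proof. by exists 1 => // u; rewrite mul1e. Qed.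

Lemma bounded_perm s : bijective s -> bounded_op (fun u x => u (s x)).
Proof. by move=> bs; exists 1 => // u; rewrite mul1e mass_perm. Qed.

Lemma bounded_scale k B : bounded_op B -> bounded_op (fun u x => k * B u x).
Proof.
move=> [C C0 hC]; exists (nrm k `^ p * C); first by rewrite mulr_ge0 ?powR_ge0.
move=> u; apply: le_trans (massZ _ _) _; rewrite EFinM -muleA.
by apply: lee_wpmul2l; rewrite ?lee_fin ?powR_ge0.
Qed.

Lemma bounded_add A B : bounded_op A -> bounded_op B ->
  bounded_op (fun u x => A u x + B u x).
Proof.
move=> [C C0 hC] [D D0 hD]; exists (quasi * (C + D)).
  by rewrite mulr_ge0 ?addr_ge0 // ltW // quasi_gt0.
move=> u; apply: le_trans (massD _ _) _; rewrite EFinM -muleA.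
apply: lee_wpmul2l; first by rewrite lee_fin ltW // quasi_gt0.
by rewrite EFinD ge0_muleDl ?lee_fin // leeD.
Qed.

Lemma bounded_opp A : bounded_op A -> bounded_op (fun u x => - A u x).
Proof. by move=> [C C0 hC]; exists C => // u; rewrite massN. Qed.

Lemma bounded_comp A B : bounded_op A -> bounded_op B ->
  bounded_op (fun u => A (B u)).
Proof.
move=> [C C0 hC] [D D0 hD]; exists (C * D); first by rewrite mulr_ge0.
move=> u; apply: le_trans (hC _) _; rewrite EFinM -muleA.
by apply: lee_wpmul2l; rewrite ?lee_fin.
Qed.

Lemma bounded_fin B u : bounded_op B -> (mass u < +oo)%E -> (mass (B u) < +oo)%E.
Proof.
move=> [C C0 hC] u1; apply: le_lt_trans (hC u) _.
by move: u1; rewrite !lt_neqAle !leey !andbT; case: (mass u) (mass_ge0 u) => // r _ _.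
Qed.

Lemma massD_fin u v : (mass u < +oo)%E -> (mass v < +oo)%E ->
  (mass (fun x => u x + v x)%R < +oo)%E.
Proof.
move=> u1 v1; apply: le_lt_trans (massD u v) _.
by apply: lte_mul_pinfty; rewrite ?lee_fin ?(ltW quasi_gt0) ?lte_add_pinfty.
Qed.

Lemma massZ_fin k u : (mass u < +oo)%E -> (mass (fun x => k * u x)%R < +oo)%E.
Proof.
move=> u1; apply: le_lt_trans (massZ k u) _.
by apply: lte_mul_pinfty; rewrite ?lee_fin ?powR_ge0.
Qed.

Lemma massB_fin u v : (mass u < +oo)%E -> (mass v < +oo)%E ->
  (mass (fun x => u x - v x)%R < +oo)%E.
Proof. by move=> u1 v1; apply: massD_fin; rewrite ?massN. Qed.

Lemma mass_approx u (e : R) : (mass u < +oo)%E -> 0 < e ->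
  exists2 A : set I, finite_set A &
    (mass (fun x => if x \in A then 0%R else u x) <= e%:E)%E.
Proof.
move=> u1 e0; have fu : mass u \is a fin_num by rewrite ge0_fin_numE ?mass_ge0.
have [A [[finA _] hA]] : exists A, fsets [set: I] A /\
    (mass u - e%:E < \sum_(x \in A) (nrm (u x) `^ p)%:E)%E.
  have h : (mass u - e%:E < mass u)%E.
    by rewrite lteBlDr // lteDl // lte_fin.
  by have /ereal_sup_gt [_ [A fA <-] hA] := h; exists A.
exists A => //.
have e1 : mass u = (mass (fun x => if x \in A then u x else 0%R) +
   mass (fun x => if x \in A then 0%R else u x))%E.
  by rewrite -mass_disjoint => [|x]; last (by case: ifP; [right|left]);
    apply: mass_ext => x; case: ifP; rewrite ?addr0 ?add0r.
have e2 : mass (fun x => if x \in A then u x else 0) =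
    (\sum_(x \in A) (nrm (u x) `^ p)%:E)%E.
  rewrite -esum_fset; last by move=> ? ?; rewrite lee_fin powR_ge0.
    rewrite [RHS]esum_mkcond; apply: eq_esum => x _.
    by case: ifP => // _; rewrite nrm0 powR0 // gt_eqF.
  by [].
move: hA fu; rewrite -e2 lteBlDr // {1 2}e1 fin_numD => hA /andP[f1 f2].
move: hA; rewrite -(fineK f1) -(fineK f2) -!EFinD lte_fin lee_fin; lra.
Qed.

End AnyIndex.
End Mass.

(** * Completeness and Neumann series in terms of [p]-th powers *)

Section Completeness.
Variable R : realType.

Lemma limit_of_cauchy (a e : nat -> R) :
  (forall n m, (n <= m)%N -> `|a m - a n| <= e n) ->
  exists l, forall n, `|l - a n| <= e n.
Proof.
move=> ae; have lo n m : a n - e n <= a m + e m.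
  have e0 k : 0 <= e k by apply: le_trans (ae k k _).
  have [nm|/ltnW mn] := leqP n m.
    have := ae _ _ nm; have := e0 m; rewrite ler_norml; lra.
  by have := ae _ _ mn; have := e0 n; rewrite ler_norml; lra.
(* By [lo] each of these lower bounds is below every [a m + e m], so their supremum lies in all the
   intervals at once. *)
pose A := [set a n - e n | n in [set: nat]].
have ubA m : ubound A (a m + e m) by move=> _ [n _ <-].
have A0 : A !=set0 by exists (a 0%N - e 0%N); exists 0%N.
exists (sup A) => n; rewrite ler_norml lerBlDl lerBrDl; apply/andP; split.
  by apply: ub_le_sup; [exists (a 0%N + e 0%N)|exists n].
by apply: ge_sup.
Qed.

Lemma nrm_Re (z : R[i]) : `|complex.Re z| <= nrm z.
Proof.
case: z => a b /=; rewrite -sqrtr_sqr ler_sqrt ?addr_ge0 ?sqr_ge0 //.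
by rewrite lerDl sqr_ge0.
Qed.

Lemma nrm_Im (z : R[i]) : `|complex.Im z| <= nrm z.
Proof.
case: z => a b /=; rewrite -sqrtr_sqr ler_sqrt ?addr_ge0 ?sqr_ge0 //.
by rewrite lerDr sqr_ge0.
Qed.

Lemma nrm_le_ReIm (z : R[i]) : nrm z <= `|complex.Re z| + `|complex.Im z|.
Proof.
case: z => a b; have -> : (a +i* b)%C = (a%:C + (0 +i* b))%C by simpc.
apply: le_trans (nrmD _ _) _; rewrite nrm_real /= addr0 add0r.
by rewrite /nrm /= expr0n /= add0r sqrtr_sqr.
Qed.

Lemma complex_limit_of_cauchy (a : nat -> R[i]) (e : nat -> R) :
  (forall n m, (n <= m)%N -> nrm (a m - a n) <= e n) ->
  exists l, forall n, nrm (l - a n) <= 2 * e n.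
Proof.
move=> ae.
have [r hr] : exists r, forall n, `|r - complex.Re (a n)| <= e n.
  apply: limit_of_cauchy => n m /ae; apply: le_trans.
  by have := nrm_Re (a m - a n); case: (a m) (a n) => ? ? [].
have [s hs] : exists s, forall n, `|s - complex.Im (a n)| <= e n.
  apply: limit_of_cauchy => n m /ae; apply: le_trans.
  by have := nrm_Im (a m - a n); case: (a m) (a n) => ? ? [].
exists (r +i* s)%C => n; apply: le_trans (nrm_le_ReIm _) _.
have := hr n; have := hs n; case: (a n) => x y /=; lra.
Qed.

Lemma powR_inv_le (p a e : R) : 0 < p -> 0 <= a -> a `^ p <= e -> a <= e `^ p^-1.
Proof.
move=> p0 a0 ae; have -> : a = (a `^ p) `^ p^-1.
  by rewrite -powRrM mulfV ?powRr1 // gt_eqF.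
rewrite ge0_ler_powR ?nnegrE ?powR_ge0 ?invr_ge0 ?(ltW p0) //.
exact: le_trans (powR_ge0 _ _) ae.
Qed.

Lemma le_of_geometric (a b N c : R) : 0 <= c < 1 -> 0 <= N ->
  (forall m, a <= b + N * c ^+ m) -> a <= b.
Proof.
move=> /andP[c0 c1] N0 h; apply/ler_addgt0Pr => e e0.
have [N00|Npos] := eqVneq N 0; first by have := h 0%N; rewrite N00; lra.
have Np : 0 < N by rewrite lt0r Npos.
have : (fun m => c ^+ m) @ \oo --> (0 : R).
  by apply: cvg_expr; rewrite ger0_norm.
move/cvgrPdist_lt => /(_ (e / N)); rewrite divr_gt0 // => /(_ isT) [m _ /(_ m (leqnn m))] /=.
rewrite sub0r normrN ger0_norm ?exprn_ge0 // ltr_pdivlMr // => hm.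
by have := h m; lra.
Qed.

Variable p : R.
Hypothesis p1 : 1 <= p.
Variable I : choiceType.
Implicit Types u v g : I -> R[i].
Local Notation mass := (mass p).

(** The limit is taken pointwise, and the bound is checked on finite sets as in Fatou's lemma. *)
Lemma mass_complete (u : nat -> I -> R[i]) (M c : R) : 0 <= M -> 0 <= c < 1 ->
  (forall n k, (mass (fun x => u (n + k)%N x - u n x)%R <= (M * c ^+ n)%:E)%E) ->
  exists2 v, forall n, (mass (fun x => v x - u n x)%R <= (quasi p * (M * c ^+ n))%:E)%E
    & forall x n, nrm (v x - u n x) <= 2 * (M * c ^+ n) `^ p^-1.
Proof.
move=> M0 c01 hu; have /andP[c0 c1] := c01.
have p0 : 0 < p by exact: lt_le_trans p1.
have e0 n : 0 <= M * c ^+ n by rewrite mulr_ge0 ?exprn_ge0.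
have lim x : exists l, forall n, nrm (l - u n x) <= 2 * (M * c ^+ n) `^ p^-1.
  apply: complex_limit_of_cauchy => n m nm.
  have := le_trans (mass_point p _ x) (hu n (m - n)%N); rewrite subnKC // lee_fin => h.
  by apply: powR_inv_le => //; exact: nrm_ge0.
pose v x := xget 0 [set l | forall n, nrm (l - u n x) <= 2 * (M * c ^+ n) `^ p^-1].
have vlim x n : nrm (v x - u n x) <= 2 * (M * c ^+ n) `^ p^-1.
  by rewrite /v; case: xgetP => [y _ /= /(_ n)|] //; have [l hl] := lim x => /(_ l) /(_ hl).
exists v => // n; apply: ge_ereal_sup => /= _ [X [finX _] <-].
rewrite fsbig_finite // sumEFin lee_fin.
pose sX (f : I -> R[i]) : R := \sum_(x <- fset_set X) nrm (f x) `^ p.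
have sXm f (a : R) : (mass f <= a%:E)%E -> sX f <= a.
  move=> fa; rewrite -lee_fin -sumEFin; apply: le_trans fa.
  by rewrite -fsbig_finite //; apply: ereal_sup_ubound; exists X.
(* Replacing [v] by [u (n + k)] on the finite set [X] costs at most [N * c ^+ k], which disappears
   as [k] grows. *)
pose N := quasi p * \sum_(x <- fset_set X) 2 `^ p * M.
apply: (@le_of_geometric _ _ N c) => // [|k].
  rewrite mulr_ge0 ?(ltW (quasi_gt0 _)) // sumr_ge0 // => x _.
  by rewrite mulr_ge0 ?powR_ge0.
rewrite -/(sX _); apply: (@le_trans _ _ (quasi p * (sX (fun x => v x - u (n + k)%N x)
    + sX (fun x => u (n + k)%N x - u n x)))).
  rewrite -big_split /= mulr_sumr; apply: ler_sum => x _; rewrite mulrDr.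
  have h : 0 < (2^-1 : R) < 1 by lra.
  have := powRD_le p1 h (nrm_ge0 (v x - u (n + k)%N x)) (nrm_ge0 (u (n + k)%N x - u n x)).
  have -> : 1 - 2^-1 = 2^-1 :> R by lra.
  apply: le_trans; rewrite ge0_ler_powR ?nnegrE ?addr_ge0 ?nrm_ge0 ?(ltW p0) //.
  by apply: le_trans (nrmD _ _); rewrite addrA subrK.
rewrite mulrDr addrC lerD // ?ler_wpM2l ?(ltW (quasi_gt0 _)) ?sXm //.
rewrite -[leRHS]mulrA ler_wpM2l ?(ltW (quasi_gt0 _)) // mulr_suml; apply: ler_sum => x _.
apply: (@le_trans _ _ ((2 * (M * c ^+ (n + k)) `^ p^-1) `^ p)).
  by rewrite ge0_ler_powR ?nnegrE ?nrm_ge0 ?(ltW p0) ?mulr_ge0 ?powR_ge0 ?ler0n.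
rewrite powRM ?powR_ge0 ?ler0n // -powRrM mulVf ?gt_eqF // powRr1 // -mulrA.
rewrite ler_wpM2l ?powR_ge0 // ler_wpM2l // exprD.
by rewrite ler_piMl ?exprn_ge0 // exprn_ile1 // ltW.
Qed.

Lemma mass_fin_le u : (mass u < +oo)%E -> exists2 M : R, 0 <= M & (mass u <= M%:E)%E.
Proof.
move=> fu; exists (fine (mass u)); first by rewrite fine_ge0 ?mass_ge0.
by rewrite fineK // ge0_fin_numE ?mass_ge0.
Qed.

Section Contraction.
Variable B : (I -> R[i]) -> (I -> R[i]).
Variable nu : R.
Hypothesis nu01 : 0 < nu < 1.
Hypothesis BB : forall u v, B (fun x => u x - v x) = (fun x => B u x - B v x).
Hypothesis Bnu : forall u, (mass (B u) <= (nu `^ p)%:E * mass u)%E.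

Let p0 : 0 < p. Proof. exact: lt_le_trans p1. Qed.
Let c := nu `^ p.
Let c01 : 0 <= c < 1.
Proof.
rewrite powR_ge0 /=; have /andP[n0 n1] := nu01.
have e1 : 1 `^ p = 1 :> R by rewrite powR1.
by rewrite -[ltRHS]e1 gt0_ltr_powR // ?nnegrE ?ler01 // ltW.
Qed.

Lemma contraction_injective u : (mass u < +oo)%E ->
  (forall x, u x + B u x = 0) -> forall x, u x = 0.
Proof.
move=> fu uB; apply: (@mass_eq0 _ p); have [M M0 uM] := mass_fin_le fu.
have e : (mass u <= c%:E * mass u)%E.
  rewrite -{1}(massN p u); apply: le_trans (Bnu u).
  by rewrite le_eqVlt (@mass_ext _ _ _ (fun x => - u x) (B u)) ?eqxx // => x;
     apply/eqP; rewrite eq_sym -addr_eq0 addrC uB.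
move: e fu; case: (mass u) (mass_ge0 p u) => // r r0; rewrite -EFinM !lee_fin in r0 *.
move: c01; nra.
Qed.

Fixpoint picard g n : I -> R[i] :=
  if n is n'.+1 then fun x => g x - B (picard g n') x else fun=> 0.

Lemma picard_step g M n : (mass g <= M%:E)%E -> 0 <= M ->
  (mass (fun x => picard g n.+1 x - picard g n x)%R <= (M * c ^+ n)%:E)%E.
Proof.
move=> gM M0; have B0 : B (fun=> 0) = fun=> 0.
  have e : (fun _ : I => (0 : R[i]) - 0) = fun=> 0 by apply/funext => x; rewrite subrr.
  by move: (BB (fun=> 0) (fun=> 0)); rewrite e => ->; apply/funext => x; rewrite subrr.
elim: n => [|n IHn].
  rewrite expr0 mulr1; apply: le_trans gM; rewrite le_eqVlt; apply/orP; left; apply/eqP.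
  by apply: mass_ext => x /=; rewrite B0 !subr0.
have e : mass (fun x => picard g n.+2 x - picard g n.+1 x)%R =
         mass (B (fun x => picard g n.+1 x - picard g n x)).
  rewrite BB -(massN p (fun x => B _ x - B _ x)).
  by apply: mass_ext => x /=; ring.
rewrite e; apply: le_trans (Bnu _) _; rewrite exprS mulrCA EFinM.
by apply: lee_wpmul2l; rewrite ?lee_fin ?powR_ge0.
Qed.

Lemma contraction_surjective g : (mass g < +oo)%E ->
  exists2 u, (mass u < +oo)%E & forall x, u x + B u x = g x.
Proof.
move=> fg; have [M M0 gM] := mass_fin_le fg; have /andP[n0 n1] := nu01.
(* [K] solves [K = (1 - nu)^(1 - p) + nu * K], the recursion given by [massD_le] with weight
   [1 - nu], because [nu^(1 - p) * nu^p = nu]. Equal weights would lose a factor [quasi] at every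
   step. *)
pose K := (1 - nu) `^ (1 - p) / (1 - nu).
have nn : 0 < 1 - nu by lra.
have K0 : 0 <= K by rewrite divr_ge0 ?powR_ge0 // ltW.
have step n k : (mass (fun x => picard g (n + k)%N x - picard g n x)%R
    <= (K * M * c ^+ n)%:E)%E.
  elim: k n => [n|k IHk n].
    rewrite addn0 (@mass_ext _ _ _ _ (fun=> 0)) => [|x]; last by rewrite subrr.
    rewrite mass0 // lee_fin; apply: mulr_ge0; first exact: mulr_ge0.
    by apply: exprn_ge0; case/andP: c01.
  have t01 : 0 < 1 - nu < 1 by lra.
  have := massD_le p1 (fun x => picard g n.+1 x - picard g n x)
    (fun x => picard g (n.+1 + k)%N x - picard g n.+1 x) t01.
  rewrite (@mass_ext _ _ _ _ (fun x => picard g (n + k.+1)%N x - picard g n x)); last first.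
    by move=> x; rewrite addnS addSn; ring.
  move/le_trans; apply; have -> : 1 - (1 - nu) = nu by ring.
  have le1 (t : R) (a : \bar R) (b : R) : 0 <= t -> (a <= b%:E -> t%:E * a <= (t * b)%:E)%E.
    by move=> t0 ab; rewrite EFinM; apply: lee_wpmul2l; rewrite ?lee_fin.
  apply: le_trans (leeD (le1 _ _ _ (powR_ge0 _ _) (picard_step n gM M0))
    (le1 _ _ _ (powR_ge0 _ _) (IHk n.+1))) _.
  rewrite -EFinD lee_fin.
  have e1 : nu `^ (1 - p) * c = nu.
    by rewrite /c -powRD ?subrK ?powRr1 ?ltW // gt_eqF ?implybT.
  have e2 : (1 - nu) `^ (1 - p) = K * (1 - nu) by rewrite /K divfK // gt_eqF.
  rewrite e2 exprS; have -> : nu `^ (1 - p) * (K * M * (c * c ^+ n)) =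
    (nu `^ (1 - p) * c) * (K * M * c ^+ n) by ring.
  by rewrite e1 le_eqVlt; apply/orP; left; apply/eqP; ring.
have KM0 : 0 <= K * M by rewrite mulr_ge0.
have [u hu _] := mass_complete KM0 c01 step; exists u.
  rewrite (@mass_ext _ _ _ _ (fun x => u x - picard g 0 x)) => [|x]; last by rewrite subr0.
  exact: le_lt_trans (hu 0%N) (ltry _).
move=> x; apply/eqP; rewrite -subr_eq0; apply/eqP; move: x.
apply: (@mass_eq0 _ p); apply/lee_addgt0Pr => e e0; rewrite add0e.
pose Q := quasi p * (quasi p * (K * M) + quasi p * (K * M)).
have tw : 0 <= quasi p by rewrite ltW ?quasi_gt0.
have Q0 : 0 <= Q by apply: mulr_ge0 => //; apply: addr_ge0; apply: mulr_ge0.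
have hn n : (mass (fun x => u x + B u x - g x)%R <= (Q * c ^+ n)%:E)%E.
  rewrite (@mass_ext _ _ _ _ (fun x => (u x - picard g n.+1 x) +
      B (fun x => u x - picard g n x) x)); last by move=> x; rewrite BB /=; ring.
  apply: le_trans (massD p1 _ _) _; rewrite /Q -mulrA EFinM.
  apply: lee_wpmul2l; first by rewrite lee_fin ltW ?quasi_gt0.
  rewrite mulrDl EFinD; apply: leeD.
    apply: le_trans (hu n.+1) _; rewrite lee_fin -[leRHS]mulrA.
    have /andP[cc0 /ltW cc1] := c01.
    by rewrite !ler_wpM2l ?(ltW (quasi_gt0 _)) // exprS ler_piMl ?exprn_ge0.
  apply: le_trans (Bnu _) _; apply: (@le_trans _ _ (1 * mass (fun x => u x - picard g n x)%R)%E).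
    by apply: lee_wpmul2r; rewrite ?mass_ge0 // lee_fin; have /andP[_ /ltW] := c01.
  by rewrite mul1e -mulrA; exact: hu.
have [M' M'0 hM'] : exists2 M' : R, 0 <= M' &
    mass (fun x => u x + B u x - g x)%R = M'%:E.
  have := hn 0%N; have := mass_ge0 p (fun x => u x + B u x - g x).
  by case: (mass _) => // r; rewrite lee_fin; exists r.
rewrite hM' lee_fin; apply: le_trans (ltW e0).
apply: (le_of_geometric c01 Q0) => m; rewrite add0r.
by have := hn m; rewrite hM' lee_fin.
Qed.

End Contraction.
End Completeness.

(** * Spectral decimation *)

Section SchurComplement.
Variable K : fieldType.
Implicit Types (u a b g : flag -> K) (l : K).

Lemma csD u v c : cs (fun x => u x + v x) c = cs u c + cs v c.
Proof. by rewrite /cs -big_split. Qed.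

Lemma csZ k u c : cs (fun x => k * u x) c = k * cs u c.
Proof. by rewrite /cs mulr_sumr. Qed.

Lemma csB u v c : cs (fun x => u x - v x) c = cs u c - cs v c.
Proof. by rewrite /cs -sumrB. Qed.

Lemma cs0 c : cs (fun=> 0 : K) c = 0.
Proof. by rewrite /cs big1. Qed.

Lemma T_D l u v x : T l (fun x => u x + v x) x = T l u x + T l v x.
Proof. rewrite /T !csD /=; ring. Qed.

Lemma T_Z l k u x : T l (fun x => k * u x) x = k * T l u x.
Proof. rewrite /T !csZ /=; ring. Qed.

Lemma T_B l u v x : T l (fun x => u x - v x) x = T l u x - T l v x.
Proof. rewrite /T !csB /=; ring. Qed.

Definition decim l : K := l * (5 - l).
(** The midpoint block of a cell is the all-ones matrix minus [5 - l] times the identity; its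
    eigenvalues are [l - 2] and, twice, [l - 5]. *)
Definition disc l : K := (2 - l) * (5 - l).

(** The midpoint values are those forced by [a] when the midpoint equations are homogeneous. *)
Definition ext l a : flag -> K :=
  glue a (fun x => ((4 - l) * cs a x.1 - (2 - l) * a x) / disc l).

Lemma inv_ext l a : inv a -> inv (ext l a). Proof. exact: inv_glue. Qed.

Lemma res_ext l a : res (ext l a) = a. Proof. exact: res_glue. Qed.

Lemma mid_solve l a b g : 2 - l != 0 -> 5 - l != 0 ->
  (forall x, cs a x.1 - a x + cs b x.1 - (5 - l) * b x = g x) ->
  forall x, b x = ((4 - l) * cs a x.1 - (2 - l) * a x
                   - (2 - l) * g x - cs g x.1) / disc l.
Proof.
move=> l2 l5 h [c i] /=.
have hB : (2 - l) * cs b c = 2 * cs a c - cs g c.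
  rewrite (csE g) -!h /= !csE; ring.
have e : b (c, i) = (cs a c - a (c, i) + cs b c - g (c, i)) / (5 - l).
  by rewrite -(h (c, i)) /=; field.
have -> : b (c, i) = ((2 - l) * (cs a c - a (c, i) - g (c, i)) + (2 - l) * cs b c) / disc l.
  by rewrite e /disc; field; rewrite l2 l5.
by rewrite hB /disc; field; rewrite l2 l5.
Qed.

(** Spectral decimation itself: the Schur complement is again the operator, at [decim l], up to a
    factor that vanishes at 6. *)
Lemma T_ext l a : 2 - l != 0 -> 5 - l != 0 -> inv a ->
  T l (ext l a) = glue (fun x => (6 - l) / disc l * T (decim l) a x) (fun=> 0).
Proof.
move=> l2 l5 ia; rewrite T_glue //; congr glue; apply/funext => x.
  rewrite (ia x) /T /decim /disc !csE; field.
  by rewrite l2 l5.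
by rewrite /disc !csE; field; rewrite l2 l5.
Qed.

Lemma glue0 : glue (fun=> 0) (fun=> 0) = (fun=> 0) :> (flag -> K).
Proof. by apply/funext => x; rewrite /glue; case: ifP. Qed.

Lemma glueD a b a' b' :
  (fun x => glue a b x + glue a' b' x) = glue (fun x => a x + a' x) (fun x => b x + b' x).
Proof. by apply/funext => x; rewrite /glue; case: ifP. Qed.

Lemma ext_kernel l a : 2 - l != 0 -> 5 - l != 0 -> inv a ->
  (forall x, T (decim l) a x = 0) -> forall x, T l (ext l a) x = 0.
Proof.
move=> l2 l5 ia Ta x; rewrite T_ext //.
have -> : (fun x => (6 - l) / disc l * T (decim l) a x) = fun=> 0.
  by apply/funext => y; rewrite Ta mulr0.
by rewrite glue0.
Qed.

Lemma res_kernel l u : 2 - l != 0 -> 5 - l != 0 -> 6 - l != 0 -> inv u ->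
  (forall x, T l u x = 0) ->
  u = ext l (res u) /\ forall x, T (decim l) (res u) x = 0.
Proof.
move=> l2 l5 l6 iu Tu; have ir := inv_res iu.
have uE : u = ext l (res u).
  have := glueE iu => uE; rewrite {1}uE /ext; congr glue; apply/funext => x.
  have Tu0 : T l u = glue (fun=> 0) (fun=> 0) by rewrite glue0; apply/funext.
  move: Tu0; rewrite uE T_glue // -uE => /glue_inj[_ e].
  rewrite (mid_solve l2 l5 (fun x => f_equal (fun f => f x) e)) cs0 /=.
  by congr (_ / _); ring.
split=> // x; have := Tu (lift x); rewrite uE T_ext // glue_lift => /eqP.
rewrite mulf_eq0 mulf_eq0 invr_eq0 mulf_eq0 (negbTE l2) (negbTE l5) (negbTE l6) /=.
by rewrite -uE => /eqP.
Qed.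

(** Clears the midpoint part [g] of a right-hand side using zero coarse values; the remainder is
    supported on coarse vertices. *)
Definition elim l g : flag -> K :=
  glue (fun=> 0) (fun x => - ((2 - l) * g x + cs g x.1) / disc l).

Lemma inv_elim l g : inv (elim l g). Proof. exact: inv_glue. Qed.

Lemma T_elim l g : 2 - l != 0 -> 5 - l != 0 -> exists2 n, inv n &
  T l (elim l g) = glue n g /\
  n = (fun x => (- ((4 - l) * cs g x.1 - (2 - l) * g x) / disc l)
              + (- ((4 - l) * cs g (mate x).1 - (2 - l) * g (mate x)) / disc l)).
Proof.
move=> l2 l5; eexists; last first.
  split; last by [].
  rewrite T_glue //; congr glue; apply/funext => x.
    by rewrite /disc !csE; field; rewrite l2 l5.
  by rewrite /disc !csE; field; rewrite l2 l5.
by move=> x; rewrite mateK addrC.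
Qed.

End SchurComplement.

(** * Transfer of injectivity and surjectivity along decimation *)

Section FlagMass.
Variables (R : realType) (p : R).
Hypothesis p1 : 1 <= p.
Implicit Types (u a b g : flag -> R[i]) (l : R[i]).
Local Notation mass := (mass p).
Local Notation fin u := (mass u%R < +oo)%E.
Let p0 : 0 < p. Proof. exact: lt_le_trans p1. Qed.

(** [mid1 x] and [mid2 x] are the two flags at the midpoint opposite to [x], exchanged by [mate].
    Together with the lifts they partition the flags. *)
Definition mid1 (x : flag) : flag := (sub x.1 (x.2 + 1), x.2 + (1 + 1)).
Definition mid2 (x : flag) : flag := (sub x.1 (x.2 + (1 + 1)), x.2 + 1).

Lemma lift_inj : injective lift.
Proof. by move=> [c i] [d j] [/sub_inj[-> _] ->]. Qed.

Lemma mid1_inj : injective mid1.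
Proof. by move=> [c i] [d j] [/= /sub_inj[-> /(@addIr _ _ i j) ->]]. Qed.

Lemma mid2_inj : injective mid2.
Proof. by move=> [c i] [d j] [/= /sub_inj[-> /(@addIr _ _ i j) ->]]. Qed.

Lemma flagP (x : flag) :
  (exists y, x = lift y) \/ (exists y, x = mid1 y) \/ (exists y, x = mid2 y).
Proof.
rewrite (surjective_pairing x) -(sub_parent x.1).
move: (parent x.1) (digit x.1) x.2 => c j i.
have [->|ij] := eqVneq i j; first by left; exists (c, j).
right; have [h|h] : j = opp i j + 1 /\ i = opp i j + (1 + 1) \/
    j = opp i j + (1 + 1) /\ i = opp i j + 1.
- move: i j ij; apply: I3P; apply: I3P => //= _; rewrite ?oppE;
    by [left; split; apply: val_inj|right; split; apply: val_inj].
- by left; exists (c, opp i j); rewrite /mid1 /= -(proj1 h) -(proj2 h).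
- by right; exists (c, opp i j); rewrite /mid2 /= -(proj1 h) -(proj2 h).
Qed.

Lemma glue_mid1 a b x : glue a b (mid1 x) = b x.
Proof. by case: x => c i; have := mid_glue a b => /(f_equal (fun f => f (c, i))). Qed.

Lemma glue_mid2 a b x : glue a b (mid2 x) = b x.
Proof.
case: x => c i; rewrite glue_sub /=; move: i; apply: I3P; rewrite /=;
  congr (b (_, _)); exact: val_inj.
Qed.

Lemma mass_split u : mass u =
  (mass (fun x => u (lift x)) + (mass (fun x => u (mid1 x)) + mass (fun x => u (mid2 x))))%E.
Proof.
have E0 (f : flag -> \bar R) (s : flag -> flag) : injective s ->
    (\esum_(x in range s) f x = \esum_(x in [set: flag]) f (s x))%E.
  by move=> si; apply: esum_image => x y _ _; exact: si.
have f0 x : (0 <= (nrm (u x) `^ p)%:E)%E by rewrite lee_fin powR_ge0.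
rewrite {1}/mass (esumID (range lift)) //; congr (_ + _)%E.
  by rewrite setTI E0; last exact: lift_inj.
rewrite (esumID (range mid1)) //; congr (_ + _)%E.
  have -> : [set: flag] `&` ~` range lift `&` range mid1 = range mid1.
    apply/seteqP; split=> [x []//|x [[c k] _ <-]]; split; last by exists (c, k).
    split=> // -[[d j] _ [/= /sub_inj[_ ->]]] /addrI.
    by move/(f_equal val).
  by rewrite E0; last exact: mid1_inj.
have -> : [set: flag] `&` ~` range lift `&` ~` range mid1 = range mid2.
  apply/seteqP; split=> [x [[_ nl] n1]|x [[c k] _ <-]].
    have [[y xy]|[[y xy]|[y ->]]] := flagP x; last by exists y.
      by case: nl; exists y.
    by case: n1; exists y.
  split; first split=> // -[[d j] _ [/= /sub_inj[_ ->]]] /addrI /(f_equal val) //.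
  move=> [[d j] _ e]; have := f_equal (fun x => x.2) e.
  have /sub_inj[_] := f_equal (fun x => x.1) e; move: j k {e}.
  by apply: I3P; apply: I3P.
by rewrite E0; last exact: mid2_inj.
Qed.

Lemma mass_glue a b : mass (glue a b) = (mass a + (mass b + mass b))%E.
Proof.
rewrite mass_split; congr (_ + (_ + _))%E; apply: mass_ext => x.
- exact: glue_lift.
- exact: glue_mid1.
- exact: glue_mid2.
Qed.

Lemma fin_glue a b : fin a -> fin b -> fin (glue a b).
Proof. by move=> fa fb; rewrite mass_glue !lte_add_pinfty. Qed.

Lemma fin_glue_inv a b : fin (glue a b) -> fin a /\ fin b.
Proof.
rewrite mass_glue => h; split; apply: le_lt_trans h.
  by rewrite leeDl // adde_ge0 ?mass_ge0.
by rewrite -[leLHS]adde0 addeCA leeD // adde_ge0 ?mass_ge0.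
Qed.

Lemma fin_res u : inv u -> fin u -> fin (res u) /\ fin (mid u).
Proof. by move=> iu fu; apply: fin_glue_inv; rewrite -glueE. Qed.

Lemma fin0 : fin (fun _ : flag => 0). Proof. by rewrite mass0. Qed.

Definition rot (x : flag) : flag := (x.1, x.2 + 1).

Lemma rot_bij : bijective rot.
Proof.
by exists (fun x => (x.1, x.2 - 1)) => -[c i]; rewrite /rot /= ?addrK ?subrK.
Qed.

Lemma cs_rot u x : cs u x.1 = u x + u (rot x) + u (rot (rot x)).
Proof.
case: x => c i; rewrite /rot /= csE.
have -> : 1 + 1 = 2 :> 'I_3 by [].
move: i; apply: I3P.
- by rewrite add0r.
- have -> : 1 + 1 + 1 = 0 :> 'I_3 by apply: val_inj.
  rewrite [u (c, 0) + _]addrC -addrA [_ + u (c, 2)]addrC addrA; congr (_ + _ + _).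
- have -> : 1 + 1 + 1 = 0 :> 'I_3 by apply: val_inj.
  rewrite add0r addrC addrA; congr (_ + _ + _).
Qed.

Lemma bounded_cs : bounded_op p (fun u (x : flag) => cs u x.1).
Proof.
have -> : (fun u (x : flag) => cs u x.1) =
   (fun u x => u x + u (rot x) + u (rot (rot x))) :> ((flag -> R[i]) -> flag -> R[i]).
  by apply/funext => u; apply/funext => x; exact: cs_rot.
apply: (bounded_add p1); first apply: (bounded_add p1).
- exact: bounded_id.
- by apply: bounded_perm; exact: rot_bij.
- by apply: (@bounded_perm _ _ _ (rot \o rot)); apply: bij_comp; exact: rot_bij.
Qed.

Lemma bounded_cs_mate : bounded_op p (fun u (x : flag) => cs u (mate x).1).
Proof.
have := bounded_comp (bounded_perm p mate_bij) bounded_cs.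
exact.
Qed.

Lemma bounded_T l : bounded_op p (T l).
Proof.
apply: (bounded_add p1); last by apply/bounded_opp/bounded_scale; exact: bounded_id.
by apply: (bounded_add p1); [exact: bounded_cs|exact: bounded_cs_mate].
Qed.

Lemma fin_cs u : fin u -> fin (fun x : flag => cs u x.1).
Proof. exact: (bounded_fin bounded_cs). Qed.

Lemma fin_T l u : fin u -> fin (T l u).
Proof. exact: (bounded_fin (bounded_T l)). Qed.

Lemma fin_ext l a : fin a -> fin (ext l a).
Proof.
move=> fa; apply: fin_glue => //.
have -> : (fun x : flag => ((4 - l) * cs a x.1 - (2 - l) * a x) / disc l) =
  (fun x => (disc l)^-1 * ((4 - l) * cs a x.1 - (2 - l) * a x)).
  by apply/funext => x; rewrite mulrC.
by apply/massZ_fin/(massB_fin p1); apply: massZ_fin => //; exact: fin_cs.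
Qed.

Lemma fin_elim l g : fin g -> fin (elim l g).
Proof.
move=> fg; apply: fin_glue; first exact: fin0.
have -> : (fun x : flag => - ((2 - l) * g x + cs g x.1) / disc l) =
  (fun x => - (disc l)^-1 * ((2 - l) * g x + cs g x.1)).
  by apply/funext => x; rewrite mulNr mulrC mulNr.
apply/massZ_fin/(massD_fin p1); first exact: massZ_fin.
exact: fin_cs.
Qed.

Definition injX l := forall u, inv u -> fin u -> (forall x, T l u x = 0) -> forall x, u x = 0.

Definition surjX l := forall g, inv g -> fin g ->
  exists u, [/\ inv u, fin u & forall x, T l u x = g x].

Definition regular l := [/\ 2 - l != 0, 5 - l != 0 & 6 - l != 0].

Lemma injX_pullback l : regular l -> injX (decim l) -> injX l.
Proof.
move=> [l2 l5 l6] il u iu fu Tu; have [uE Tr] := res_kernel l2 l5 l6 iu Tu.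
have r0 : res u = fun=> 0.
  by apply/funext => x; apply: il => //; [exact: inv_res|case: (fin_res iu fu)].
move=> x; rewrite uE r0 /ext.
have -> : (fun x : flag => ((4 - l) * cs (fun=> 0) x.1 - (2 - l) * 0) / disc l) = fun=> 0.
  by apply/funext => y; rewrite cs0 !mulr0 subr0 mul0r.
by rewrite glue0.
Qed.

Lemma injX_pushforward l : 2 - l != 0 -> 5 - l != 0 -> injX l -> injX (decim l).
Proof.
move=> l2 l5 il a ia fa Ta x; rewrite -(res_ext l a).
by apply: (il (ext l a)); [exact: inv_ext|exact: fin_ext|exact: ext_kernel].
Qed.

(** After [elim] has cleared the midpoints the right-hand side is coarse; it is solved at [decim l]
    with the factor of [T_ext] divided out, and the solution is extended. *)
Lemma surjX_pullback l : regular l -> surjX (decim l) -> surjX l.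
Proof.
move=> [l2 l5 l6] sl h ih fh; have [fa fb] := fin_res ih fh.
have [n i_n [Tn _]] := T_elim (mid h) l2 l5.
have fn : fin n by have := fin_T l (fin_elim l fb); rewrite Tn => /fin_glue_inv[].
have [||f [i_f ff Tf]] := sl (fun x => disc l / (6 - l) * (res h x - n x)).
- by move=> x; rewrite i_n (inv_res ih).
- exact/massZ_fin/(massB_fin p1).
exists (fun x => ext l f x + elim l (mid h) x); split.
- by move=> x; rewrite (inv_ext _ i_f) (@inv_elim _ l (mid h)).
- by apply: (massD_fin p1); [exact: fin_ext|exact: fin_elim].
- move=> x; rewrite T_D T_ext // Tn.
  have -> : (fun x => (6 - l) / disc l * T (decim l) f x) = (fun x => res h x - n x).
    apply/funext => y; rewrite Tf /disc; field.
    by rewrite l2 l5 l6.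
  have := f_equal (fun f => f x) (glueD (fun x => res h x - n x) (fun=> 0) n (mid h)).
  move=> /= ->; rewrite [in RHS](glueE ih); congr (glue _ _ x); apply/funext => y.
    by rewrite subrK.
  by rewrite add0r.
Qed.

End FlagMass.

(** * Resolvent and point spectrum *)

Section Resolvent.
Variables (R : realType) (p : R).
Hypothesis p1 : 1 <= p.
Implicit Types (u a b g : flag -> R[i]) (l : R[i]).
Local Notation mass := (mass p).
Local Notation fin u := (mass u%R < +oo)%E.
Let p0 : 0 < p. Proof. exact: lt_le_trans p1. Qed.

Definition spread u (x : flag) : R[i] := cs u x.1 + cs u (mate x).1.

Lemma inv_spread u : inv (spread u).
Proof. by move=> x; rewrite /spread mateK addrC. Qed.

Lemma resolvent_far : exists N : R, forall l, N < nrm (l - 6) ->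
  injX p l /\ surjX p l.
Proof.
have [C C0 hC] : bounded_op p spread.
  by apply: (bounded_add p1); [exact: bounded_cs|exact: bounded_cs_mate].
(* [T l] is [l - 6] times the identity plus [spread], and [C^(1/p)] bounds the norm of [spread];
   beyond this radius the perturbation has norm at most 1/2. *)
exists (2 * C `^ p^-1) => l hl.
have l6 : l - 6 != 0.
  apply: contraTneq hl => ->; rewrite nrm0 -leNgt mulr_ge0 ?powR_ge0 ?ler0n //.
pose B u x := (l - 6)^-1 * spread u x.
have nl : 0 < nrm (l - 6) by exact: nrm_gt0.
have half : 0 < (2^-1 : R) < 1 by lra.
have BB u v : B (fun x => u x - v x) = (fun x => B u x - B v x).
  by apply/funext => x; rewrite /B /spread !csB; ring.
have Bnu u : (mass (B u) <= (2^-1 `^ p)%:E * mass u)%E.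
  apply: le_trans (massZ _ _ _) _.
  apply: le_trans (lee_wpmul2l _ (hC u)) _; first by rewrite lee_fin powR_ge0.
  rewrite muleA -EFinM; apply: lee_wpmul2r; first exact: mass_ge0.
  have e : C = (C `^ p^-1) `^ p by rewrite -powRrM mulVf ?powRr1 // gt_eqF.
  rewrite lee_fin e -powRM ?nrm_ge0 ?powR_ge0 // ge0_ler_powR ?nnegrE ?(ltW p0) //.
  - by rewrite mulr_ge0 ?nrm_ge0 ?powR_ge0.
  - by rewrite nrmV mulrC ler_pdivrMr // mulrC ler_pdivlMr // mulrC ltW.
have TE u x : T l u x = (l - 6) * (u x + B u x).
  by rewrite /T /B /spread; field.
split.
  move=> u iu fu Tu; apply: (contraction_injective p1 half Bnu) => // x.
  by apply: (mulfI l6); rewrite -TE Tu mulr0.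
move=> g ig fg.
have [|u fu hu] := contraction_surjective p1 half BB Bnu (g := fun x => (l - 6)^-1 * g x).
  exact: massZ_fin.
exists u; split=> // x; last by rewrite TE hu mulrA mulfV // mul1r.
(* The Neumann series runs over all functions of flags; invariance of [u] is recovered from the
   equation, as [spread] is always invariant. *)
have h y : u y = (l - 6)^-1 * g y - B u y by rewrite -hu addrK.
by rewrite !h ig /B inv_spread.
Qed.

(* At [l = 2] the Schur complement is singular.  The sums [Y c] of the midpoint
   values of each coarse cell, as a function of the flag [(parent c, digit c)],
   then satisfy an equation in which this contraction perturbs the identity. *)
Definition triple u (x : flag) : R[i] := 2^-1 * (u (mate x) - 5^-1 * cs (u \o mate) x.1).

(** On each cell the coefficients of [u \o mate] are 2/5, -1/10 and -1/10. Their absolute values are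
    3/5 times the convex weights 2/3, 1/6, 1/6, so Jensen applies, and each of the three terms is a
    rearrangement. *)
Lemma triple_contracts u : (mass (triple u) <= ((3 / 5) `^ p)%:E * mass u)%E.
Proof.
rewrite -(mass_perm p u mate_bij); pose w := u \o mate.
have jensen x : nrm (triple u x) `^ p <= (3 / 5) `^ p *
    (2 / 3 * nrm (w x) `^ p + (6^-1 * nrm (w (rot x)) `^ p + 6^-1 * nrm (w (rot (rot x))) `^ p)).
  have e : triple u x = (2 / 5)%:C%C * w x + (- (1 / 10)%:C%C * w (rot x)
       + - (1 / 10)%:C%C * w (rot (rot x))).
    rewrite /triple cs_rot -/w /w /= !(rmorphM, fmorphV, rmorphMn, rmorph1) /=.
    by field.
  have le1 : nrm (triple u x) <= 3 / 5 * (2 / 3 * nrm (w x) + (1 - 2 / 3) *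
      (2^-1 * nrm (w (rot x)) + (1 - 2^-1) * nrm (w (rot (rot x))))).
    rewrite e; apply: le_trans (nrmD _ _) _.
    apply: le_trans (lerD (lexx _) (nrmD _ _)) _.
    by rewrite !nrmM !nrmN !nrm_real !ger0_norm; lra.
  apply: le_trans (_ : _ <= (3 / 5 * (2 / 3 * nrm (w x) + (1 - 2 / 3) *
      (2^-1 * nrm (w (rot x)) + (1 - 2^-1) * nrm (w (rot (rot x)))))) `^ p) _.
    rewrite ge0_ler_powR ?nnegrE ?nrm_ge0 ?(ltW p0) //.
    exact: le_trans (nrm_ge0 _) le1.
  have n1 := nrm_ge0 (w x); have n2 := nrm_ge0 (w (rot x)).
  have n3 := nrm_ge0 (w (rot (rot x))).
  rewrite powRM; [|lra|nra].
  rewrite ler_wpM2l ?powR_ge0 //.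
  have h1 : 0 <= (2 / 3 : R) <= 1 by lra.
  have h2 : 0 <= (2^-1 : R) <= 1 by lra.
  have n23 : 0 <= 2^-1 * nrm (w (rot x)) + (1 - 2^-1) * nrm (w (rot (rot x))) by lra.
  apply: le_trans (powR_convex p1 h1 n1 n23) _.
  by have := powR_convex p1 h2 n2 n3; lra.
pose W (x : flag) := nrm (w x) `^ p.
have W0 x : 0 <= W x by exact: powR_ge0.
have Er (s : flag -> flag) : bijective s ->
    (\esum_(x in [set: flag]) (W (s x))%:E = mass w)%E.
  by move=> bs; exact: (mass_perm p w bs).
apply: (@le_trans _ _ (\esum_(x in [set: flag]) ((3 / 5) `^ p *
    (2 / 3 * W x + (6^-1 * W (rot x) + 6^-1 * W (rot (rot x)))))%:E)%E).
  by apply: le_esum => x _; rewrite lee_fin; exact: jensen.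
have c6 : 0 <= (6^-1 : R) by lra.
have c23 : 0 <= (2 / 3 : R) by lra.
apply: le_trans (esumZ_le _ _) _; rewrite ?powR_ge0 //.
  by move=> x; rewrite !addr_ge0 // mulr_ge0.
apply: lee_wpmul2l; first by rewrite lee_fin powR_ge0.
rewrite (eq_esum (b := fun x => ((2 / 3 * W x)%:E + ((6^-1 * W (rot x))%:E
    + (6^-1 * W (rot (rot x)))%:E))%E)) //.
rewrite esumD; last 2 first.
- by move=> x _; rewrite lee_fin mulr_ge0.
- by move=> x _; rewrite -EFinD lee_fin addr_ge0 // mulr_ge0.
rewrite esumD; try by move=> x _; rewrite lee_fin mulr_ge0.
apply: le_trans (leeD (esumZ_le c23 W0) (leeD (esumZ_le c6 _) (esumZ_le c6 _))) _ => //.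
rewrite Er; last by exists id.
rewrite Er; last exact: rot_bij.
rewrite (Er (rot \o rot)); last by apply: bij_comp; exact: rot_bij.
rewrite -!ge0_muleDl ?lee_fin ?addr_ge0 // -!EFinD.
have -> : 2 / 3 + (6^-1 + 6^-1) = 1 :> R by lra.
by rewrite mul1e.
Qed.

(** With [J] the all-ones matrix on a cell, the inverse of [2 + J] is [(1 - J / 5) / 2]; both sides
    differ by this multiplication. *)
Lemma triple_solve (s : flag -> R[i]) (h : flag -> R[i]) :
  (forall x, s x + triple s x = 2^-1 * (h x - 5^-1 * cs h x.1)) <->
  (forall x, 2 * s x + cs s x.1 + s (mate x) = h x).
Proof.
have cs1 (f : flag -> R[i]) (x : flag) : cs (fun y => cs f y.1) x.1 = 3 * cs f x.1.
  by rewrite csE /=; ring.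
split=> e x; last first.
  have eh : h = (fun y => 2 * s y + cs s y.1 + s (mate y)) by apply/funext => y.
  by rewrite eh !csD cs1 csZ /triple /=; field.
have es : s = fun y => 2^-1 * (h y - 5^-1 * cs h y.1) - triple s y.
  by apply/funext => y; rewrite -e addrK.
have e5 c : 5 * cs s c = cs h c - cs (s \o mate) c.
  rewrite [in LHS]es csB csZ csB csZ /triple csZ csB csZ.
  by rewrite (cs1 h (c, 0)) (cs1 _ (c, 0)) /=; field.
have esx := f_equal (fun f => f x) es; rewrite /= in esx.
rewrite [X in 2 * X]esx; have -> : cs s x.1 = 5^-1 * (5 * cs s x.1) by field.
by rewrite e5 /triple /=; field.
Qed.

Definition par (x : flag) : flag := (parent x.1, digit x.1).

Lemma fin_par s : fin s -> fin (fun x => s (par x)).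
Proof.
move=> fs; rewrite mass_split //.
have e1 : mass (fun x => s (par (lift x))) = mass s.
  by apply: mass_ext => -[c i]; rewrite /par /= parent_sub digit_sub.
have e2 : mass (fun x => s (par (mid1 x))) = mass s.
  rewrite -(mass_perm p s rot_bij).
  by apply: mass_ext => -[c i]; rewrite /par /= parent_sub digit_sub.
have e3 : mass (fun x => s (par (mid2 x))) = mass s.
  have b2 : bijective (rot \o rot) by apply: bij_comp; exact: rot_bij.
  rewrite -(mass_perm p s b2).
  by apply: mass_ext => -[c i]; rewrite /par /= parent_sub digit_sub addrA.
by rewrite e1 e2 e3 !lte_add_pinfty.
Qed.

Lemma fin_cs_sub u : fin u -> fin (fun x => cs u (sub x.1 x.2)).
Proof.
move=> fu; have fj j : fin (fun x => u (sub x.1 x.2, x.2 + j)).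
  apply: le_lt_trans fu; apply: (mass_inj p u (s := fun x => (sub x.1 x.2, x.2 + j))).
  by move=> [c i] [d k] [/= /sub_inj[-> ->]].
rewrite (@mass_ext _ _ _ _ (fun x => u (sub x.1 x.2, x.2 + 0)
     + u (sub x.1 x.2, x.2 + 1) + u (sub x.1 x.2, x.2 + (1 + 1)))); last first.
  move=> x; rewrite (cs_rot u (sub x.1 x.2, x.2)) /rot /= addr0 addrA.
  by [].
by apply: (massD_fin p1) => //; apply: (massD_fin p1).
Qed.

(** The corners [i != j] of the cell [sub d j] lead to its siblings, the corner [j] to the cell
    across the coarse vertex. *)
Lemma cs_sub_mate (s : flag -> R[i]) d j :
  \sum_i s (par (mate (sub d j, i))) = cs s d - s (d, j) + s (mate (d, j)).
Proof.
rewrite (bigD1 j) //= mate_sub eqxx /lift /par /= parent_sub digit_sub.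
rewrite -surjective_pairing addrC; congr (_ + _).
rewrite /cs [in RHS](bigD1 j) //= addrAC subrr add0r.
by apply: eq_bigr => i ij; rewrite mate_sub (negbTE ij) /= parent_sub digit_sub.
Qed.

(** In the sum of the three midpoint equations the coefficient of [cs b] is [l - 2 = 0], so the sum
    constrains [a] instead: [cs a = 0]. Since [a] is the mean of [cs b] over its two cells, this
    becomes a homogeneous equation for the function [cs b] of cells, solved by [triple_solve]. *)
Lemma injX_two : injX p 2.
Proof.
move=> u iu fu Tu; have [fa fb] := fin_res iu fu; have ia := inv_res iu.
move: (glueE iu) ia fa fb; move: (res u) (mid u) => a b uE ia fa fb.
have Tu0 : T 2 u = glue (fun=> 0) (fun=> 0) by rewrite glue0; apply/funext.
rewrite uE T_glue // in Tu0; have [e1 e2] := glue_inj Tu0.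
have {}e1 x := f_equal (fun f => f x) e1; have {}e2 x := f_equal (fun f => f x) e2.
rewrite /= in e1 e2.
have A0 c : cs a c = 0.
  apply/eqP; rewrite -(mulrI_eq0 _ (@mulfI R[i] 2 _)) ?pnatr_eq0 //; apply/eqP.
  transitivity (\sum_i (cs a c - a (c, i) + cs b c - (5 - 2) * b (c, i))).
    by rewrite sum3 !csE; ring.
  by rewrite big1 // => i _; exact: (e2 (c, i)).
have bE x : b x = 3^-1 * (cs b x.1 - a x).
  have := e2 x; rewrite A0 => e; apply/eqP; rewrite -subr_eq0; apply/eqP.
  apply: (@mulfI _ (-3)); first by rewrite oppr_eq0 pnatr_eq0.
  by rewrite mulr0 -e; field.
have aE x : a x = 2^-1 * (cs b x.1 + cs b (mate x).1).
  have := e1 x; rewrite [b x]bE [b (mate x)]bE ia => e.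
  apply/eqP; rewrite -subr_eq0; apply/eqP.
  apply: (@mulfI _ (- (4 / 3))); first by rewrite oppr_eq0 mulf_neq0 ?invr_eq0 ?pnatr_eq0.
  by rewrite mulr0 -e; field.
pose s x := cs b (sub x.1 x.2).
have csP c : cs b c = s (par (c, 0)) by rewrite /s /par /= sub_parent.
have s0 x : s x = 0.
  move: x; have h : 0 < (3 / 5 : R) < 1 by lra.
  apply: (contraction_injective p1 h triple_contracts); first exact: fin_cs_sub.
  move=> x; move: x; have := (triple_solve s (fun=> 0)).2 _.
  move=> H; have {}H := H _; suff K : forall x, 2 * s x + cs s x.1 + s (mate x) = 0.
    by move=> x; rewrite (H K) cs0 mulr0 subrr mulr0.
  move=> [d j]; rewrite /=.
  have := A0 (sub d j); rewrite /cs (eq_bigr (fun i => 2^-1 *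
      (s (d, j) + s (par (mate (sub d j, i)))))) => [|i _]; last first.
    by rewrite aE /s /par /= sub_parent.
  rewrite -mulr_sumr big_split /= cs_sub_mate sumr_const card_ord => e.
  apply/eqP; rewrite -(mulrI_eq0 _ (@mulfI R[i] 2^-1 _)) ?invr_eq0 ?pnatr_eq0 //.
  apply/eqP; apply: etrans e; rewrite -[X in _ + X + _]/(cs s d) -mulr_natl; ring.
have B0 c : cs b c = 0 by rewrite csP s0.
have a0 x : a x = 0 by rewrite aE !B0 addr0 mulr0.
have b0 x : b x = 0 by rewrite bE B0 a0 subr0 mulr0.
move=> x; rewrite uE; have -> : a = fun=> 0 by apply/funext.
by have -> : b = fun=> 0; [apply/funext|rewrite glue0].
Qed.

Lemma surjX_two : surjX p 2.
Proof.
move=> h ih fh; have [fga fgb] := fin_res ih fh; have iga := inv_res ih.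
move: (glueE ih) iga fga fgb; move: (res h) (mid h) => ga gb hE iga fga fgb.
(* [q] is the inhomogeneous term in [a = (Y + Y') / 2 - q], the equation at the coarse vertices; [k]
   is then the right-hand side for [Y] that makes the constraint [2 * cs a = cs gb] hold. *)
pose z x := 2^-1 * cs gb x.1 - gb x.
pose q x := 4^-1 * (3 * ga x + (z x + z (mate x))).
have fz : fin z by apply: (massB_fin p1) => //; apply: massZ_fin; exact: fin_cs.
have fq : fin q.
  apply: massZ_fin; apply: (massD_fin p1); first exact: massZ_fin.
  by apply: (massD_fin p1) => //; rewrite mass_perm //; exact: mate_bij.
have iq : inv q by move=> x; rewrite /q iga mateK [z _ + _]addrC.
pose k (x : flag) := cs gb (sub x.1 x.2) + 2 * cs q (sub x.1 x.2).
have fk : fin k.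
  apply: (massD_fin p1); first exact: fin_cs_sub.
  by apply: massZ_fin; exact: fin_cs_sub.
have half : 0 < (3 / 5 : R) < 1 by lra.
have tB u v : triple (fun x => u x - v x) = (fun x => triple u x - triple v x).
  by apply/funext => x; rewrite /triple /comp csB; ring.
have [|s fs sE] := contraction_surjective p1 half tB triple_contracts
    (g := fun x => 2^-1 * (k x - 5^-1 * cs k x.1)).
  apply: massZ_fin; apply: (massB_fin p1) => //; apply: massZ_fin; exact: fin_cs.
have {}sE := (triple_solve s k).1 sE.
pose Y (c : nat) := s (parent c, digit c).
pose a x := 2^-1 * (Y x.1 + Y (mate x).1) - q x.
have A2 c : 2 * cs a c = cs gb c.
  rewrite -(sub_parent c); move: (parent c) (digit c) => d j.
  have -> : cs a (sub d j) = \sum_i 2^-1 * (s (d, j) + s (par (mate (sub d j, i))))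
       - cs q (sub d j).
    rewrite /cs -sumrB; apply: eq_bigr => i _.
    by rewrite /a /Y /par /= parent_sub digit_sub.
  rewrite -mulr_sumr big_split /= cs_sub_mate sumr_const card_ord.
  have := sE (d, j); rewrite /k /= => e.
  rewrite -[LHS]subr0 -(subrr (cs gb (sub d j) + 2 * cs q (sub d j))) -[in X in _ - (X - _)]e.
  by rewrite -mulr_natl; field.
have ia : inv a by move=> x; rewrite /a iq mateK [Y _ + _]addrC.
pose b x := 3^-1 * (cs a x.1 - a x + Y x.1 - gb x).
have BY c : cs b c = Y c.
  have e : cs b c = Y c + 3^-1 * (2 * cs a c - cs gb c) by rewrite /b !csE /=; field.
  by rewrite e A2 subrr mulr0 addr0.
have fY : fin (fun x : flag => Y x.1) by exact: (fin_par fs).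
have fa : fin a.
  apply: (massB_fin p1) => //; apply: massZ_fin; apply: (massD_fin p1) => //.
  by rewrite (mass_perm p (fun y : flag => Y y.1) mate_bij).
have fb : fin b.
  apply: massZ_fin; apply: (massB_fin p1) => //; apply: (massD_fin p1) => //.
  by apply: (massB_fin p1) => //; exact: fin_cs.
exists (glue a b); split; [exact: inv_glue|exact: fin_glue|].
move=> x; rewrite T_glue // hE; congr (glue _ _ x); apply/funext => y; last first.
  by rewrite BY /b; field.
rewrite !BY.
have e w : Y w.1 - b w = 3^-1 * (2 * Y w.1 + a w - z w).
  have A w' : cs a w'.1 = 2^-1 * cs gb w'.1 by rewrite -A2 mulKf // pnatr_eq0.
  by rewrite /b /z A; field.
by rewrite !e ia /a /q; field.
Qed.

End Resolvent.

(** * Finitely supported eigenfunctions at 5 and 6 *)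

Section EigenfunctionsForbidden.
Variable R : realType.
Implicit Types (u a b : flag -> R[i]) (l : R[i]).

Definition supp_in (A B : nat) u := forall x, ~~ (A <= x.1 < B)%N -> u x = 0.

(** Used as midpoint values, it alternates between 1 and -1 along the six midpoints on the outer
    sides of a triangle made of nine smallest ones, and is 0 on the sides of its central hole. Sums
    over cells and around coarse vertices vanish. *)
Definition loop (d : nat) (x : flag) : R[i] :=
  if parent x.1 == d then
    if x.2 == digit x.1 then 0 else if x.2 == digit x.1 + 1 then 1 else -1
  else 0.

Definition loop5 d := glue (fun=> 0) (loop d).

Lemma inv_loop5 d : inv (loop5 d). Proof. exact: inv_glue. Qed.

Lemma loop_sub d c j i :
  loop d (sub c j, i) = if c == d then if i == j then 0 else
     if i == j + 1 then 1 else -1 else 0.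
Proof. by rewrite /loop /= parent_sub digit_sub. Qed.

Lemma T_loop5 d x : T 5 (loop5 d) x = 0.
Proof.
have csl c : cs (loop d) c = 0.
  rewrite -(sub_parent c); move: (parent c) (digit c) => e j.
  rewrite csE !loop_sub; case: ifP; rewrite ?addr0 // => _.
  by move: j; apply: I3P; rewrite /=; ring.
have lm y : loop d (mate y) = - loop d y.
  rewrite (surjective_pairing y) -(sub_parent y.1) mate_sub.
  move: (parent y.1) (digit y.1) y.2 => e j i.
  have [->|ij] := eqVneq i j.
    case em: (mate (e, j)) => [c k]; rewrite /lift /= !loop_sub !eqxx.
    by do 2 case: ifP; rewrite ?oppr0.
  rewrite !loop_sub; case: ifP; rewrite ?oppr0 // => _.
  by move: i j ij; apply: I3P; apply: I3P; rewrite /= ?opprK.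
rewrite T_glue //; have -> : (fun=> 0 : R[i]) = (fun x : flag => 0) by [].
rewrite -[RHS](f_equal (fun f => f x) (glue0 R[i])); congr (glue _ _ x); apply/funext => y.
  by rewrite !csl lm; ring.
by rewrite csl cs0; ring.
Qed.

Lemma supp_loop5 d : supp_in (9 * d) (9 * d + 9) (loop5 d).
Proof.
move=> x; rewrite /loop5 /glue; case: ifP => // _ hx.
rewrite /loop ifN //=; apply: contra hx => /eqP <-; rewrite /parent; lia.
Qed.

Lemma loop5_neq0 d : exists x, loop5 d x != 0.
Proof.
exists (mid1 (sub d 0, 1)); rewrite /loop5 glue_mid1 loop_sub eqxx /=.
exact: oner_neq0.
Qed.

Lemma supp_ext A B l u : supp_in A B u -> supp_in (3 * A) (3 * B) (ext l u).
Proof.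
move=> su x hx; have h0 i : u (parent x.1, i) = 0.
  by apply: su; apply: contra hx; rewrite /= /parent; lia.
rewrite /ext /glue; case: ifP => // _; rewrite csE !h0 /= !addr0 !mulr0 subr0 mul0r.
by [].
Qed.

(** At 6 the diagonal term of [T] is absent, so it suffices that all cell sums vanish; the midpoint
    values are chosen for that, whatever [a] is. *)
Lemma six_eigenfunction a : inv a ->
  forall x, T 6 (glue a (fun x => a x - 2^-1 * cs a x.1)) x = 0.
Proof.
move=> ia x; set b := fun x : flag => _; set u := glue a b.
have csu c : cs u c = 0.
  rewrite -(sub_parent c) cs_glue /b /= csB.
  have -> : cs (fun x : flag => 2^-1 * cs a x.1) (parent c) = 3 / 2 * cs a (parent c).
    by rewrite csE /=; field.
  by field.
by rewrite /T !csu; ring.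
Qed.

Variable p : R.
Hypothesis p1 : 1 <= p.
Local Notation fin u := (mass p u%R < +oo)%E.

Lemma fin_supp A B u : supp_in A B u -> fin u.
Proof.
move=> su; pose D : set flag := [set` [seq (c, i) | c <- iota 0 B, i <- enum 'I_3]].
have finD : finite_set D by exact: finite_seq.
have uD x : ~ D x -> u x = 0.
  move=> Dx; apply: su; apply/negP => /andP[_ xB]; apply: Dx.
  rewrite /D /=; apply/allpairsP; exists x => /=.
  by rewrite mem_iota mem_enum xB; split=> //; case: x {xB}.
have -> : mass p u = (\esum_(x in D) (nrm (u x) `^ p)%:E)%E.
  rewrite [RHS]esum_mkcond; apply: eq_esum => x _; case: ifPn => // /negP Dx.
  rewrite uD ?nrm0 ?powR0 ?gt_eqF ?(lt_le_trans _ p1) // => Dx'.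
  by apply: Dx; rewrite inE.
rewrite esum_fset //; last by move=> x _; rewrite lee_fin powR_ge0.
by rewrite fsbig_finite // sumEFin ltry.
Qed.

Lemma point5 : ~ injX p 5.
Proof.
move=> i5; have [x /eqP] := loop5_neq0 0; apply.
apply: (i5 (loop5 0)); [exact: inv_loop5| |exact: T_loop5].
exact: (fin_supp (@supp_loop5 0)).
Qed.

Lemma point6 : ~ injX p 6.
Proof.
move=> i6; pose a (x : flag) : R[i] := (x == (0%N, 0))%:R.
have ia : inv a.
  move=> x; rewrite /a; congr (_%:R); apply: congr1.
  by apply/eqP/eqP => [h|->]; rewrite ?mate00 // -(mateK x) h mate00.
have fa : fin a.
  by apply: (@fin_supp 0 1) => -[[|c] i] //= _; rewrite /a.
have := i6 _ (inv_glue _ ia) _ (six_eigenfunction ia) (lift (0%N, 0)).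
rewrite glue_lift /a eqxx => h; have/eqP := oner_neq0 R[i]; apply; apply: h.
apply: fin_glue => //; apply: (massB_fin p1) => //.
by apply: massZ_fin; exact: fin_cs.
Qed.

End EigenfunctionsForbidden.

(** * Backward orbits in the point spectrum, and the resolvent set *)

Section Spectrum.
Variable R : realType.
Implicit Types (l z : R[i]) (n k : nat).

Lemma iter_neg k (x : R) : x < 0 ->
  exists2 y : R, y < 0 & iter k (@decimation R) x%:C%C = y%:C%C.
Proof.
move=> x0; elim: k => [|k [y y0 e]]; first by exists x.
rewrite iterS e; exists (y * (5 - y)); first nra.
by rewrite /decimation !(rmorphM, rmorphB, rmorph_nat).
Qed.

Lemma iter6 k (a : nat) : iter k (@decimation R) 6 = a%:R -> k = 0%N /\ a = 6%N.
Proof.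
case: k => [/= /eqP|k]; first by rewrite eqr_nat => /eqP <-.
rewrite iterSr; have -> : decimation (6 : R[i]) = ((-6) : R)%:C%C.
  by rewrite /decimation !(rmorphN, rmorph_nat); ring.
have [|y y0 ->] := @iter_neg k (-6); first by lra.
rewrite -(rmorph_nat (real_complex R)) => /complexI e.
by move: y0; rewrite e ltrn0.
Qed.

(** The orbit of 2 continues with 6, -6 and stays negative. So 2 is in no backward orbit of 3, 4 or
    5, and [2 - l] may be inverted when eigenfunctions are extended along these. *)
Lemma iter2 k (a : nat) : iter k (@decimation R) 2 = a%:R -> a = 2%N \/ a = 6%N.
Proof.
case: k => [/= /eqP|k]; first by rewrite eqr_nat => /eqP <-; left.
rewrite iterSr; have -> : decimation (2 : R[i]) = 6 by rewrite /decimation; ring.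
by move=> /iter6[_]; right.
Qed.

Lemma iter0 k : iter k (@decimation R) 0 = 0.
Proof. by elim: k => // k; rewrite iterS => ->; rewrite /decimation mul0r. Qed.

Lemma iter5 k : iter k.+1 (@decimation R) 5 = 0.
Proof. by rewrite iterSr; have -> : decimation (5 : R[i]) = 0; [rewrite /decimation; ring|exact: iter0]. Qed.

Lemma iter4 k : iter k (@decimation R) 4 = 4.
Proof. by elim: k => // k; rewrite iterS => ->; rewrite /decimation; ring. Qed.

Lemma julia_preimage l : julia R (decimation l) -> julia R l.
Proof.
move=> [M hM]; exists (Num.max M (nrm l)) => -[|k].
  by rewrite /= le_max lexx orbT.
by rewrite iterSr le_max hM.
Qed.

Lemma julia0 : julia R 0.
Proof. by exists 0 => k; rewrite iter0 Normc.normc0. Qed.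

Lemma julia5 : julia R 5.
Proof.
apply: julia_preimage; have -> : decimation (5 : R[i]) = 0; last exact: julia0.
by rewrite /decimation; ring.
Qed.

Variable p : R.
Hypothesis p1 : 1 <= p.

Lemma point_Sigma5 l : Sigma5 R l -> ~ injX p l.
Proof.
move=> [k _ /=]; elim: k l => [l /= ->|k IHk l]; first exact: point5.
have [->|l5] := eqVneq l 5.
  by rewrite iter5 => /esym/eqP; rewrite pnatr_eq0.
have [->|l2] := eqVneq l 2; first by move/(@iter2 _ 5) => [].
rewrite iterSr => /IHk n il; apply: n; apply: injX_pushforward => //.
  by rewrite subr_eq0 eq_sym.
by rewrite subr_eq0 eq_sym.
Qed.

Lemma point_Sigma6 l : Sigma6 R l -> ~ injX p l.
Proof.
move=> [->|[k _ /=]]; first exact: point6.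
elim: k l => [l /= ->|k IHk l].
  move=> i3; apply: (point6 p1); have -> : 6 = decim 3 :> R[i] by rewrite /decim; ring.
  by apply: injX_pushforward; rewrite // subr_eq0 eqr_nat.
have [->|l5] := eqVneq l 5.
  by rewrite iter5 => /esym/eqP; rewrite pnatr_eq0.
have [->|l2] := eqVneq l 2; first by move/(@iter2 _ 3) => [].
rewrite iterSr => /IHk n il; apply: n; apply: injX_pushforward => //.
  by rewrite subr_eq0 eq_sym.
by rewrite subr_eq0 eq_sym.
Qed.

Lemma resolvent l : ~ julia R l -> ~ Sigma6 R l -> injX p l /\ surjX p l.
Proof.
have [N hN] := resolvent_far p1.
move=> jl; have [k] : exists k, N < nrm (iter k (@decimation R) l - 6).
  apply: contrapT => h; apply: jl; exists (N + nrm 6) => k.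
  rewrite -[X in Normc.normc X](subrK 6); apply: le_trans (nrmD _ _) _.
  rewrite lerD2r leNgt; apply/negP => h'; apply: h; by exists k.
elim: k l jl => [l _ /hN //|k IHk l jl hk s6].
(* The case where induction fails: [R(l) = 6] means [l = 2] or [l = 3], and only 3 belongs to
   [Sigma6]. *)
have [->|l2] := eqVneq l 2; first by split; [exact: injX_two|exact: surjX_two].
have l5 : 5 - l != 0.
  by rewrite subr_eq0; apply/eqP => e; apply: jl; rewrite -e; exact: julia5.
have l6 : 6 - l != 0.
  by rewrite subr_eq0; apply/eqP => e; apply: s6; left.
have rl : regular l by split; rewrite // subr_eq0 eq_sym.
rewrite iterSr in hk; have [||il sl] := IHk _ _ hk.
- by move=> /julia_preimage.
- move=> [e|[m _ em]]; last by apply: s6; right; exists m.+1 => //=; rewrite -iterS iterSr.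
  have : (l - 2) * (l - 3) = 0.
    by have -> : (l - 2) * (l - 3) = 6 - decimation l; [rewrite /decimation; ring|rewrite e subrr].
  move/eqP; rewrite mulf_eq0 !subr_eq0 (negbTE l2) /= => /eqP e3.
  by apply: s6; right; exists 0%N.
by split; [exact: injX_pullback|exact: surjX_pullback].
Qed.

End Spectrum.

(** * The Julia set *)

Section RealDynamics.
Variable R : realType.
Implicit Types (x y : R) (k n : nat).

Definition rdec x : R := x * (5 - x).

Definition bdd x := forall k, 0 <= iter k rdec x <= 5.

Lemma decimation_real x : decimation x%:C%C = (rdec x)%:C%C.
Proof. by rewrite /decimation /rdec !(rmorphM, rmorphB, rmorph_nat). Qed.

Lemma iter_real k x : iter k (@decimation R) x%:C%C = (iter k rdec x)%:C%C.
Proof. by elim: k => // k; rewrite !iterS => ->; rewrite decimation_real. Qed.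

Lemma pow2_unbounded (e c : R) : 0 < e -> exists n, c < 2 ^+ n * e.
Proof.
move=> e0; pose n := Num.bound (c / e); exists n.
rewrite -ltr_pdivrMr //; apply: le_lt_trans (ler_norm _) _.
apply: lt_trans (archi_boundP (normr_ge0 _)) _.
rewrite -natrX ltr_nat; apply: leq_ltn_trans (ltn_expl _ _) => //.
rewrite /n /Num.bound; apply: eq_leq; congr (Num.truncn _).+1.
by rewrite normr_id.
Qed.

Lemma bdd_rdec x : bdd x -> bdd (rdec x).
Proof. by move=> bx k; rewrite -iterSr. Qed.

Lemma bdd_iter k x : bdd x -> bdd (iter k rdec x).
Proof. by move=> bx j; rewrite -iterD. Qed.

(** From [x (5 - x) <= 5]; the bounds are rational approximations of [(5 - sqrt 5) / 2] and
    [(5 + sqrt 5) / 2]. *)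
Lemma bdd_gap x : bdd x -> 0 <= x <= 5 /\ (x <= 7 / 5 \/ 18 / 5 <= x).
Proof.
move=> bx; have /= := bx 0%N; have := bx 1%N; rewrite /= /rdec => h1 h0; split=> //.
have [|h2] := leP x (7 / 5); first by left.
have [|h3] := leP (18 / 5) x; first by right.
nra.
Qed.

(** With [A = 5/2 - z] the map is [A -> A^2 - 15/4]. Outside the disc [|A| <= 5/2] orbits escape;
    staying in it forces the real part of [A^2] to be at least 5/4. Each step multiplies the
    imaginary part of [z] by twice the real part of [A], so a nonzero one would grow. *)
Lemma julia_real (z : R[i]) : julia R z -> exists2 x, z = x%:C%C & bdd x.
Proof.
move=> [M hM].
pose zr k := complex.Re (iter k (@decimation R) z).
pose zi k := complex.Im (iter k (@decimation R) z).
have zr1 k : zr k.+1 = 5 * zr k - zr k ^+ 2 + zi k ^+ 2.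
  by rewrite /zr /zi iterS; case: (iter k _ z) => a b; rewrite /decimation; simpc => /=; ring.
have zi1 k : zi k.+1 = 5 * zi k - 2 * zr k * zi k.
  by rewrite /zr /zi iterS; case: (iter k _ z) => a b; rewrite /decimation; simpc => /=; ring.
pose N k := (5 / 2 - zr k) ^+ 2 + zi k ^+ 2.
have N0 k : 0 <= N k by rewrite addr_ge0 ?sqr_ge0.
have NM k : N k <= 2 * (5 / 2) ^+ 2 + 2 * M ^+ 2 + M ^+ 2.
  have hr : `|zr k| <= M by exact: le_trans (nrm_Re _) (hM k).
  have hi : `|zi k| <= M by exact: le_trans (nrm_Im _) (hM k).
  have sr : zr k ^+ 2 <= M ^+ 2 by rewrite -real_normK ?num_real // lerXn2r ?nnegrE // (le_trans _ hr).
  have si : zi k ^+ 2 <= M ^+ 2 by rewrite -real_normK ?num_real // lerXn2r ?nnegrE // (le_trans _ hi).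
  rewrite /N; have := sqr_ge0 (5 / 2 + zr k); rewrite !expr2 in sr si *; nra.
have step k : 25 / 4 < N k -> 2 * (N k - 25 / 4) <= N k.+1 - 25 / 4.
  move=> h; have : (N k - 15 / 4) ^+ 2 <= N k.+1.
    have -> : N k.+1 = (N k - 15 / 4) ^+ 2 + 15 * zi k ^+ 2.
      by rewrite /N zr1 zi1; field.
    by have := sqr_ge0 (zi k); lra.
  by rewrite expr2; nra.
have N25 k : N k <= 25 / 4.
  rewrite leNgt; apply/negP => hk.
  have grow j : 2 ^+ j * (N k - 25 / 4) <= N (k + j)%N - 25 / 4.
    elim: j => [|j IHj]; first by rewrite expr0 mul1r addn0.
    have p2 : 0 < 2 ^+ j * (N k - 25 / 4) by rewrite mulr_gt0 ?exprn_gt0 ?subr_gt0.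
    rewrite addnS exprS -mulrA.
    have := step (k + j)%N; have -> : 25 / 4 < N (k + j)%N by lra.
    by move/(_ isT); lra.
  have [|j hj] := @pow2_unbounded (N k - 25 / 4) (2 * (5 / 2) ^+ 2 + 2 * M ^+ 2 + M ^+ 2).
    lra.
  have := grow j; have := NM (k + j)%N; lra.
have gap k : 5 / 4 <= (5 / 2 - zr k) ^+ 2 - zi k ^+ 2.
  have := N25 k.+1; rewrite {1}/N zr1 zi1 => h.
  set A := 5 / 2 - zr k in h *; have e : zr k = 5 / 2 - A by rewrite /A; ring.
  rewrite e in h; set B := zi k in h *.
  have h2 : (A ^+ 2 - B ^+ 2 - 15 / 4) ^+ 2 <= 25 / 4.
    have := sqr_ge0 (2 * A * B).
    have e2 : (5 / 2 - (5 * (5 / 2 - A) - (5 / 2 - A) ^+ 2 + B ^+ 2)) ^+ 2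
      + (5 * B - 2 * (5 / 2 - A) * B) ^+ 2 =
      (A ^+ 2 - B ^+ 2 - 15 / 4) ^+ 2 + (2 * A * B) ^+ 2 by field.
    by rewrite e2 in h; lra.
  rewrite leNgt; apply/negP => h3; rewrite expr2 in h2.
  by set D := A ^+ 2 - B ^+ 2 in h2 h3; nra.
have im0 : zi 0%N = 0.
  apply: contrapT => /eqP i0.
  have p0 : 0 < zi 0%N ^+ 2 by rewrite lt0r sqr_ge0 sqrf_eq0 i0.
  have grow j : 2 ^+ j * zi 0%N ^+ 2 <= zi j ^+ 2.
    elim: j => [|j IHj]; first by rewrite expr0 mul1r.
    have -> : zi j.+1 ^+ 2 = 4 * (5 / 2 - zr j) ^+ 2 * zi j ^+ 2 by rewrite zi1; field.
    have h1 := gap j; have h0 := sqr_ge0 (zi j); rewrite [2 ^+ _.+1]exprS -mulrA.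
    have h4 : 2 <= 4 * (5 / 2 - zr j) ^+ 2 by lra.
    by have /= := ler_wpM2r h0 h4; lra.
  have [j hj] := @pow2_unbounded _ (25 / 4) p0.
  have := grow j; have := N25 j; rewrite /N; have := sqr_ge0 (5 / 2 - zr j); lra.
have zE : z = (zr 0%N)%:C%C.
  by move: im0; rewrite /zi /zr /=; case: (z) => a b /= ->.
exists (zr 0%N) => // k.
have zik : zi k = 0 by rewrite /zi zE iter_real.
have := N25 k; rewrite /N zik expr0n addr0.
have -> : iter k rdec (zr 0%N) = zr k by rewrite [in RHS]/zr zE iter_real.
by move=> h; apply/andP; rewrite expr2 in h; split; nra.
Qed.

(** Below 1 a point is multiplied by [5 - x], more than 4, so a positive orbit cannot stay there.
    These returns keep the telescoped product [R^k(x) / x] away from 0. *)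
Lemma orbit_returns x : bdd x -> (forall k, iter k rdec x <> 5) -> x != 0 ->
  forall n, exists2 k, (n <= k)%N & 1 <= iter k rdec x.
Proof.
move=> bx x5 x0 n; have xn k : 0 < iter k rdec x.
  elim: k => [|k IHk]; first by have /andP[h _] := bx 0%N; rewrite lt0r x0.
  rewrite iterS /rdec mulr_gt0 // subr_gt0 lt_neqAle; apply/andP; split.
    by apply/eqP; exact: x5.
  by have /andP[_] := bx k.
apply: contrapT => h.
have lt1 k : iter (n + k) rdec x < 1.
  rewrite ltNge; apply/negP => h1; apply: h; exists (n + k)%N => //; exact: leq_addr.
have grow j : 2 ^+ j * iter n rdec x <= iter (n + j) rdec x.
  elim: j => [|j IHj]; first by rewrite expr0 mul1r addn0.
  have := lt1 j; have := xn (n + j)%N; rewrite addnS iterS exprS -mulrA.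
  move: IHj; rewrite /rdec; move: (iter (n + j) rdec x) => y; nra.
have [j hj] := @pow2_unbounded _ 1 (xn n).
by have := grow j; have := lt1 j; lra.
Qed.

(** Pull back 5 along the inverse branches [5/2 - s] or [5/2 + s], always on the side of the orbit
    of [x]. By the gap both [s] and [|5/2 - x|] are at least 11/10, so each pull-back halves the
    distance. *)
Lemma approx_Sigma5 n x : bdd x ->
  exists y, [/\ iter n rdec y = 5, 0 <= y <= 5 & `|x - y| <= 5 * 2^-1 ^+ n].
Proof.
elim: n x => [|n IHn] x bx.
  exists 5; split=> //; first lra.
  by have /= := bx 0%N; rewrite expr0 mulr1 ler_norml; lra.
have [y [hy y05 xy]] := IHn _ (bdd_rdec bx).
have [x05 gx] := bdd_gap bx.
pose s := Num.sqrt (25 / 4 - y).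
have s2 : s * s = 25 / 4 - y by rewrite -expr2 sqr_sqrtr //; lra.
have s0 : 0 <= s by exact: sqrtr_ge0.
have s1 : 11 / 10 <= s by nra.
have sM : s <= 5 / 2 by nra.
have key w : 11 / 10 <= w -> w * w = 25 / 4 - rdec x -> `|w - s| <= 5 * 2^-1 ^+ n.+1.
  move=> w1 w2; have e : `|w - s| * (w + s) = `|rdec x - y|.
    rewrite -[X in _ * X = _]ger0_norm ?addr_ge0 //; last by lra.
    by rewrite -normrM distrC; congr `|_|; rewrite mulrBl !mulrDr w2 s2; ring.
  rewrite exprS; have := xy; rewrite -e; have := normr_ge0 (w - s); nra.
have fin y' : (5 / 2 - y') * (5 / 2 - y') = s * s -> iter n.+1 rdec y' = 5.
  move=> e; rewrite iterSr; have -> : rdec y' = y; last by [].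
  by rewrite /rdec; lra.
have [xl|xh] := gx.
- exists (5 / 2 - s); split; first by apply: fin; ring.
    lra.
  have -> : x - (5 / 2 - s) = - (5 / 2 - x - s) by ring.
  by rewrite normrN; apply: key; [lra|rewrite /rdec; field].
- exists (5 / 2 + s); split; first by apply: fin; ring.
    lra.
  have -> : x - (5 / 2 + s) = x - 5 / 2 - s by ring.
  by apply: key; [lra|rewrite /rdec; field].
Qed.

Fixpoint prod3 k x : R := if k is k'.+1 then (3 - x) * prod3 k' (rdec x) else 1.

(* Lyapunov weight: a factor [|3 - x| < 1] occurs only just below the repelling
   fixed point 4, and is repaid by the next factor. *)
Definition weight x : R := if 4 <= x then x - 3 else 1.

Lemma weight_bounds x : x <= 5 -> 1 <= weight x <= 2.
Proof. by rewrite /weight => x5; case: (leP 4 x) => ?; apply/andP; split; lra. Qed.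

Lemma weight_step x : bdd x -> weight x <= `|3 - x| * weight (rdec x).
Proof.
move=> bx; have [x05 gx] := bdd_gap bx.
have [rx05 _] := bdd_gap (bdd_rdec bx).
have /weight_bounds/andP[w1 w2] : rdec x <= 5 by case/andP: rx05.
rewrite {1}/weight; case: (leP 4 x) => h4.
  rewrite distrC ger0_norm; [nra|lra].
case: gx => hx; first by rewrite ger0_norm; [nra|lra].
rewrite distrC ger0_norm; last by lra.
have r4 : 4 <= rdec x by rewrite /rdec; nra.
rewrite /weight r4 /rdec.
have -> : x = 4 - (4 - x) by ring.
set e := 4 - x; have e0 : 0 < e <= 2 / 5 by rewrite /e; lra.
have -> : (4 - e - 3) * ((4 - e) * (5 - (4 - e)) - 3) = 1 + e * (2 - 4 * e + e * e) by ring.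
nra.
Qed.

(** A uniform gain at points away from 4; [leaves_four] makes it occur again and again. *)
Lemma weight_grow x : bdd x -> x <= 39 / 10 ->
  21 / 20 * weight x <= `|3 - x| * weight (rdec x).
Proof.
move=> bx x4; have [x05 gx] := bdd_gap bx.
have [rx05 _] := bdd_gap (bdd_rdec bx).
have /weight_bounds/andP[w1 w2] : rdec x <= 5 by case/andP: rx05.
rewrite {1}/weight; case: (leP 4 x) => h4; first by lra.
case: gx => hx; first by rewrite ger0_norm; [nra|lra].
rewrite distrC ger0_norm; last by lra.
have r4 : 4 <= rdec x by rewrite /rdec; nra.
rewrite /weight r4 /rdec.
have -> : x = 4 - (4 - x) by ring.
set e := 4 - x; have e0 : 1 / 10 <= e <= 2 / 5 by rewrite /e; lra.
have -> : (4 - e - 3) * ((4 - e) * (5 - (4 - e)) - 3) = 1 + e * (2 - 4 * e + e * e) by ring.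
nra.
Qed.

Lemma prod3S k x : prod3 k.+1 x = prod3 k x * (3 - iter k rdec x).
Proof.
elim: k x => [|k IHk] x; first by rewrite /= mul1r mulr1.
by rewrite iterSr [LHS]/= -/(prod3 k.+1 (rdec x)) IHk /= mulrA.
Qed.

Lemma prod3_weight k x : bdd x ->
  weight x <= `|prod3 k x| * weight (iter k rdec x).
Proof.
move=> bx; elim: k => [|k IHk]; first by rewrite /= normr1 mul1r.
apply: le_trans IHk _; rewrite prod3S normrM -mulrA ler_wpM2l //.
by rewrite iterS; exact/weight_step/bdd_iter.
Qed.

(** A point above 41/10 is sent below 39/10, and between the two the distance to 4 is multiplied by
    [y - 1], more than 2. *)
Lemma leaves_four x : bdd x -> (forall k, iter k rdec x <> 4) ->
  exists k, iter k rdec x <= 39 / 10.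
Proof.
move=> bx x4; apply: contrapT => h.
have lo k : 39 / 10 < iter k rdec x.
  by rewrite ltNge; apply/negP => hk; apply: h; exists k.
have hi k : iter k rdec x < 41 / 10.
  rewrite ltNge; apply/negP => hk; have := lo k.+1; rewrite iterS.
  by move: (bx k) hk; rewrite /rdec; move: (iter k rdec x) => y; nra.
have grow j : 2 ^+ j * `|4 - x| <= `|4 - iter j rdec x|.
  elim: j => [|j IHj]; first by rewrite expr0 mul1r.
  rewrite iterS exprS -mulrA; move: IHj (lo j) (hi j); move: (iter j rdec x) => y.
  have -> : 4 - rdec y = - (y - 1) * (4 - y) by rewrite /rdec; ring.
  rewrite normrM normrN => IHj l1 l2; rewrite (@ger0_norm _ (y - 1)); last by lra.
  by have := normr_ge0 (4 - y); nra.
have x40 : 0 < `|4 - x|.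
  by rewrite normr_gt0 subr_eq0 eq_sym; apply/eqP; exact: (x4 0%N).
have [j hj] := @pow2_unbounded _ 1 x40.
have := grow j; have : `|4 - iter j rdec x| <= 1.
  by rewrite ler_norml; have := lo j; have := hi j; lra.
lra.
Qed.

Lemma prod3_unbounded x : bdd x -> (forall k, iter k rdec x <> 4) ->
  forall M, exists k, M <= `|prod3 k x|.
Proof.
move=> bx x4.
have grow m : exists k, (21 / 20) ^+ m <= `|prod3 k x| * weight (iter k rdec x).
  elim: m => [|m [k hk]].
    by exists 0%N; rewrite /= normr1 mul1r expr0; case/andP: (weight_bounds (x := x) (proj2 (andP (bx 0%N)))).
  have by_ := bdd_iter k bx.
  have [|j hj] := leaves_four by_; first by move=> j; rewrite -iterD; exact: x4.
  exists (k + j).+1; rewrite exprS.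
  have split n : prod3 (k + n) x = prod3 k x * prod3 n (iter k rdec x).
    elim: n => [|n IHn]; first by rewrite addn0 mulr1.
    by rewrite addnS !prod3S IHn mulrA addnC iterD.
  have w1 := prod3_weight j by_; have w2 := weight_grow (bdd_iter j by_) hj.
  rewrite prod3S split iterS addnC iterD !normrM.
  have h1 : 21 / 20 * (21 / 20) ^+ m <= 21 / 20 * (`|prod3 k x| *
      (`|prod3 j (iter k rdec x)| * weight (iter j rdec (iter k rdec x)))).
    by rewrite ler_wpM2l //; apply: le_trans hk _; rewrite ler_wpM2l.
  have h2 := ler_wpM2l (normr_ge0 (prod3 k x))
    (ler_wpM2l (normr_ge0 (prod3 j (iter k rdec x))) w2).
  by rewrite /= in h2; lra.
move=> M; have [m hm] : exists m, 2 * M <= (21 / 20 : R) ^+ m.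
  have [n hn] := @pow2_unbounded 1 (2 * M) ltr01.
  (* 15 is large enough for [(21 / 20) ^+ 15] to exceed 2. *)
  exists (15 * n)%N; rewrite exprM; apply: le_trans (ltW hn) _; rewrite mulr1.
  by rewrite lerXn2r ?nnegrE ?exprn_ge0 //; lra.
have [k hk] := grow m; exists k.
have /andP[_ /weight_bounds w] := bx k.
by have := normr_ge0 (prod3 k x); nra.
Qed.

End RealDynamics.

(** * Injectivity and non-surjectivity on the Julia set *)

Section Kernel.
Variable R : realType.
Implicit Types (u w : flag -> R[i]) (l : R[i]) (x : R) (s y : flag).

(* Along the lifts of these three flags an [l^p] function tends to 0, whereas a
   solution of the eigenvalue equation takes values there that are controlled by
   its values near the corner. *)
Definition special s := [\/ s = (0%N, 1), s = (0%N, 1 + 1) | s = (1%N, 1 + 1)].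

Definition decays u := forall s, special s -> forall e : R, 0 < e ->
  exists n, forall k, (n <= k)%N -> nrm (u (iter k lift s)) <= e.

Lemma iter_lift00 k : iter k lift (0%N, 0) = (0%N, 0).
Proof. by elim: k => // k; rewrite iterS => ->. Qed.

Lemma iter_lift_ge s k : special s -> (k <= (iter k lift s).1)%N.
Proof.
move=> ss; have e : (iter k lift s).2 = s.2 by elim: k => // k; rewrite iterS.
have s2 : (0 < s.2)%N by case: ss => ->.
elim: k e => // k IHk; rewrite iterS /= => e; have := IHk e; rewrite e /sub; lia.
Qed.

Lemma ext_sub l a c j i : ext l a (sub c j, i) =
  if i == j then a (c, i) else ((4 - l) * cs a c - (2 - l) * a (c, opp i j)) / disc l.
Proof. exact: glue_sub. Qed.

Lemma kernel_corner l w : (forall y, T l w y = 0) ->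
  2 * (w (0%N, 1) + w (0%N, 1 + 1)) = (4 - l) * w (0%N, 0).
Proof.
move/(_ (0%N, 0)); rewrite /T mate00 /= csE => e.
by apply/eqP; rewrite -subr_eq0 -e; apply/eqP; ring.
Qed.

Section RegularStep.
Variables (l : R[i]) (w : flag -> R[i]).
Hypotheses (rl : regular l) (iw : inv w) (Tw : forall y, T l w y = 0).

(** The flag is at the midpoint opposite to the boundary point. The corner equation for [res w] at
    [decim l] eliminates the two other coarse values. *)
Lemma kernel_mid : w (1%N, 1 + 1) = (2 - l) / 2 * w (0%N, 0).
Proof.
have [l2 l5 l6] := rl; have [wE Tr] := res_kernel l2 l5 l6 iw Tw.
have w0 : w (0%N, 0) = res w (0%N, 0) by [].
have wm : w (1%N, 1 + 1) =
    ((4 - l) * cs (res w) 0 - (2 - l) * res w (0%N, 0)) / disc l.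
  by rewrite wE; have := ext_sub l (res w) 0 1 (1 + 1); rewrite /= oppE -wE.
have h := kernel_corner Tr; rewrite wm w0 csE.
have -> : res w (0%N, 0) + res w (0%N, 1) + res w (0%N, 1 + 1) =
  res w (0%N, 0) + 2^-1 * (2 * (res w (0%N, 1) + res w (0%N, 1 + 1))) by field.
by rewrite h /decim /disc; field; rewrite l2 l5.
Qed.

(** In the difference of the two midpoints next to the boundary point the term in [cs] cancels. *)
Lemma kernel_antisym :
  (5 - l) * (w (0%N, 1) - w (0%N, 1 + 1)) = res w (0%N, 1) - res w (0%N, 1 + 1).
Proof.
have [l2 l5 l6] := rl; have [wE Tr] := res_kernel l2 l5 l6 iw Tw.
have w1 : w (0%N, 1) =
    ((4 - l) * cs (res w) 0 - (2 - l) * res w (0%N, 1 + 1)) / disc l.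
  by rewrite wE; have := ext_sub l (res w) 0 0 1; rewrite /= oppE -wE.
have w2 : w (0%N, 1 + 1) =
    ((4 - l) * cs (res w) 0 - (2 - l) * res w (0%N, 1)) / disc l.
  by rewrite wE; have := ext_sub l (res w) 0 0 (1 + 1); rewrite /= oppE -wE.
by rewrite w1 w2 /disc; field; rewrite l2 l5.
Qed.

End RegularStep.

Definition avoid5 x := forall k, iter k (@rdec R) x <> 5.

Lemma avoid5_rdec x : avoid5 x -> avoid5 (rdec x).
Proof. by move=> hx k; rewrite -iterSr. Qed.

Lemma avoid5_iter k x : avoid5 x -> avoid5 (iter k (@rdec R) x).
Proof. by move=> hx j; rewrite -iterD. Qed.

Lemma regular_real x : bdd x -> avoid5 x -> regular x%:C%C.
Proof.
move=> bx ax; have [x05 gx] := bdd_gap bx.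
have h n : n%:R - x != 0 -> n%:R - x%:C%C != 0 :> R[i].
  by move=> nx; rewrite -(rmorph_nat (real_complex R)) -rmorphB fmorph_eq0.
split; apply: h.
- by apply/eqP => e; case: gx => h; lra.
- by rewrite subr_eq0 eq_sym; apply/eqP; exact: (ax 0%N).
- by apply/eqP => e; lra.
Qed.

Lemma decim_real x : decim x%:C%C = (rdec x)%:C%C.
Proof. exact: decimation_real. Qed.

Definition resk k u : flag -> R[i] := fun y => u (iter k lift y).

Lemma res_resk k u : res (resk k u) = resk k.+1 u.
Proof. by apply/funext => y; rewrite /res /resk iterSr. Qed.

Lemma kernel_resk x w k : bdd x -> avoid5 x -> inv w ->
  (forall y, T x%:C%C w y = 0) ->
  inv (resk k w) /\ forall y, T (iter k (@rdec R) x)%:C%C (resk k w) y = 0.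
Proof.
move=> bx ax iw Tw; elim: k => [//|k [ik Tk]].
have rk := regular_real (bdd_iter k bx) (@avoid5_iter k _ ax).
have [k2 k5 k6] := rk; have [_ Tr] := res_kernel k2 k5 k6 ik Tk.
by rewrite -res_resk iterS -decim_real; split=> //; exact: inv_res.
Qed.

Lemma kernel_decay_corner x w : bdd x -> avoid5 x -> inv w ->
  (forall y, T x%:C%C w y = 0) -> decays w -> forall i, w (0%N, i) = 0.
Proof.
move=> bx ax iw Tw dw.
pose xk k := iter k (@rdec R) x.
have rk k : regular (xk k)%:C%C by apply: regular_real; [exact: bdd_iter|exact: avoid5_iter].
have ker k := kernel_resk k bx ax iw Tw.
have w0 : w (0%N, 0) = 0.
  apply: nrm_eq0; apply/eqP; rewrite eq_le nrm_ge0 andbT; apply/ler_addgt0Pr => e e0.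
  have e4 : 0 < e / 4 by lra.
  have [n /(_ n (leqnn n))] := dw _ (Or33 _ _ (erefl _)) _ e4.
  have [ik Tk] := ker n; rewrite -/(resk n w _) (kernel_mid (rk n) ik Tk).
  rewrite /resk iter_lift00 nrmM => h.
  have h3 : 3 / 10 <= nrm ((2 - (xk n)%:C%C) / 2).
    have -> : (2 - (xk n)%:C%C) / 2 = ((2 - xk n) / 2)%:C%C.
      by rewrite rmorphM fmorphV rmorphB !rmorph_nat.
    rewrite nrm_real; have [x05 [g|g]] := bdd_gap (bdd_iter n bx).
      by rewrite ger0_norm; rewrite -/(xk n) in g *; lra.
    by rewrite ler0_norm; rewrite -/(xk n) in g *; lra.
  by have := nrm_ge0 (w (0%N, 0)); nra.
pose a k := nrm (resk k w (0%N, 1) - resk k w (0%N, 1 + 1)).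
have aS k : a k.+1 = (5 - xk k) * a k.
  have [ik Tk] := ker k; rewrite /a -res_resk -(kernel_antisym (rk k) ik Tk) nrmM.
  have -> : 5 - (xk k)%:C%C = (5 - xk k)%:C%C by rewrite rmorphB rmorph_nat.
  by rewrite nrm_real ger0_norm // subr_ge0; case/andP: (bx k).
have a_small e : 0 < e -> exists n, forall k, (n <= k)%N -> a k <= e.
  move=> e0; have e2 : 0 < e / 2 by lra.
  have [n1 h1] := dw _ (Or31 _ _ (erefl _)) _ e2.
  have [n2 h2] := dw _ (Or32 _ _ (erefl _)) _ e2.
  exists (maxn n1 n2) => k; rewrite geq_max => /andP[/h1 k1 /h2 k2].
  by apply: le_trans (nrmB _ _) _; rewrite /resk; lra.
have a0 : a 0%N = 0.
  apply/eqP; rewrite eq_le nrm_ge0 andbT; apply/ler_addgt0Pr => e e0; rewrite add0r.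
  have e5 : 0 < e / 5 by lra.
  have [n hn] := a_small _ e5.
  have [x0|x0] := eqVneq x 0.
    have xk0 k : xk k = 0.
      by rewrite /xk x0; elim: k => // k; rewrite iterS => ->; rewrite /rdec mul0r.
    have : a 0%N <= a n.
      elim: (n) => // k IHk; rewrite aS xk0; have := nrm_ge0 (w (0%N, 1) - w (0%N, 1 + 1)).
      by rewrite -/(a 0%N); lra.
    by have := hn n (leqnn n); lra.
  (* The factors [5 - xk j] telescope, being [xk j.+1 / xk j]. *)
  have prop k : x * a k = xk k * a 0%N.
    elim: k => [//|k IHk]; rewrite aS mulrCA IHk /xk iterS /rdec -/(xk k); ring.
  have [k nk xk1] := orbit_returns bx ax x0 n.
  have ha := hn k nk; have := prop k; rewrite -/(xk k) in xk1 * => pk.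
  have := nrm_ge0 (resk 0 w (0%N, 1) - resk 0 w (0%N, 1 + 1)); rewrite -/(a 0%N) => a00.
  have := nrm_ge0 (resk k w (0%N, 1) - resk k w (0%N, 1 + 1)); rewrite -/(a k) => ak0.
  have /= x05 := bx 0%N; nra.
have w12 : w (0%N, 1) = w (0%N, 1 + 1).
  by apply/eqP; rewrite -subr_eq0; apply/eqP/nrm_eq0; exact: a0.
have w1 : w (0%N, 1) = 0.
  have := kernel_corner Tw; rewrite w0 mulr0 -w12 => e.
  have e4 : 4 * w (0%N, 1) = 0 by rewrite -e; ring.
  by move/eqP: e4; rewrite mulf_eq0 pnatr_eq0 => /eqP.
by apply: I3P => //; rewrite -w12.
Qed.

Lemma decays_res w : decays w -> decays (res w).
Proof.
move=> dw s ss e e0; have [n hn] := dw s ss e e0; exists n => k nk.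
by rewrite /res -iterS; apply: hn; exact: leqW.
Qed.

(** Induction on the digits of the cell with [x] and [w] generalized: the values on [sub c j] are
    fixed by those of [res w] on [c], a kernel function at [rdec x]. *)
Lemma kernel_decay x w : bdd x -> avoid5 x -> inv w ->
  (forall y, T x%:C%C w y = 0) -> decays w -> forall y, w y = 0.
Proof.
move=> bx ax iw Tw dw [c]; move: c x w bx ax iw Tw dw.
apply: cell_ind => [x w bx ax iw Tw dw|c j IHc x w bx ax iw Tw dw i].
  exact: kernel_decay_corner.
have [l2 l5 l6] := regular_real bx ax.
have [wE Tr] := res_kernel l2 l5 l6 iw Tw; rewrite decim_real in Tr.
have r0 := IHc _ _ (bdd_rdec bx) (avoid5_rdec ax) (inv_res iw) Tr (decays_res dw).
by rewrite wE ext_sub csE !r0 !addr0 !mulr0 subr0 mul0r if_same.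
Qed.

Variable p : R.
Hypothesis p1 : 1 <= p.
Local Notation mass := (mass p).
Local Notation fin u := (mass u%R < +oo)%E.
Let p0 : 0 < p. Proof. exact: lt_le_trans p1. Qed.

Lemma fin_tail u (e : R) : fin u -> 0 < e ->
  exists n, (mass (fun y => if (n <= y.1)%N then u y else 0)%R <= e%:E)%E.
Proof.
move=> fu e0; have [A finA hA] := mass_approx p1 fu e0.
exists (\max_(y <- fset_set A) y.1).+1; apply: le_trans hA; apply: (mass_le p1) => y.
case: ifP => [hy|_]; last by rewrite nrm0 nrm_ge0.
case: ifP => // yA; move: hy; rewrite ltnNge => /negP[].
by apply: (@leq_bigmax_seq _ _ xpredT (fun z : flag => z.1) y) => //; rewrite in_fset_set.
Qed.

Lemma fin_decays u : fin u -> decays u.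
Proof.
move=> fu s ss e e0; have ep : 0 < e `^ p by exact: powR_gt0.
have [n hn] := fin_tail fu ep; exists n => k nk.
have := le_trans (mass_point p _ (iter k lift s)) hn.
rewrite (leq_trans nk (iter_lift_ge k ss)) lee_fin => h.
rewrite leNgt; apply/negP => h'; move: h; rewrite leNgt => /negP; apply.
by rewrite gt0_ltr_powR // ?nnegrE ?nrm_ge0 // ltW.
Qed.

Lemma injX_julia x : bdd x -> avoid5 x -> injX p x%:C%C.
Proof.
by move=> bx ax u iu fu Tu; apply: (kernel_decay bx ax iu Tu); exact: fin_decays.
Qed.

(** Covers all lifts of the special flags. A sum of such functions therefore satisfies [decays] even
    when it is not in the [l^p] space. *)
Definition vanishing u := forall k y, (y.1 < 3)%N -> u (iter k lift y) = 0.

Lemma loop_family k l n : iter k (@decimation R) l = 5 -> (0 < n)%N ->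
  exists v A B, [/\ inv v, forall y, T l v y = 0, supp_in A B v & (n <= A)%N]
    /\ vanishing v /\ exists y, v y != 0.
Proof.
have base : (0 < n)%N -> exists v A B,
    [/\ inv v, forall y, T 5 v y = 0, supp_in A B v & (n <= A)%N]
    /\ vanishing v /\ exists y, v y != 0 :> R[i].
  move=> n0; exists (loop5 R n), (9 * n)%N, (9 * n + 9)%N; split; last split.
  - split; [exact: inv_loop5|exact: T_loop5|exact: supp_loop5|by lia].
  - case=> [|j] y y3; last by rewrite iterS /loop5 glue_lift.
    by apply: supp_loop5; rewrite /=; lia.
  - exact: loop5_neq0.
elim: k l => [l /= ->|k IHk l]; first exact: base.
have [->|l5] := eqVneq l 5; first by move=> _; exact: base.
have [->|l2] := eqVneq l 2; first by move/(@iter2 _ _ 5) => [].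
rewrite iterSr => /IHk {}IHk n0; have [v [A [B [[iv Tv sv nA] [zv [y vy]]]]]] := IHk n0.
have d2 : 2 - l != 0 by rewrite subr_eq0 eq_sym.
have d5 : 5 - l != 0 by rewrite subr_eq0 eq_sym.
exists (ext l v), (3 * A)%N, (3 * B)%N; split; last split.
- split; [exact: inv_ext|exact: ext_kernel|exact: supp_ext|by lia].
- case=> [|m] z z3; last by rewrite iterS /ext glue_lift; exact: zv.
  rewrite /= (surjective_pairing z) -(sub_parent z.1).
  have -> : parent z.1 = 0%N by rewrite /parent; lia.
  have v0 i : v (0%N, i) = 0 by exact: (zv 0%N (0%N, i)).
  by rewrite ext_sub csE !v0 !addr0 !mulr0 subr0 mul0r if_same.
- by exists (lift y); rewrite /ext glue_lift.
Qed.

Lemma massZ_eq (k : R[i]) u : k != 0 -> mass (fun y => k * u y) = ((nrm k `^ p)%:E * mass u)%E.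
Proof.
move=> k0; apply/eqP; rewrite eq_le massZ /=.
have h := massZ p k^-1 (fun y => k * u y).
have e : mass (fun y => k^-1 * (k * u y)) = mass u.
  by apply: mass_ext => y; rewrite mulKf.
rewrite e in h; apply: le_trans (lee_wpmul2l _ h) _; first by rewrite lee_fin powR_ge0.
rewrite muleA -EFinM -powRM ?nrm_ge0 // -nrmM mulfV //.
by rewrite [nrm 1]Normc.normc1 powR1 mul1e.
Qed.

Lemma normalized_loop x (n : nat) (e : R) : bdd x -> (0 < n)%N -> 0 < e ->
  exists v B (y : R), [/\ inv v, supp_in n B v, (n < B)%N, vanishing v & mass v = 1%E]
    /\ (forall z, T y%:C%C v z = 0) /\ `|x - y| <= e.
Proof.
move=> bx n0 e0.
have [m hm] := @pow2_unbounded R e 5 e0.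
have [y [hy _ xy]] := approx_Sigma5 m bx.
have hyc : iter m (@decimation R) y%:C%C = 5 by rewrite iter_real hy rmorph_nat.
have [v [A [B [[iv Tv sv nA] [zv [z vz]]]]]] := loop_family hyc n0.
have fv := fin_supp p1 sv.
have [M M0 eM] : exists2 M : R, 0 < M & mass v = M%:E.
  have := mass_point p v z; move: fv; case: (mass v) (mass_ge0 p v) => // r _ _.
  rewrite lee_fin => h; exists r => //; apply: lt_le_trans h.
  by apply: powR_gt0; exact: nrm_gt0.
pose k := (M `^ (- p^-1))%:C%C : R[i].
have k0 : k != 0 by rewrite fmorph_eq0 gt_eqF // powR_gt0.
exists (fun a => k * v a), (maxn B n.+1), y; split; last split.
- split.
  + by move=> w; rewrite iv.
  + move=> w hw; rewrite sv ?mulr0 //; apply: contra hw => /andP[h1 h2].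
    by rewrite (leq_trans nA h1) (leq_trans h2) // leq_maxl.
  + by rewrite leq_max leqnn orbT.
  + by move=> j w w3; rewrite zv ?mulr0.
  + rewrite massZ_eq // eM nrm_real ger0_norm ?powR_ge0 // -powRrM mulNr mulVf ?gt_eqF //.
    by rewrite -EFinM powRN powRr1 ?(ltW M0) // mulVf // gt_eqF.
- by move=> w; rewrite T_Z Tv mulr0.
- apply: le_trans xy _; rewrite exprVn ler_pdivrMr ?exprn_gt0 //.
  by rewrite mulrC ltW.
Qed.

Lemma mass_le_locally u (M : R) :
  (forall N : nat, exists2 f, (forall y, (y.1 < N)%N -> u y = f y) & (mass f <= M%:E)%E) ->
  (mass u <= M%:E)%E.
Proof.
move=> h; apply: ge_ereal_sup => /= _ [X [finX _] <-].
have [f uf fM] := h (\max_(y <- fset_set X) y.1).+1.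
apply: le_trans fM; apply: ereal_sup_ubound; exists X => //.
apply: eq_fsbigr => y yX; rewrite uf // ltnS.
by apply: (@leq_bigmax_seq _ _ xpredT (fun z : flag => z.1) y) => //; rewrite in_fset_set.
Qed.

(* Gliding hump: with disjointly supported normalized eigenfunctions [v_n] for
   eigenvalues [l_n] rapidly converging to [x], the series [sum (x - l_n) v_n]
   converges.  A preimage in [l^p] differs from [sum v_n] by an eigenfunction
   tending to 0 along the special flags, hence by 0; but [sum v_n] is not in [l^p]. *)
Lemma not_surjX_julia x : bdd x -> avoid5 x -> ~ surjX p x%:C%C.
Proof.
move=> bx ax sX.
(* [t.1] bounds the cells already occupied, and [t.2] is the index that sets the accuracy. *)
have ex (t : nat * nat) : exists r : ((flag -> R[i]) * nat) * R,
    [/\ inv r.1.1, supp_in t.1.+1 r.1.2 r.1.1, (t.1.+1 < r.1.2)%N,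
      vanishing r.1.1 & mass r.1.1 = 1%E]
    /\ (forall z, T r.2%:C%C r.1.1 z = 0) /\ `|x - r.2| `^ p <= 2^-1 ^+ t.2.
  have h2 : 0 < (2^-1 ^+ t.2 : R) by rewrite exprn_gt0.
  have hp : 0 < (2^-1 ^+ t.2 : R) `^ p^-1 by exact: powR_gt0.
  have [v [B [y [h [Tv xy]]]]] := normalized_loop bx (ltn0Sn t.1) hp.
  exists (v, B, y); split=> //; split=> //=.
  have -> : 2^-1 ^+ t.2 = ((2^-1 ^+ t.2 : R) `^ p^-1) `^ p.
    by rewrite -powRrM mulVf ?gt_eqF // powRr1 // ltW.
  by rewrite ge0_ler_powR ?nnegrE ?powR_ge0 // ltW.
have [F hF] := choice ex.
(* Each hump begins beyond the end of the preceding one, so the supports are disjoint. *)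
pose st := fix st n := if n is n'.+1 then (F (st n', n')).1.2 else 0%N.
pose v n := (F (st n, n)).1.1; pose m n := (F (st n, n)).2.
have iv n : inv (v n) by case: (hF (st n, n)) => -[].
have sv n : supp_in (st n).+1 (st n.+1) (v n) by case: (hF (st n, n)) => -[].
have stS n : ((st n).+1 < st n.+1)%N by case: (hF (st n, n)) => -[].
have zv n : vanishing (v n) by case: (hF (st n, n)) => -[].
have mv n : mass (v n) = 1%E by case: (hF (st n, n)) => -[].
have Tv n z : T (m n)%:C%C (v n) z = 0 by case: (hF (st n, n)) => _ [].
have xm n : `|x - m n| `^ p <= 2^-1 ^+ n by case: (hF (st n, n)) => _ [].
have st_le a b : (a <= b)%N -> (st a <= st b)%N.
  move=> /subnKC <-; elim: (b - a)%N => [|d IHd]; first by rewrite addn0.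
  by rewrite addnS; have := stS (a + d)%N; lia.
have st_ge n : (n <= st n)%N by elim: n => // n IHn; have := stS n; lia.
have v_out n y : (y.1 <= st n)%N || (st n.+1 <= y.1)%N -> v n y = 0.
  by move=> h; apply: sv; move: h; lia.
clearbody v m st.
pose U (c : nat -> R[i]) N y := \sum_(n < N) c n * v n y.
have U_stable c N y : (y.1 < N)%N -> U c N y = U c y.1.+1 y.
  move=> yN; rewrite /U -(subnKC yN) big_split_ord /= [X in _ + X]big1 ?addr0 // => i _.
  by rewrite v_out ?mulr0 //; have := st_ge (y.1.+1 + i)%N; lia.
have U_mass c N : mass (U c N) = (\sum_(n < N) (nrm (c n) `^ p)%:E)%E.
  elim: N => [|N IHN].
    rewrite big_ord0 (@mass_ext _ _ _ _ (fun=> 0)) ?mass0 // => y.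
    by rewrite /U big_ord0.
  rewrite big_ord_recr /= -IHN (@mass_ext _ _ _ _ (fun y => U c N y + c N * v N y)); last first.
    by move=> y; rewrite /U big_ord_recr.
  rewrite mass_disjoint //.
    congr (_ + _)%E; have [->|c0] := eqVneq (c N) 0; last by rewrite massZ_eq // mv mule1.
    rewrite nrm0 powR0 ?gt_eqF // (@mass_ext _ _ _ _ (fun=> 0)) ?mass0 // => y.
    by rewrite mul0r.
  move=> y; have [h|h] := leqP (y.1) (st N); first by right; rewrite v_out ?h ?mulr0.
  left; apply: big1 => i _; rewrite v_out ?mulr0 //; apply/orP; right.
  exact: leq_trans (st_le _ _ (ltn_ord i)) (ltnW h).
pose u y := U (fun=> 1) y.1.+1 y.
have uU N y : (y.1 < N)%N -> u y = U (fun=> 1) N y by move=> h; rewrite /u -(U_stable _ N).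
have iu : inv u.
  move=> y; pose N := (maxn (mate y).1 y.1).+1.
  rewrite (uU N (mate y)) ?(uU N y) /N ?ltnS ?leq_maxl ?leq_maxr //.
  by apply: eq_bigr => i _; rewrite iv.
have uinf : ~ fin u.
  move=> /mass_fin_le[M M0 hM].
  have big N : ((N%:R : R)%:E <= mass u)%E.
    have e : mass (U (fun=> 1) N) = (N%:R : R)%:E.
      rewrite U_mass (eq_bigr (fun=> 1%E)) => [|i _].
        by rewrite sumEFin sumr_const card_ord.
      by rewrite [nrm 1]Normc.normc1 powR1.
    rewrite -e; apply: (mass_le p1) => y.
    have [h|h] := leqP (y.1) (st N); last first.
      rewrite /U big1 ?nrm0 ?nrm_ge0 // => i _; rewrite v_out ?mulr0 //.
      by apply/orP; right; exact: leq_trans (st_le _ _ (ltn_ord i)) (ltnW h).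
    rewrite (uU (maxn N y.1.+1)) ?leq_maxr // /U.
    rewrite -(subnKC (leq_maxl N y.1.+1)) big_split_ord /= [X in _ + X]big1 ?addr0 // => i _.
    by rewrite v_out ?mulr0 // (leq_trans h) // st_le // leq_addr.
  have := le_trans (big (Num.bound M)) hM; rewrite lee_fin leNgt => /negP; apply.
  by apply: le_lt_trans (ler_norm _) _; rewrite ger0_norm // archi_boundP.
have Tu N y : (y.1 < N)%N -> T x%:C%C u y = U (fun n => (x - m n)%:C%C) N y.
  move=> yN; rewrite (U_stable _ _ _ yN).
  (* Beyond both cells at [y]: there the infinite sum may be replaced by a partial one, on which [T]
     acts termwise. *)
  pose N' := (maxn (mate y).1 y.1).+1.
  rewrite -(U_stable (fun n => (x - m n)%:C%C) N'); last by rewrite ltnS leq_maxr.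
  have -> : T x%:C%C u y = T x%:C%C (U (fun=> 1) N') y.
    rewrite /T /cs (uU N' y); last by rewrite ltnS leq_maxr.
    congr (_ + _ - _); apply: eq_bigr => i _; apply: uU; rewrite /= ltnS ?leq_maxr //.
    exact: leq_maxl.
  elim: (N') => [|K IHK].
    have U0 c : U c 0%N = fun=> 0 by apply/funext => z; rewrite /U big_ord0.
    by rewrite !U0 /T !cs0 mulr0 addr0 subr0.
  have -> : U (fun=> 1) K.+1 = (fun z => U (fun=> 1) K z + v K z).
    by apply/funext => z; rewrite /U big_ord_recr /= mul1r.
  rewrite T_D IHK [in RHS]/U big_ord_recr /= -/(U _ K y); congr (_ + _).
  rewrite -[LHS]subr0 -(Tv K y) /T rmorphB; ring.
have fg : fin (T x%:C%C u).
  apply: le_lt_trans (ltry 2); apply: mass_le_locally => N.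
  exists (U (fun n => (x - m n)%:C%C) N); first by move=> y; exact: Tu.
  rewrite U_mass sumEFin lee_fin.
  apply: (@le_trans _ _ (\sum_(n < N) 2^-1 ^+ n)).
    by apply: ler_sum => i _; rewrite nrm_real.
  have e : \sum_(n < N) (2^-1 : R) ^+ n = 2 - 2 * 2^-1 ^+ N.
    elim: N => [|N IHN]; first by rewrite big_ord0 expr0; ring.
    by rewrite big_ord_recr /= IHN exprS; field.
  by rewrite e; have := @exprn_ge0 R N 2^-1 ltac:(lra); lra.
have [u' [iu' fu' Tu']] := sX _ (T_inv _ iu) fg.
have w0 : forall y, u y - u' y = 0.
  apply: (kernel_decay bx ax) => [y|y|s ss e e0].
  - by rewrite iu iu'.
  - by rewrite T_B Tu' subrr.
  - have [n hn] := fin_decays fu' ss e0; exists n => k nk.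
    have -> : u (iter k lift s) = 0.
      rewrite /u /U big1 // => i _; rewrite zv ?mulr0 //.
      by case: ss => ->.
    by rewrite sub0r nrmN hn.
apply: uinf; rewrite (@mass_ext _ _ _ _ u') // => y.
by apply/eqP; rewrite -subr_eq0 w0.
Qed.

End Kernel.

(** * Density of the range *)

Section Vertices.
Variable K : fieldType.
Implicit Types (l : K) (s y : flag) (c : nat) (i j k : 'I_3).

(* The indicator of a vertex, except that it is doubled at the flag [(0, 0)]
   fixed by [mate]. *)
Definition vtx s y : K := (y == s)%:R + (y == mate s)%:R.

Lemma vtx_mate s : vtx (mate s) = vtx s.
Proof. by apply/funext => y; rewrite /vtx mateK addrC. Qed.

Lemma eq_mate s y : (mate y == s) = (y == mate s).
Proof. by apply/eqP/eqP => [<-|->]; rewrite mateK. Qed.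

Lemma inv_vtx s : inv (vtx s).
Proof. by move=> y; rewrite /vtx !eq_mate mateK addrC. Qed.

Lemma sum_delta c s : \sum_i ((c, i) == s)%:R = (c == s.1)%:R :> K.
Proof.
case: s => d k /=; rewrite (bigD1 k) //= big1 => [|i ik].
  by rewrite addr0 xpair_eqE eqxx andbT.
by rewrite xpair_eqE (negbTE ik) andbF.
Qed.

Definition csv c y : K := \sum_j vtx (c, j) y.

Lemma csvE c y : csv c y = (y.1 == c)%:R + ((mate y).1 == c)%:R.
Proof.
rewrite /csv /vtx big_split /= eq_sym -(sum_delta c y); congr (_ + _).
  by apply: eq_bigr => j _; rewrite eq_sym.
rewrite eq_sym -(sum_delta c (mate y)); apply: eq_bigr => j _.
by rewrite -eq_mate eq_sym.
Qed.

Lemma T_vtx l s y : T l (vtx s) y = csv s.1 y + csv (mate s).1 y - (6 - l) * vtx s y.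
Proof.
have e c : cs (vtx s) c = (c == s.1)%:R + (c == (mate s).1)%:R.
  by rewrite /cs /vtx big_split /= !sum_delta.
rewrite /T !e !csvE; ring.
Qed.

Lemma vtx_lift s : vtx (lift s) = glue (vtx s) (fun=> 0).
Proof.
apply/funext => y; rewrite (surjective_pairing y) -(sub_parent y.1) glue_sub.
move: (parent y.1) (digit y.1) y.2 => c j i; rewrite /vtx mate_lift.
have e t : ((sub c j, i) == lift t) = (i == j) && ((c, i) == t).
  case: t => d k; rewrite /lift /= !xpair_eqE.
  apply/andP/and3P => [[/eqP/sub_inj[-> ->] /eqP ->]|[/eqP -> /eqP -> /eqP ->]] //.
by rewrite !e; case: ifP => //= _; rewrite addr0.
Qed.

Lemma vtx_sub c j i : i != j -> vtx (sub c j, i) = vtx (mid1 (c, opp i j)).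
Proof.
move=> ij; have [->//|h] : (sub c j, i) = mid1 (c, opp i j) \/
    (sub c j, i) = mate (mid1 (c, opp i j)).
  rewrite /mid1 mate_sub /=; move: i j ij; apply: I3P; apply: I3P => //= _;
  rewrite ?oppE; by [left; congr (sub _ _, _); apply: val_inj
    |right; congr (sub _ _, _); apply: val_inj].
by rewrite h vtx_mate.
Qed.

Lemma csv_sub c j y : csv (sub c j) y =
  vtx (lift (c, j)) y + \sum_k vtx (mid1 (c, k)) y - vtx (mid1 (c, j)) y.
Proof.
have hv i : vtx (sub c j, i) y =
    if i == j then vtx (lift (c, j)) y else vtx (mid1 (c, opp i j)) y.
  have [-> //|ij] := eqVneq i j; exact: (f_equal (fun f => f y) (vtx_sub c ij)).
rewrite /csv (eq_bigr _ (fun i _ => hv i)) !sum3; move: j {hv}; apply: I3P; rewrite /= ?oppE; ring.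
Qed.

(** The transpose of [ext]: modulo the range, a midpoint indicator is the combination of coarse
    indicators with the coefficients by which [ext] computes that midpoint. *)
Definition mid_value l (c : nat) (k : 'I_3) y : K :=
  ((4 - l) * (\sum_j vtx (lift (c, j)) y) - (2 - l) * vtx (lift (c, k)) y) / disc l.

Lemma T_mid l c k y : T l (vtx (mid1 (c, k))) y =
  \sum_j vtx (lift (c, j)) y - vtx (lift (c, k)) y
  + \sum_j vtx (mid1 (c, j)) y - (5 - l) * vtx (mid1 (c, k)) y.
Proof.
rewrite T_vtx {2}/mid1 mate_sub /=.
have -> : (k + (1 + 1) == k + 1) = false by move: k; apply: I3P.
have I3add : (1 + (1 + 1) = 0 :> 'I_3) * (1 + 1 + 1 = 0 :> 'I_3) *
  (1 + 1 + (1 + 1) = 1 :> 'I_3) by do !split; apply: val_inj.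
by rewrite /= !csv_sub !sum3; move: k; apply: I3P; rewrite ?add0r ?I3add; ring.
Qed.

End Vertices.

(** * The closure of the range and its behaviour under decimation *)

Section Approximation.
Variables (R : realType) (p : R).
Hypothesis p1 : 1 <= p.
Implicit Types (u h a b : flag -> R[i]) (l : R[i]) (s y : flag) (x : R).
Local Notation mass := (mass p).
Local Notation fin u := (mass u%R < +oo)%E.
Let p0 : 0 < p. Proof. exact: lt_le_trans p1. Qed.

Definition apx l h := forall e : R, 0 < e ->
  exists u, [/\ inv u, fin u & (mass (fun y => T l u y - h y)%R <= e%:E)%E].

Lemma mass_leD (A B : R) u h : (mass u <= A%:E)%E -> (mass h <= B%:E)%E ->
  (mass (fun y => u y + h y)%R <= (quasi p * (A + B))%:E)%E.
Proof.
move=> uA hB; apply: le_trans (massD p1 _ _) _; rewrite EFinM EFinD.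
by apply: lee_wpmul2l; [rewrite lee_fin ltW ?quasi_gt0|exact: leeD].
Qed.

Lemma mass_leZ (A : R) (k : R[i]) u : (mass u <= A%:E)%E ->
  (mass (fun y => k * u y)%R <= (nrm k `^ p * A)%:E)%E.
Proof.
move=> uA; apply: le_trans (massZ _ _ _) _; rewrite EFinM.
by apply: lee_wpmul2l; rewrite ?lee_fin ?powR_ge0.
Qed.

Lemma apx_ext l h h' : (forall y, h y = h' y) -> apx l h -> apx l h'.
Proof. by move=> /funext ->. Qed.

Lemma apx_T l u : inv u -> fin u -> apx l (T l u).
Proof.
move=> iu fu e e0; exists u; split=> //.
by rewrite (@mass_ext _ _ _ _ (fun=> 0)) => [|y]; [rewrite mass0 // lee_fin ltW|exact: subrr].
Qed.

Lemma apxD l h h' : apx l h -> apx l h' -> apx l (fun y => h y + h' y).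
Proof.
move=> ah ah' e e0; have t0 := quasi_gt0 p; pose d := e / (quasi p * 2).
have d0 : 0 < d by rewrite divr_gt0 ?mulr_gt0.
have [u [iu fu hu]] := ah d d0; have [u' [iu' fu' hu']] := ah' d d0.
exists (fun y => u y + u' y); split.
- by move=> y; rewrite iu iu'.
- exact: (massD_fin p1).
- rewrite (@mass_ext _ _ _ _ (fun y => (T l u y - h y) + (T l u' y - h' y))) => [|y].
    apply: le_trans (mass_leD hu hu') _; rewrite lee_fin /d.
    by rewrite le_eqVlt; apply/orP; left; apply/eqP; field; rewrite gt_eqF.
  by rewrite T_D; ring.
Qed.

Lemma apxZ l k h : apx l h -> apx l (fun y => k * h y).
Proof.
move=> ah e e0; pose d := e / (nrm k `^ p + 1).
have n0 : 0 < nrm k `^ p + 1 by rewrite ltr_wpDl ?powR_ge0.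
have d0 : 0 < d by rewrite divr_gt0.
have [u [iu fu hu]] := ah d d0; exists (fun y => k * u y); split.
- by move=> y; rewrite iu.
- exact: massZ_fin.
- rewrite (@mass_ext _ _ _ _ (fun y => k * (T l u y - h y))) => [|y].
    apply: le_trans (mass_leZ _ hu) _; rewrite lee_fin /d mulrCA ler_piMr ?(ltW e0) //.
    by rewrite ler_pdivrMr // mul1r lerDl.
  by rewrite T_Z /=; ring.
Qed.

Lemma apxB l h h' : apx l h -> apx l h' -> apx l (fun y => h y - h' y).
Proof.
move=> ah ah'; apply: (@apx_ext _ (fun y => h y + -1 * h' y)) => [y|].
  by rewrite mulN1r.
by apply: apxD => //; exact: apxZ.
Qed.

Lemma apx_sum l (I : Type) (r : seq I) (h : I -> flag -> R[i]) :
  (forall i, apx l (h i)) -> apx l (fun y => \sum_(i <- r) h i y).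
Proof.
move=> ah; elim: r => [|i r IHr].
  apply: (@apx_ext _ (T l (fun=> 0))) => [y|].
    by rewrite big_nil /T !cs0 mulr0 addr0 subr0.
  by apply: apx_T => //; exact: fin0.
apply: (@apx_ext _ (fun y => h i y + \sum_(j <- r) h j y)) => [y|].
  by rewrite big_cons.
exact: apxD.
Qed.

Lemma apx_closed l h :
  (forall e : R, 0 < e -> exists h', apx l h' /\ (mass (fun y => h' y - h y)%R <= e%:E)%E) ->
  apx l h.
Proof.
move=> ah e e0; have t0 := quasi_gt0 p; pose d := e / (quasi p * 2).
have d0 : 0 < d by rewrite divr_gt0 ?mulr_gt0.
have [h' [/(_ d d0)[u [iu fu hu]] hh']] := ah d d0; exists u; split=> //.
rewrite (@mass_ext _ _ _ _ (fun y => (T l u y - h' y) + (h' y - h y))) => [|y]; last by ring.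
apply: le_trans (mass_leD hu hh') _; rewrite lee_fin /d.
by rewrite le_eqVlt; apply/orP; left; apply/eqP; field; rewrite gt_eqF.
Qed.

Lemma mass_coarse h : mass (glue h (fun=> 0)) = mass h.
Proof. by rewrite mass_glue // mass0 // !adde0. Qed.

(** By [T_ext], images at [decim l] placed on the coarse vertices are, up to a nonzero factor,
    images of extensions at [l]. *)
Lemma apx_coarse l h : regular l -> apx (decim l) h -> apx l (glue h (fun=> 0)).
Proof.
move=> [l2 l5 l6] ah e e0; have [u [iu fu hu]] := ah e e0.
pose k := disc l / (6 - l).
exists (fun y => k * ext l u y); split.
- by move=> y; rewrite (inv_ext _ iu).
- by apply: massZ_fin; exact: fin_ext.
- rewrite (@mass_ext _ _ _ _ (glue (fun y => T (decim l) u y - h y) (fun=> 0))) => [|y].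
    by rewrite mass_coarse.
  rewrite T_Z T_ext // /glue; case: ifP => _; last by rewrite mulr0 subr0.
  by congr (_ - _); rewrite /k /disc; field; rewrite l2 l5 l6.
Qed.

Lemma mass_delta s : (mass (fun y => (y == s)%:R)%R <= 1%:E)%E.
Proof.
apply: ge_ereal_sup => /= _ [X [finX _] <-]; rewrite fsbig_finite // sumEFin lee_fin.
have [sX|sX] := boolP (s \in fset_set X); last first.
  rewrite big1_seq // => y /andP[_ yX]; case: eqP => [e|_].
    by rewrite -e yX in sX.
  by rewrite nrm0 powR0 // gt_eqF.
rewrite (bigD1_seq s) //= ?fset_uniq // eqxx [nrm 1]Normc.normc1 powR1.
by rewrite big1 ?addr0 // => y /negbTE ->; rewrite nrm0 powR0 // gt_eqF.
Qed.

Lemma mass_vtx s : (mass (vtx _ s) <= (quasi p * (1 + 1))%:E)%E.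
Proof. by apply: mass_leD; exact: mass_delta. Qed.

Lemma fin_vtx s : fin (vtx _ s).
Proof. exact: le_lt_trans (mass_vtx s) (ltry _). Qed.

Lemma apx_T_vtx l s : apx l (T l (vtx _ s)).
Proof. by apply: apx_T; [exact: inv_vtx|exact: fin_vtx]. Qed.

Lemma finite_combination u (e : R) : inv u -> fin u -> 0 < e ->
  exists r : seq flag,
    (mass (fun y => \sum_(s <- r) (2^-1 * u s) * vtx _ s y - u y)%R <= e%:E)%E.
Proof.
move=> iu fu e0; have t0 := quasi_gt0 p; pose d := e / (quasi p * 2).
have d0 : 0 < d by rewrite divr_gt0 ?mulr_gt0.
have [A finA hA] := mass_approx p1 fu d0.
pose w y := if y \in A then 0 else u y.
exists (fset_set A).
(* [A] need not be stable under [mate]. The combination is the mean of the restriction of [u] to [A]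
   and its mirror image, so the error is, up to sign, the mean of [w] and its mirror image. *)
rewrite (@mass_ext _ _ _ _ (fun y => - 2^-1 * w y + - 2^-1 * w (mate y))); last first.
  have sumA (f : flag -> R[i]) y : \sum_(s <- fset_set A) f s * (y == s)%:R =
      if y \in A then f y else 0.
    have -> : (y \in A) = (y \in fset_set A) by rewrite in_fset_set.
    case: ifP => yA; last first.
      by rewrite big1_seq // => s /andP[_ sA]; case: eqP => [e1|_]; [rewrite e1 sA in yA|rewrite mulr0].
    rewrite (bigD1_seq y) //= ?fset_uniq // eqxx mulr1.
    by rewrite big1 ?addr0 // => s sy; rewrite eq_sym (negbTE sy) mulr0.
  move=> y; rewrite /vtx; under eq_bigr do rewrite mulrDr.
  rewrite big_split /= sumA.
  under eq_bigr do rewrite -eq_mate.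
  by rewrite sumA /w iu; case: ifP => _; case: ifP => _; field.
have half : nrm (- 2^-1 : R[i]) `^ p <= 1.
  have -> : - 2^-1 = (- 2^-1 : R)%:C%C by rewrite rmorphN fmorphV rmorph_nat.
  rewrite nrm_real normrN ger0_norm ?invr_ge0 //.
  have e1 : 1 `^ p = 1 :> R by rewrite powR1.
  by rewrite -[leRHS]e1 ge0_ler_powR ?nnegrE ?invr_ge0 ?(ltW p0) //; lra.
have half_le f : (mass f <= d%:E)%E -> (mass (fun y => - 2^-1 * f y)%R <= d%:E)%E.
  move=> fd; apply: le_trans (mass_leZ _ fd) _; rewrite lee_fin.
  by rewrite ler_piMl // ltW.
have wm : (mass (fun y => w (mate y)) <= d%:E)%E.
  by rewrite (mass_perm p w mate_bij).
have wA : (mass w <= d%:E)%E by exact: hA.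
apply: le_trans (mass_leD (half_le w wA) (half_le (fun y => w (mate y)) wm)) _; rewrite lee_fin /d.
by rewrite le_eqVlt; apply/orP; left; apply/eqP; field; rewrite gt_eqF.
Qed.

Definition denseX l := forall g, inv g -> fin g -> forall e : R, 0 < e ->
  exists u, [/\ inv u, fin u & (mass (fun y => T l u y - g y)%R < e%:E)%E].

Lemma denseX_vtx l : (forall s, apx l (vtx _ s)) -> denseX l.
Proof.
move=> al g ig fg e e0; have e2 : 0 < e / 2 by lra.
have [|u [iu fu hu]] := @apx_closed l g _ _ e2.
  move=> d d0; have [r hr] := finite_combination ig fg d0.
  exists (fun y => \sum_(s <- r) (2^-1 * g s) * vtx _ s y); split=> //.
  by apply: apx_sum => s; exact: apxZ.
by exists u; split=> //; apply: le_lt_trans hu _; rewrite lte_fin; lra.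
Qed.

Lemma apx_mid l c k : 2 - l != 0 -> 5 - l != 0 ->
  apx l (fun y => vtx _ (mid1 (c, k)) y - mid_value l c k y).
Proof.
move=> l2 l5; pose t j := T l (vtx _ (mid1 (c, j))).
apply: (@apx_ext _ (fun y => - (5 - l)^-1 * t k y + - (disc l)^-1 * \sum_(j <- enum 'I_3) t j y)).
  move=> y; rewrite big_enum /= sum3 /t !T_mid /mid_value /disc !sum3; field.
  by rewrite l2 l5.
apply: apxD; first by apply: apxZ; exact: apx_T_vtx.
by apply: apxZ; apply: apx_sum => j; exact: apx_T_vtx.
Qed.

Local Notation o := (vtx R[i] (0%N, 0)).
Local Notation e1 := (vtx R[i] (0%N, 1)).
Local Notation e2 := (vtx R[i] (0%N, 1 + 1)).

Lemma apx_corner l : apx l (fun y => 2 * (e1 y + e2 y) - (4 - l) * o y).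
Proof.
apply: apx_ext (apx_T_vtx l (0%N, 0)) => y.
by rewrite T_vtx mate00 /csv sum3 /=; ring.
Qed.

(** [Q] must be stable under [rdec], since descending from [c] to [sub c j] changes the parameter.
    On cell 0 the corner equation expresses [e1 + e2] by [o], which leaves only [o] and [e1 - e2] to
    be supplied. *)
Lemma apx_all (Q : R -> Prop) :
  (forall x, Q x -> [/\ bdd x, avoid5 x & Q (rdec x)]) ->
  (forall x, Q x -> apx x%:C%C o /\ apx x%:C%C (fun y => e1 y - e2 y)) ->
  forall s x, Q x -> apx x%:C%C (vtx _ s).
Proof.
move=> QP Q0 [c]; move: c; apply: cell_ind => [i x Qx|c j IHc i x Qx].
  have [a0 ad] := Q0 x Qx; have ac := apx_corner x%:C%C.
  move: i; apply: I3P; first exact: a0.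
  - apply: (@apx_ext _ (fun y => 4^-1 * (2 * (e1 y + e2 y) - (4 - x%:C%C) * o y) +
      ((4 - x%:C%C) / 4 * o y + 2^-1 * (e1 y - e2 y)))) => [y|]; first by field.
    by apply: apxD; [exact: apxZ|apply: apxD; exact: apxZ].
  - apply: (@apx_ext _ (fun y => 4^-1 * (2 * (e1 y + e2 y) - (4 - x%:C%C) * o y) +
      ((4 - x%:C%C) / 4 * o y + - 2^-1 * (e1 y - e2 y)))) => [y|]; first by field.
    by apply: apxD; [exact: apxZ|apply: apxD; exact: apxZ].
have [bx ax Qr] := QP x Qx; have rx := regular_real bx ax; have [l2 l5 l6] := rx.
have al k : apx x%:C%C (vtx _ (lift (c, k))).
  by rewrite vtx_lift; apply: apx_coarse => //; rewrite decim_real; exact: IHc.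
have [->|ij] := eqVneq i j; first exact: al.
rewrite vtx_sub //; set k := opp i j.
apply: (@apx_ext _ (fun y => (vtx _ (mid1 (c, k)) y - mid_value x%:C%C c k y)
  + (disc x%:C%C)^-1 * ((4 - x%:C%C) * (\sum_(j <- enum 'I_3) vtx _ (lift (c, j)) y)
      - (2 - x%:C%C) * vtx _ (lift (c, k)) y))) => [y|].
  by rewrite big_enum /= /mid_value [_ / disc _]mulrC subrK.
apply: apxD; first exact: apx_mid.
by apply/apxZ/apxB; apply: apxZ => //; exact: apx_sum.
Qed.

(** [h] moved to the vertices of the lattice of mesh [2 ^ k], and 0 at the other vertices. *)
Definition up k h : flag -> R[i] := iter k (fun h => glue h (fun=> 0)) h.

Lemma apx_up k x h : bdd x -> avoid5 x -> apx (iter k (@rdec R) x)%:C%C h ->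
  apx x%:C%C (up k h).
Proof.
elim: k x => [//|k IHk] x bx ax ah; rewrite /up iterS; apply: apx_coarse.
  exact: regular_real.
rewrite decim_real; apply: IHk; [exact: bdd_rdec|exact: avoid5_rdec|].
by rewrite -iterSr.
Qed.

Lemma upD k h h' y : up k (fun y => h y + h' y) y = up k h y + up k h' y.
Proof.
elim: k y => [//|k IHk] y; rewrite /up !iterS -!/(up k _) /glue; case: ifP => _.
  exact: IHk.
by rewrite addr0.
Qed.

Lemma upZ k (a : R[i]) h y : up k (fun y => a * h y) y = a * up k h y.
Proof.
elim: k y => [//|k IHk] y; rewrite /up !iterS -!/(up k _) /glue; case: ifP => _.
  exact: IHk.
by rewrite mulr0.
Qed.

Lemma up_origin k : up k o = o.
Proof. by elim: k => // k IHk; rewrite /up iterS -/(up k o) IHk -vtx_lift. Qed.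

Lemma mass_up k h : mass (up k h) = mass h.
Proof. by elim: k => // k IHk; rewrite /up iterS -/(up k h) mass_coarse. Qed.

Lemma up_iter_lift k h y : up k h (iter k lift y) = h y.
Proof. by elim: k => // k IHk; rewrite /up !iterS glue_lift. Qed.

Lemma up_support k h y : up k h y != 0 -> exists z, y = iter k lift z.
Proof.
elim: k y => [|k IHk] y; first by exists y.
rewrite /up iterS -/(up k h) (surjective_pairing y) -(sub_parent y.1) glue_sub.
case: ifP => [/eqP ->|_]; last by rewrite eqxx.
by move=> /IHk[z hz]; exists z; rewrite iterS -hz.
Qed.

End Approximation.

(** * Congruences modulo the range near the boundary point *)

Section CornerRelations.
Variables (R : realType) (p : R).
Hypothesis p1 : 1 <= p.
Implicit Types (h : flag -> R[i]) (l : R[i]) (s y : flag) (x : R).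
Local Notation o := (vtx R[i] (0%N, 0)).
Local Notation e1 := (vtx R[i] (0%N, 1)).
Local Notation e2 := (vtx R[i] (0%N, 1 + 1)).

Lemma vtx_mid_lift c k y : vtx R[i] (mid1 (c, k)) (lift y) = 0.
Proof.
have ne (z : flag) : (lift y == mid1 z) = false /\ (lift y == mate (mid1 z)) = false.
  case: y z => d i [e j]; rewrite /mid1 mate_sub /lift /=.
  have -> : (j + (1 + 1) == j + 1) = false by move: j; apply: I3P.
  split; apply/eqP => -[/sub_inj[_ ei] ei'].
    by move: ei ei'; move: i j; apply: I3P; apply: I3P.
  by move: ei ei'; move: i j; apply: I3P; apply: I3P.
by have [a b] := ne (c, k); rewrite /vtx a b addr0.
Qed.

(** Transposed form of [kernel_mid]. As [up] fixes [o], it holds at every scale with the same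
    left-hand term. *)
Lemma apx_vtx_mid l : regular l -> apx p l (fun y => o y - 2 / (2 - l) * vtx _ (mid1 (0%N, 0)) y).
Proof.
move=> rl; have [l2 l5 l6] := rl.
have h1 := apx_mid p1 0 0 l2 l5.
have h2 := apx_coarse p1 rl (apx_corner p1 (decim l)).
pose X j := vtx R[i] (lift (0%N, j)).
have h2' : apx p l (fun y => 2 * (X 1 y + X (1 + 1) y) - (4 - decim l) * X 0 y).
  apply: apx_ext h2 => y; have XE j : X j y = glue (vtx R[i] (0%N, j)) (fun=> 0) y.
    by rewrite /X vtx_lift.
  by rewrite !XE /glue; case: ifP => // _; ring.
apply: (@apx_ext _ _ _ (fun y => - (2 / (2 - l)) * (vtx _ (mid1 (0%N, 0)) y - mid_value l 0 0 y)
   + - ((4 - l) / ((2 - l) * disc l)) * (2 * (X 1 y + X (1 + 1) y) - (4 - decim l) * X 0 y))).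
  move=> y; have -> : o y = X 0 y by [].
  rewrite /mid_value sum3 -!/(X _) /disc /decim; field; rewrite l2 l5.
  by [].
by apply: apxD => //; exact: apxZ.
Qed.

Lemma apx_antisym l : regular l -> apx p l (fun y => (e1 y - e2 y)
  - (5 - l)^-1 * glue (fun y => e1 y - e2 y) (fun=> 0) y).
Proof.
move=> rl; have [l2 l5 l6] := rl.
have h2 := apx_mid p1 0 (1 + 1) l2 l5; have h1 := apx_mid p1 0 1 l2 l5.
have m1 : e1 = vtx _ (mid1 (0%N, 1 + 1)).
  have := @vtx_sub R[i] 0 0 1; rewrite oppE; exact.
have m2 : e2 = vtx _ (mid1 (0%N, 1)).
  have := @vtx_sub R[i] 0 0 (1 + 1); rewrite oppE; exact.
apply: apx_ext (apxB p1 h2 h1) => y; rewrite m1 m2 /mid_value.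
have -> : glue (fun y => vtx R[i] (mid1 (0%N, 1 + 1)) y - vtx R[i] (mid1 (0%N, 1)) y)
    (fun=> 0) y = vtx R[i] (lift (0%N, 1)) y - vtx R[i] (lift (0%N, 1 + 1)) y.
  by rewrite -m1 -m2 !vtx_lift /glue; case: ifP => // _; rewrite subr0.
by rewrite sum3 /disc; field; rewrite l2 l5.
Qed.

Lemma apx_up_relation x n f h (c : R[i]) : bdd x -> avoid5 x -> up n f = f ->
  apx p (iter n (@rdec R) x)%:C%C (fun y => f y - c * h y) ->
  apx p x%:C%C (fun y => f y - c * up n h y).
Proof.
move=> bx ax uf /(apx_up p1 bx ax); apply: apx_ext => y.
have -> : (fun y => f y - c * h y) = (fun y => f y + - c * h y).
  by apply/funext => z; rewrite mulNr.
by rewrite upD (upZ n (- c)) uf mulNr.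
Qed.

(** [c] is the product of the [(5 - R^j(x))^-1] for [j < n]. It telescopes to [x / R^n(x)], which
    says nothing at [x = 0], where it is [5^-n]; hence the separate clause. *)
Lemma antisym_up n x : bdd x -> avoid5 x -> exists c : R,
  [/\ apx p x%:C%C (fun y => (e1 y - e2 y) - c%:C%C * up n (fun y => e1 y - e2 y) y),
    x = 0 -> 0 <= c <= 1 & c * iter n (@rdec R) x = x].
Proof.
elim: n x => [|n IHn] x bx ax.
  exists 1; split; [|lra|by rewrite mul1r].
  apply: (@apx_ext _ _ _ (T x%:C%C (fun=> 0))) => [y|].
    by rewrite rmorph1 mul1r /T !cs0 mulr0 addr0 !subr0 subrr.
  by apply: apx_T => //; exact: fin0.
have rx := regular_real bx ax; have [l2 l5 l6] := rx.
have [c [ac c0 cx]] := IHn _ (bdd_rdec bx) (avoid5_rdec ax).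
have x5 : 5 - x != 0 by rewrite subr_eq0 eq_sym; apply/eqP; exact: (ax 0%N).
have xle : 0 <= x <= 5 := bx 0%N.
exists (c / (5 - x)); split.
- have h1 := apx_antisym rx.
  rewrite -decim_real in ac; have h2 := apx_coarse p1 rx ac.
  apply: (@apx_ext _ _ _ (fun y => (e1 y - e2 y - (5 - x%:C%C)^-1 *
     glue (fun y => e1 y - e2 y) (fun=> 0) y) + (5 - x%:C%C)^-1 *
     glue (fun y => e1 y - e2 y - c%:C%C * up n (fun y => e1 y - e2 y) y) (fun=> 0) y)).
    move=> y; rewrite rmorphM fmorphV rmorphB rmorph_nat {2}/up iterS -/(up n _).
    by rewrite /glue; case: ifP => _; ring.
  by apply: apxD => //; exact: apxZ.
- move=> x0; have /c0 h : rdec x = 0 by rewrite /rdec x0 mul0r.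
  by rewrite x0 subr0; lra.
- by rewrite iterSr mulrAC cx /rdec mulfK.
Qed.

End CornerRelations.

(** * Density of the range for p > 1 *)

Section DenseReflexive.
Variables (R : realType) (p : R).
Hypothesis p1 : 1 < p.
Implicit Types (u h : flag -> R[i]) (l : R[i]) (s y : flag) (x : R).
Local Notation mass := (mass p).
Local Notation fin u := (mass u%R < +oo)%E.
Let p1w : 1 <= p. Proof. exact: ltW. Qed.
Let p0 : 0 < p. Proof. exact: lt_trans p1. Qed.
Local Notation o := (vtx R[i] (0%N, 0)).
Local Notation e1 := (vtx R[i] (0%N, 1)).
Local Notation e2 := (vtx R[i] (0%N, 1 + 1)).

(* Infinitely many equivalent copies of [h] at disjoint places may be averaged,
   which makes the [p]-norm small since [p > 1]. *)
Lemma apx_average l f h (C : R) : fin h -> (forall y, h (lift y) = 0) ->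
  (forall n, exists2 k, (n <= k)%N & exists c, nrm c <= C /\
     apx p l (fun y => f y - c * up k h y)) ->
  apx p l f.
Proof.
move=> fh h0 H; have [M M0 hM] := mass_fin_le fh.
have C0 : 0 <= C by have [k _ [c [cC _]]] := H 0%N; exact: le_trans (nrm_ge0 _) cC.
pose Q := C `^ p * M; have Q0 : 0 <= Q by rewrite mulr_ge0 ?powR_ge0.
(* [S] collects [N] copies. It vanishes on [n]-fold lifts, and a copy moved up by some [k >= n]
   lives on such lifts, so it is disjoint from [S]. *)
have sums N : exists (S : flag -> R[i]) n, [/\ forall z, S (iter n lift z) = 0,
    apx p l (fun y => N%:R * f y - S y) & (mass S <= (N%:R * Q)%:E)%E].
  elim: N => [|N [S [n [Sn aS mS]]]].
    exists (fun=> 0), 0%N; split=> //; last by rewrite mass0 // mul0r.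
    apply: (@apx_ext _ _ _ (T l (fun=> 0))) => [y|].
      by rewrite /T !cs0 mulr0 addr0 subr0 mul0r subr0.
    by apply: apx_T => //; exact: fin0.
  have [k nk [c [cC ac]]] := H n.
  exists (fun y => S y + c * up k h y), k.+1; split.
  - move=> z; rewrite iterSr up_iter_lift h0 mulr0 addr0.
    by rewrite -(subnKC nk) iterD Sn.
  - apply: (@apx_ext _ _ _ (fun y => (N%:R * f y - S y) + (f y - c * up k h y))).
      by move=> y; rewrite -[N.+1]addn1 natrD; ring.
    exact: apxD.
  - rewrite mass_disjoint // => [|y].
      rewrite -[N.+1]addn1 natrD mulrDl mul1r EFinD; apply: leeD => //.
      apply: le_trans (massZ _ _ _) _; rewrite mass_up // /Q EFinM.
      apply: le_trans (lee_wpmul2l _ hM) _; first by rewrite lee_fin powR_ge0.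
      apply: lee_wpmul2r; rewrite lee_fin //.
      by rewrite ge0_ler_powR ?nnegrE ?nrm_ge0 // ltW.
    have [->|/up_support[z ->]] := eqVneq (up k h y) 0; first by right; rewrite mulr0.
    by left; rewrite -(subnKC nk) iterD Sn.
apply: apx_closed => // e e0.
(* The average of [N] copies has mass at most [N^-p * N * Q]; this is below [e] once
   [N^(p - 1) >= Q / e]. *)
pose q := (Q / e) `^ (p - 1)^-1; pose N := (Num.bound q).+1.
have qN : q <= N%:R.
  apply: ltW; apply: le_lt_trans (ler_norm _) _.
  by apply: lt_le_trans (archi_boundP (normr_ge0 _)) _; rewrite ler_nat /N /Num.bound normr_id.
have N0 : 0 < N%:R :> R by rewrite ltr0n.
have [S [n [_ aS mS]]] := sums N.
exists (fun y => (N%:R)^-1 * (N%:R * f y - S y)); split; first exact: apxZ.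
have Nc : N%:R != 0 :> R[i] by rewrite pnatr_eq0.
rewrite (@mass_ext _ _ _ _ (fun y => - (N%:R)^-1 * S y)) => [|y]; last by field.
apply: le_trans (mass_leZ _ mS) _; rewrite lee_fin nrmN nrmV.
have -> : nrm (N%:R : R[i]) = N%:R by rewrite -(rmorph_nat (real_complex R)) nrm_real ger0_norm.
have -> : (N%:R^-1 : R) `^ p = (N%:R `^ p)^-1.
  by rewrite -[N%:R^-1]powR_inv1 ?(ltW N0) // -powRrM mulN1r powRN.
rewrite ler_pdivrMl ?powR_gt0 //.
have -> : N%:R `^ p = N%:R * N%:R `^ (p - 1) :> R by rewrite mulr_powRB1 // ltW.
rewrite -mulrA ler_wpM2l ?(ltW N0) //.
have p10 : 0 < p - 1 by rewrite subr_gt0.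
have : Q / e <= N%:R `^ (p - 1).
  have -> : Q / e = q `^ (p - 1).
    by rewrite /q -powRrM mulVf ?gt_eqF // powRr1 // divr_ge0 // ltW.
  by rewrite ge0_ler_powR ?nnegrE ?powR_ge0 ?(ltW p10) // ltW.
by rewrite ler_pdivrMr // mulrC.
Qed.

Lemma apx_origin_gt1 x : bdd x -> avoid5 x -> apx p x%:C%C o.
Proof.
move=> bx ax; apply: (@apx_average _ _ (vtx _ (mid1 (0%N, 0))) 10).
- exact: fin_vtx.
- exact: vtx_mid_lift.
move=> n; exists n => //; pose y := iter n (@rdec R) x.
have b_y : bdd y := bdd_iter n bx; have ay : avoid5 y := @avoid5_iter _ n _ ax.
exists (2 / (2 - y%:C%C)); split; last first.
  apply: (apx_up_relation p1w bx ax (up_origin R n)).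
  exact: (apx_vtx_mid p1w (regular_real b_y ay)).
have -> : 2 / (2 - y%:C%C) = (2 / (2 - y))%:C%C.
  by rewrite rmorphM fmorphV rmorphB !rmorph_nat.
rewrite nrm_real normrM normfV ger0_norm //.
have h : 3 / 5 <= `|2 - y|.
  have [y05 [g|g]] := bdd_gap b_y; first by rewrite ger0_norm; lra.
  by rewrite ler0_norm; lra.
by rewrite ler_pdivrMr; lra.
Qed.

Lemma vtx_e1 : e1 = vtx _ (mid1 (0%N, 1 + 1)).
Proof. by have := @vtx_sub R[i] 0 0 1; rewrite oppE; exact. Qed.

Lemma vtx_e2 : e2 = vtx _ (mid1 (0%N, 1)).
Proof. by have := @vtx_sub R[i] 0 0 (1 + 1); rewrite oppE; exact. Qed.

Lemma apx_antisym_gt1 x : bdd x -> avoid5 x -> apx p x%:C%C (fun y => e1 y - e2 y).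
Proof.
move=> bx ax; apply: (@apx_average _ _ (fun y => e1 y - e2 y) 5).
- by apply: (massB_fin p1w); exact: fin_vtx.
- by move=> y; rewrite vtx_e1 vtx_e2 !vtx_mid_lift subrr.
move=> n; have [x0|x0] := eqVneq x 0.
  exists n => //; have [c [ac /(_ x0) c01 _]] := antisym_up p1w n bx ax.
  by exists c%:C%C; split=> //; rewrite nrm_real ger0_norm; lra.
(* At a time [k] with [R^k(x) >= 1] the coefficient [x / R^k(x)] is at most 5. *)
have [k nk xk] := orbit_returns bx ax x0 n; exists k => //.
have [c [ac _ cx]] := antisym_up p1w k bx ax.
exists c%:C%C; split=> //; rewrite nrm_real.
have xx : 0 <= x <= 5 := bx 0%N.
have -> : c = x / iter k (@rdec R) x by rewrite -[X in X / _]cx mulfK // gt_eqF //; lra.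
rewrite ger0_norm; last by rewrite divr_ge0; lra.
by rewrite ler_pdivrMr; lra.
Qed.

Lemma denseX_gt1 x : bdd x -> avoid5 x -> denseX p x%:C%C.
Proof.
move=> bx ax; apply: denseX_vtx => // s.
apply: (@apx_all _ _ p1w (fun x => bdd x /\ avoid5 x)) => // y [b_y ay].
- by split=> //; split; [exact: bdd_rdec|exact: avoid5_rdec].
- by split; [exact: apx_origin_gt1|exact: apx_antisym_gt1].
Qed.

End DenseReflexive.

(** * Density of the range by unbounded fluxes, covering p = 1 *)

Section DenseNonExceptional.
Variables (R : realType) (p : R).
Hypothesis p1 : 1 <= p.
Implicit Types (h : flag -> R[i]) (l : R[i]) (s y : flag) (x : R).
Local Notation mass := (mass p).
Local Notation o := (vtx R[i] (0%N, 0)).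
Local Notation e1 := (vtx R[i] (0%N, 1)).
Local Notation e2 := (vtx R[i] (0%N, 1 + 1)).

(* One-sided normal derivative at corner [i] of cell [c]. *)
Definition flux l c i y : R[i] :=
  \sum_j vtx _ (c, j) y - (6 - l) / 2 * vtx _ (c, i) y.

(** The flux at a coarse vertex may be computed on the fine or on the coarse cell; the factor is the
    one of [T_ext]. *)
Lemma apx_flux l c i : regular l -> apx p l (fun y => flux l (sub c i) i y
  - (6 - l) / disc l * glue (flux (decim l) c i) (fun=> 0) y).
Proof.
move=> rl; have [l2 l5 l6] := rl.
pose r k y := vtx _ (mid1 (c, k)) y - mid_value l c k y.
apply: (@apx_ext _ _ _ (fun y => \sum_(k <- enum 'I_3) r k y - r i y)); last first.
  by apply: apxB => //; [apply: apx_sum => // k|]; exact: apx_mid.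
move=> y; have g0 j : vtx R[i] (lift (c, j)) y = glue (vtx _ (c, j)) (fun=> 0) y.
  by rewrite vtx_lift.
have -> : glue (flux (decim l) c i) (fun=> 0) y =
    \sum_j vtx _ (lift (c, j)) y - (6 - decim l) / 2 * vtx _ (lift (c, i)) y.
  rewrite /flux !sum3 !g0 /glue; case: ifP => _; first by rewrite sum3.
  by rewrite mulr0 !addr0 subrr.
rewrite {1}/flux -/(csv R[i] (sub c i) y) csv_sub big_enum /= /r /mid_value !sum3.
rewrite -[vtx R[i] (sub c i, i) y]/(vtx R[i] (lift (c, i)) y) /disc /decim.
by move: i; apply: I3P; field; rewrite l2 l5.
Qed.

(** All [k] digits are [i]: the smallest triangle at corner [i] of the triangle of side [2 ^ k] at
    the boundary point. *)
Fixpoint corner_cell (i : 'I_3) k := if k is k'.+1 then sub (corner_cell i k') i else 0%N.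

(** In the step, [R(x) (6 - R(x))] cancels the denominator [disc] of [apx_flux] and leaves the
    factor [3 - x]. At [x = 0] the coefficient of [o] is 0, although [prod3] is not. *)
Lemma flux_origin k x : bdd x -> avoid5 x ->
  apx p x%:C%C (fun y => flux x%:C%C (corner_cell 1 k) 1 y
    + flux x%:C%C (corner_cell (1 + 1) k) (1 + 1) y
    - (x * (6 - x) / 4 * prod3 k x)%:C%C * o y).
Proof.
elim: k x => [|k IHk] x bx ax; set l := x%:C%C.
  have -> : (x * (6 - x) / 4 * prod3 0 x)%:C%C = l * (6 - l) / 4.
    by rewrite /= mulr1 !rmorphM fmorphV rmorphB !rmorph_nat.
  apply: (@apx_ext _ _ _ (fun y => (l - 2) / 4 * (2 * (e1 y + e2 y) - (4 - l) * o y))).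
    by move=> y; rewrite /flux !sum3 /=; field.
  by apply: apxZ => //; exact: apx_corner.
have rx := regular_real bx ax; have [l2 l5 l6] := rx.
have h0 := IHk _ (bdd_rdec bx) (avoid5_rdec ax); rewrite -decim_real in h0.
have h := apx_coarse p1 rx h0.
have h1 := apx_flux (corner_cell 1 k) 1 rx.
have h2 := apx_flux (corner_cell (1 + 1) k) (1 + 1) rx.
have oE y : o y = glue o (fun=> 0) y.
  by have := vtx_lift R[i] (0%N, 0) => /(f_equal (fun f => f y)).
have h4 := apxZ ((6 - l) / disc l) h.
have h3 := apxD p1 h1 h2.
have h5 := apxD p1 h3 h4.
apply: apx_ext h5 => y.
rewrite -/l /= [in RHS]oE.
have -> : (x * (6 - x) / 4 * ((3 - x) * prod3 k (rdec x)))%:C%C =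
   (6 - l) / disc l * (rdec x * (6 - rdec x) / 4 * prod3 k (rdec x))%:C%C.
  rewrite /rdec !(rmorphM, fmorphV, rmorphB, rmorph_nat) -/l /disc; field.
  by rewrite l2 l5.
rewrite /glue; case: ifP => _; ring.
Qed.

Lemma flux_antisym k x : bdd x -> avoid5 x ->
  apx p x%:C%C (fun y => flux x%:C%C (corner_cell 1 k) 1 y
    - flux x%:C%C (corner_cell (1 + 1) k) (1 + 1) y
    - (- (6 - x) / 2 * prod3 k x)%:C%C * (e1 y - e2 y)).
Proof.
elim: k x => [|k IHk] x bx ax; set l := x%:C%C.
  have -> : (- (6 - x) / 2 * prod3 0 x)%:C%C = - (6 - l) / 2.
    by rewrite /= mulr1 !rmorphM fmorphV rmorphN rmorphB !rmorph_nat.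
  apply: (@apx_ext _ _ _ (fun y => 0 * (2 * (e1 y + e2 y) - (4 - l) * o y))).
    by move=> y; rewrite /flux !sum3 /=; field.
  by apply: apxZ => //; exact: apx_corner.
have rx := regular_real bx ax; have [l2 l5 l6] := rx.
have h0 := IHk _ (bdd_rdec bx) (avoid5_rdec ax); rewrite -decim_real in h0.
have h := apx_coarse p1 rx h0.
have h1 := apx_flux (corner_cell 1 k) 1 rx.
have h2 := apx_flux (corner_cell (1 + 1) k) (1 + 1) rx.
have h3 := apx_antisym p1 rx.
have c3 : (- (6 - x) / 2 * prod3 k.+1 x)%:C%C =
   (6 - l) / disc l * (- (6 - rdec x) / 2 * prod3 k (rdec x))%:C%C * (5 - l).
  rewrite /= /rdec !(rmorphM, fmorphV, rmorphB, rmorphN, rmorph_nat) -/l /disc; field.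
  by rewrite l2 l5.
set q := (- (6 - x) / 2 * prod3 k.+1 x)%:C%C in c3 *.
apply: apx_ext (apxB p1 (apxD p1 (apxB p1 h1 h2) (apxZ ((6 - l) / disc l) h))
   (apxZ q h3)) => y.
have dl : disc l != 0 by rewrite /disc mulf_neq0.
by rewrite -/l /= c3 /glue; case: ifP => _; field; rewrite dl; exact: l5.
Qed.

Lemma mass_flux x :
  exists2 C : R, 0 <= C & forall c i, (mass (flux x%:C%C c i) <= C%:E)%E.
Proof.
pose V := quasi p * (1 + 1).
pose t := nrm (- ((6 - x%:C%C) / 2)) `^ p.
exists (quasi p * (quasi p * (quasi p * (V + V) + V) + t * V)).
  have t0 := ltW (quasi_gt0 p); rewrite /V /t.
  by rewrite !(mulr_ge0, addr_ge0, powR_ge0, ler01).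
move=> d j; have V_ k := mass_vtx p1 (d, k).
rewrite (@mass_ext _ _ _ _ (fun y => (vtx _ (d, 0) y + vtx _ (d, 1) y + vtx _ (d, 1 + 1) y)
   + - ((6 - x%:C%C) / 2) * vtx _ (d, j) y)) => [|y]; last by rewrite /flux sum3 mulNr.
apply: (mass_leD p1); last by apply: mass_leZ; exact: V_.
by apply: (mass_leD p1); [apply: (mass_leD p1)|]; exact: V_.
Qed.

(** Divided by [q k], the congruence approximates [f] with an error of mass at most
    [C / |q k|^p]. *)
Lemma apx_of_unbounded l f (g : nat -> flag -> R[i]) (q : nat -> R) (C : R) :
  0 <= C -> (forall k, (mass (g k) <= C%:E)%E) ->
  (forall k, apx p l (fun y => g k y - (q k)%:C%C * f y)) ->
  (forall M, exists k, M <= `|q k|) -> apx p l f.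
Proof.
move=> C0 gC ag qM; have p0 : 0 < p by exact: lt_le_trans p1.
apply: apx_closed => // e e0.
have [k hk] := qM ((C / e) `^ p^-1 + 1).
have q0 : 0 < `|q k| by apply: lt_le_trans hk; rewrite ltr_wpDl ?powR_ge0.
have qc : (q k)%:C%C != 0 by rewrite fmorph_eq0 -normr_gt0.
exists (fun y => - (q k)%:C%C^-1 * (g k y - (q k)%:C%C * f y)); split.
  exact: apxZ.
rewrite (@mass_ext _ _ _ _ (fun y => - (q k)%:C%C^-1 * g k y)) => [|y]; last by field.
apply: le_trans (mass_leZ _ (gC k)) _; rewrite lee_fin nrmN nrmV nrm_real.
have -> : `|q k|^-1 `^ p = (`|q k| `^ p)^-1.
  by rewrite -[_^-1 in LHS]powR_inv1 ?(ltW q0) // -powRrM mulN1r powRN.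
rewrite ler_pdivrMl ?powR_gt0 // mulrC -ler_pdivrMl // mulrC.
have -> : C / e = ((C / e) `^ p^-1) `^ p.
  by rewrite -powRrM mulVf ?gt_eqF // powRr1 // divr_ge0 // ltW.
by rewrite ge0_ler_powR ?nnegrE ?powR_ge0 ?(ltW p0) //; lra.
Qed.

Lemma denseX_nonexceptional x : bdd x -> avoid5 x -> x != 0 ->
  (forall k, iter k (@rdec R) x <> 4) -> denseX p x%:C%C.
Proof.
move=> bx ax x0 x4; apply: denseX_vtx => // s.
pose Q x := [/\ bdd x, avoid5 x, x != 0 & forall k, iter k (@rdec R) x <> 4].
apply: (@apx_all _ _ p1 Q) => // {bx ax x0 x4 s x} x [bx ax x0 x4].
  split=> //; split.
  - exact: bdd_rdec.
  - exact: avoid5_rdec.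
  - rewrite /rdec mulf_neq0 // subr_eq0 eq_sym; apply/eqP; exact: (ax 0%N).
  - by move=> k; rewrite -iterSr.
have xle : 0 <= x <= 5 := bx 0%N.
have [C C0 hC] := mass_flux x.
have tw := ltW (quasi_gt0 p).
have big c : c != 0 -> forall M, exists k, M <= `|c * prod3 k x|.
  move=> c0 M; have [k hk] := prod3_unbounded bx x4 (M / `|c|).
  by exists k; rewrite normrM mulrC -ler_pdivrMr // normr_gt0.
split.
  apply: (@apx_of_unbounded _ _ (fun k y => flux x%:C%C (corner_cell 1 k) 1 y +
      flux x%:C%C (corner_cell (1 + 1) k) (1 + 1) y)
    (fun k => x * (6 - x) / 4 * prod3 k x) (quasi p * (C + C))).
  - by rewrite mulr_ge0 ?addr_ge0.
  - by move=> k; apply: (mass_leD p1); [exact: (hC (corner_cell 1 k) 1)|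
      exact: (hC (corner_cell (1 + 1) k) (1 + 1))].
  - by move=> k; exact: flux_origin.
  - by apply: big; rewrite !mulf_neq0 ?invr_eq0 // subr_eq0; apply/eqP; lra.
apply: (@apx_of_unbounded _ _ (fun k y => flux x%:C%C (corner_cell 1 k) 1 y -
      flux x%:C%C (corner_cell (1 + 1) k) (1 + 1) y)
    (fun k => - (6 - x) / 2 * prod3 k x) (quasi p * (C + C))).
- by rewrite mulr_ge0 ?addr_ge0.
- move=> k; apply: (mass_leD p1); first exact: (hC (corner_cell 1 k) 1).
  by have := hC (corner_cell (1 + 1) k) (1 + 1); rewrite -massN.
- by move=> k; exact: flux_antisym.
- by apply: big; rewrite !mulf_neq0 ?invr_eq0 // oppr_eq0 subr_eq0; apply/eqP; lra.
Qed.

End DenseNonExceptional.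

(** * Bounded eigenfunctions and the residual spectrum *)

Section NotDense.
Variable R : realType.
Implicit Types (u f : flag -> R[i]) (l : R[i]) (s y : flag).
Local Notation mass := (mass (1 : R)).
Local Notation fin u := (mass u%R < +oo)%E.

Definition flags_below n : seq flag := [seq (c, i) | c <- iota 0 n, i <- enum 'I_3].

Lemma mem_flags_below n y : (y \in flags_below n) = (y.1 < n)%N.
Proof.
apply/allpairsP/idP => [[z [/= + _ ->]]|yn]; first by rewrite mem_iota.
by exists y; rewrite mem_iota mem_enum yn; split=> //; case: y {yn}.
Qed.

Lemma uniq_flags_below n : uniq (flags_below n).
Proof.
by apply: allpairs_uniq; rewrite ?iota_uniq ?enum_uniq // => -[a b] [c d] _ _.
Qed.

Lemma sum_le_mass n f : \sum_(y <- flags_below n) nrm (f y) <= fine (mass f) \/ ~ fin f.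
Proof.
have [ff|nf] := pselect (fin f); last by right.
left; rewrite -lee_fin fineK ?ge0_fin_numE ?mass_ge0 // -sumEFin.
pose X : set flag := [set` flags_below n].
have finX : finite_set X by exact: finite_seq.
apply: ereal_sup_ubound; exists X => //.
rewrite -fsbig_seq ?uniq_flags_below //; apply: eq_big_seq => y _.
by rewrite powRr1 ?nrm_ge0.
Qed.

Definition pairing n f u : R[i] := \sum_(y <- flags_below n) f y * u y.

Lemma pairing_vtx n s u : inv u -> (s.1 < n)%N -> ((mate s).1 < n)%N ->
  pairing n (vtx _ s) u = 2 * u s.
Proof.
move=> iu sn msn; rewrite /pairing; under eq_bigr do rewrite /vtx mulrDl.
have delta t : (t.1 < n)%N -> \sum_(y <- flags_below n) (y == t)%:R * u y = u t.
  move=> tn; rewrite (bigD1_seq t) ?mem_flags_below ?uniq_flags_below //= eqxx mul1r.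
  by rewrite big1 ?addr0 // => y /negbTE ->; rewrite mul0r.
by rewrite big_split /= !delta // iu; ring.
Qed.

Lemma pairing_lin n (k : R[i]) f g u :
  pairing n (fun y => k * f y + g y) u = k * pairing n f u + pairing n g u.
Proof.
by rewrite /pairing mulr_sumr -big_split /=; apply: eq_bigr => y _; ring.
Qed.

(** Every flag in the support of [T l (vtx s)] has its cell below [n], so truncation of [pairing]
    loses nothing. *)
Definition wide n s := forall j, [/\ (s.1 < n)%N, ((mate s).1 < n)%N,
  ((mate (s.1, j)).1 < n)%N & ((mate ((mate s).1, j)).1 < n)%N].

Lemma wide_exists (r : seq flag) : exists n, forall s, s \in r -> wide n s.
Proof.
have mono n m s : (n <= m)%N -> wide n s -> wide m s.
  by move=> nm w j; have [a b c d] := w j; split; exact: leq_trans nm.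
elim: r => [|s r [n hn]]; first by exists 0%N.
pose ms := \max_j (maxn (mate (s.1, j)).1 (mate ((mate s).1, j)).1).
pose m := (maxn (maxn s.1 (mate s).1) ms).+1.
exists (maxn n m) => t; rewrite inE => /orP[/eqP ->|/hn]; last first.
  by apply: mono; exact: leq_maxl.
apply: (mono m); first exact: leq_maxr.
move=> j; have := @leq_bigmax _ (fun j => maxn (mate (s.1, j)).1 (mate ((mate s).1, j)).1) j.
rewrite -/ms geq_max => /andP[h1 h2]; rewrite /m !ltnS !leq_max !leqnn h1 h2 !orbT.
by [].
Qed.

Lemma pairing_T_vtx n l s u : inv u -> (forall y, T l u y = 0) -> wide n s ->
  pairing n (T l (vtx _ s)) u = 0.
Proof.
move=> iu Tu ws; have [s1 s2 _ _] := ws 0.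
have csvP c : (forall j, ((mate (c, j)).1 < n)%N) -> (c < n)%N ->
    pairing n (csv _ c) u = 2 * cs u c.
  move=> mc cn; rewrite /pairing /csv; under eq_bigr do rewrite mulr_suml.
  rewrite exchange_big /= /cs mulr_sumr; apply: eq_bigr => j _.
  by rewrite -(@pairing_vtx n (c, j)).
have -> : T l (vtx _ s) = (fun y => 1 * csv _ s.1 y + (1 * csv _ (mate s).1 y
    + (- (6 - l) * vtx _ s y + 0))).
  by apply/funext => y; rewrite T_vtx; ring.
have p0 : pairing n (fun=> 0) u = 0 by rewrite /pairing big1 // => y _; rewrite mul0r.
rewrite !pairing_lin p0 pairing_vtx // !csvP //; try by move=> j; case: (ws j).
by apply: (@etrans _ _ (2 * T l u s)); [rewrite /T; ring|rewrite Tu mulr0].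
Qed.

(** A bounded [u] is a continuous functional on [l^1], and by the symmetry of [T] a kernel function
    annihilates the range. The approximating function is first replaced by a finite combination [h],
    so that only finite pairings occur. *)
Lemma not_denseX l u (M : R) : inv u -> (forall y, T l u y = 0) ->
  (forall y, nrm (u y) <= M) -> (exists s, u s != 0) -> ~ denseX 1 l.
Proof.
move=> iu Tu uM [s us] dl.
have le11 : (1 : R) <= 1 by [].
have M0 : 0 <= M by apply: le_trans (uM s); exact: nrm_ge0.
(* An approximation of [vtx s] within [e] would give [2 |u s| <= M e < |u s|]. *)
pose e := nrm (u s) / (M + 1).
have e0 : 0 < e by rewrite divr_gt0 ?nrm_gt0 //; lra.
have al : apx 1 l (vtx _ s).
  move=> d d0; have [w [iw fw hw]] := dl (vtx _ s) (inv_vtx _ s) (fin_vtx le11 s) d d0.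
  by exists w; split=> //; exact: ltW.
have two1 : quasi 1 = 1 :> R by rewrite /quasi subrr powRr0.
have [C C0 hC] := bounded_T le11 l.
have e2 : 0 < e / 2 by lra.
have [w [iw fw hw]] := al _ e2.
have ec : 0 < e / (2 * (C + 1)) by rewrite divr_gt0 // mulr_gt0 //; lra.
have [r hr] := finite_combination le11 iw fw ec.
pose h y := \sum_(t <- r) (2^-1 * w t) * vtx _ t y.
have hle : (mass (fun y => T l h y - vtx _ s y)%R <= e%:E)%E.
  rewrite (@mass_ext _ _ _ _ (fun y => T l (fun z => h z - w z) y + (T l w y - vtx _ s y))).
    have h1 : (mass (T l (fun z => h z - w z)%R) <= (e / 2)%:E)%E.
      apply: le_trans (hC _) _; apply: le_trans (lee_wpmul2l _ hr) _; first by rewrite lee_fin.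
      have C1 : 0 < C + 1 by lra.
      have -> : (C%:E * (e / (2 * (C + 1)))%:E = (e / 2 * (C / (C + 1)))%:E)%E.
        by rewrite -EFinM; congr (_%:E); field; rewrite gt_eqF.
      by rewrite lee_fin ler_piMr ?(ltW e2) // ler_pdivrMr //; lra.
    apply: le_trans (mass_leD le11 h1 hw) _; rewrite lee_fin two1; lra.
  by move=> y; rewrite T_B; ring.
have [n hn] := wide_exists (s :: r).
have ph : pairing n (fun y => T l h y - vtx _ s y) u = - (2 * u s).
  have -> : (fun y => T l h y - vtx _ s y) =
      (fun y => \sum_(t <- r) (2^-1 * w t) * T l (vtx _ t) y - vtx _ s y).
    apply/funext => y; congr (_ - _); rewrite /h; elim: (r) => [|t q IHq].
      have -> : (fun z => \sum_(t <- [::]) (2^-1 * w t) * vtx R[i] t z) = fun=> 0.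
        by apply/funext => z; rewrite big_nil.
      by rewrite big_nil /T !cs0 mulr0 addr0 subr0.
    rewrite big_cons -IHq -T_Z -T_D; congr (T l _ y).
    by apply/funext => z; rewrite big_cons.
  have [s1 s2 _ _] := hn s (mem_head _ _) 0.
  rewrite -(pairing_vtx iu s1 s2) /pairing -sumrN.
  under eq_bigr do rewrite mulrBl mulr_suml.
  rewrite big_split /= exchange_big /= big1_seq ?add0r => [|t /andP[_ tr]].
    by apply: eq_bigr => y _.
  have := pairing_T_vtx iu Tu (hn t _); rewrite inE tr orbT => /(_ isT) pt.
  apply: (@etrans _ _ (2^-1 * w t * pairing n (T l (vtx _ t)) u)); last by rewrite pt mulr0.
  by rewrite /pairing mulr_sumr; apply: eq_bigr => y _; rewrite mulrA.
have fh : fin (fun y => T l h y - vtx _ s y) by exact: le_lt_trans hle (ltry _).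
have [le_sum|//] := sum_le_mass n (fun y => T l h y - vtx _ s y).
have le_e : fine (mass (fun y => T l h y - vtx _ s y)%R) <= e.
  by rewrite -lee_fin fineK // ge0_fin_numE ?mass_ge0.
have le_pair : nrm (2 * u s) <= M * e.
  rewrite -nrmN -ph; apply: (@le_trans _ _ (M * \sum_(y <- flags_below n)
     nrm (T l h y - vtx _ s y))); last by rewrite ler_wpM2l //; exact: le_trans le_e.
  rewrite /pairing mulr_sumr; elim: (flags_below n) => [|y q IHq].
    by rewrite !big_nil nrm0.
  rewrite !big_cons; apply: le_trans (nrmD _ _) (lerD _ IHq).
  by rewrite nrmM mulrC ler_wpM2r ?nrm_ge0.
move: le_pair; rewrite nrmM /e.
have -> : nrm (2 : R[i]) = 2 by rewrite -(rmorph_nat (real_complex R)) nrm_real ger0_norm.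
rewrite mulrA ler_pdivlMr; last by lra.
by have := nrm_gt0 us; nra.
Qed.

(** At [l = 4] the extension formula reduces to the midpoint value [- a (c, k)], so this recursion,
    with fuel [n], builds a function fixed by [ext 4]. *)
Fixpoint alternate_rec (n : nat) (x : flag) : R[i] :=
  if n is n'.+1 then
    if x.1 == 0%N then (x.2 == 0)%:R
    else if x.2 == digit x.1 then alternate_rec n' (parent x.1, x.2)
    else - alternate_rec n' (parent x.1, opp x.2 (digit x.1))
  else (x.2 == 0)%:R.

(* The bounded antisymmetric-type eigenfunction for the fixed point 4: each cell
   carries exactly one nonzero value, equal to 1 or -1. *)
Definition alternate x := alternate_rec x.1.+1 x.

Lemma alternate_recE n x : (x.1 < n)%N -> alternate_rec n x = alternate x.
Proof.
rewrite /alternate; move: {-1}(x.1.+1) (ltnSn x.1) => m.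
elim: n m x => [|n IHn] [|m] [c i] //= cm cn.
have [//|c0] := eqVneq c 0%N.
by case: ifP => _; [|congr (- _)]; apply: IHn => /=; rewrite /parent; lia.
Qed.

Lemma alternate0 i : alternate (0%N, i) = (i == 0)%:R.
Proof. by []. Qed.

Lemma alternate_glue : alternate = glue alternate (fun x => - alternate x).
Proof.
apply/funext => x; rewrite (surjective_pairing x) -(sub_parent x.1).
move: (parent x.1) (digit x.1) x.2 => c j i; rewrite glue_sub.
have [s0|sn0] := eqVneq (sub c j) 0%N.
  have c0 : c = 0%N by move: s0; rewrite /sub; lia.
  have j0 : j = 0 by apply: val_inj => /=; move: s0; rewrite /sub; lia.
  rewrite s0 c0 j0 !alternate0; move: i; apply: I3P; rewrite /= ?oppE ?oppr0 //.
rewrite {1}/alternate /= (negbTE sn0) digit_sub parent_sub.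
by case: ifP => _; [|congr (- _)]; rewrite alternate_recE //=; move: sn0; rewrite /sub; lia.
Qed.

Lemma inv_alternate : inv alternate.
Proof.
move=> x; have mids c i j : i != j -> alternate (mate (sub c j, i)) = alternate (sub c j, i).
  move=> ij; rewrite mate_sub (negbTE ij) alternate_glue !glue_sub eq_sym (negbTE ij).
  by rewrite /opp addrC.
elim/flag_ind: x => [i|c i IH|c i j ij]; last exact: mids.
- by have [->|i0] := eqVneq i 0; [rewrite mate00|exact: (mids 0%N i 0 i0)].
- by rewrite mate_lift alternate_glue !glue_lift.
Qed.

(** Since [R(4) = 4] and the factor of [T_ext] at 4 is -1, [T 4 alternate] vanishes at midpoints and
    reproduces its opposite at coarse vertices; only the boundary point needs a computation. *)
Lemma T_alternate x : T 4 alternate x = 0.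
Proof.
have e y : T 4 alternate y = glue (fun z => - T 4 alternate z) (fun=> 0) y.
  rewrite {1}alternate_glue (T_glue _ _ inv_alternate); congr (glue _ _ y);
    apply/funext => z; last by rewrite !csE; ring.
  have csN c : cs (fun x => - alternate x) c = - cs alternate c.
    by rewrite /cs sumrN.
  by rewrite !csN /T inv_alternate; ring.
have mids c i j : i != j -> T 4 alternate (sub c j, i) = 0.
  by move=> ij; rewrite e glue_sub (negbTE ij).
elim/flag_ind: x => [i|c i IH|c i j ij]; last exact: mids.
- have [->|i0] := eqVneq i 0; last exact: (mids 0%N i 0 i0).
  by rewrite /T mate00 /= csE !alternate0 /=; ring.
- by rewrite e glue_lift IH oppr0.
Qed.

Lemma nrm_alternate x : nrm (alternate x) <= 1.
Proof.
case: x => c; move: c; apply: cell_ind => [i|c j IHc i].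
  rewrite alternate0; case: (i == 0); rewrite ?nrm0 //.
  by rewrite [nrm _]Normc.normc1.
by rewrite alternate_glue glue_sub; case: ifP => _; rewrite ?nrmN IHc.
Qed.

Lemma bounded_eigenfunction4 k l : iter k (@decimation R) l = 4 ->
  exists u (M : R), [/\ inv u, forall y, T l u y = 0,
    forall y, nrm (u y) <= M & exists s, u s != 0].
Proof.
elim: k l => [l /= ->|k IHk l].
  exists alternate, 1; split; [exact: inv_alternate|exact: T_alternate|exact: nrm_alternate|].
  by exists (0%N, 0); rewrite alternate0 eqxx oner_neq0.
have [->|l5] := eqVneq l 5; first by rewrite iter5 => /esym/eqP; rewrite pnatr_eq0.
have [->|l2] := eqVneq l 2; first by move/(@iter2 _ _ 4) => [].
rewrite iterSr => /IHk[u [M [iu Tu uM [s us]]]].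
have d2 : 2 - l != 0 by rewrite subr_eq0 eq_sym.
have d5 : 5 - l != 0 by rewrite subr_eq0 eq_sym.
have M0 : 0 <= M := le_trans (nrm_ge0 _) (uM s).
pose Q := (nrm (4 - l) * (M + M + M) + nrm (2 - l) * M) / nrm (disc l).
have Q0 : 0 <= Q by rewrite divr_ge0 ?addr_ge0 ?mulr_ge0 ?addr_ge0 ?nrm_ge0.
exists (ext l u), (M + Q); split.
- exact: inv_ext.
- exact: ext_kernel.
- move=> y; rewrite /ext /glue; case: ifP => _; first by apply: le_trans (uM _) _; lra.
  rewrite nrmM nrmV; apply: (@le_trans _ _ Q); last by lra.
  rewrite ler_wpM2r ?invr_ge0 ?nrm_ge0 // csE.
  apply: le_trans (nrmB _ _) _; rewrite !nrmM lerD // ler_wpM2l ?nrm_ge0 //.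
  by apply: le_trans (nrmD _ _) _; rewrite lerD //; apply: le_trans (nrmD _ _) _; rewrite lerD.
- by exists (lift s); rewrite /ext glue_lift.
Qed.

Lemma not_denseX_zero : ~ denseX 1 (0 : R[i]).
Proof.
apply: (@not_denseX _ (fun=> 1) 1) => [//|y|y|].
- by rewrite /T !csE; ring.
- by rewrite [nrm _]Normc.normc1.
- by exists (0%N, 0); exact: oner_neq0.
Qed.

Lemma not_denseX_Sigma4 l : Sigma4 R l -> ~ denseX 1 l.
Proof.
move=> [k _ /= /bounded_eigenfunction4[u [M [iu Tu uM us]]]].
exact: (not_denseX iu Tu uM us).
Qed.

End NotDense.

(** * Transport to the Sierpinski lattice *)

Section Geometry.
Variable R : realType.
Implicit Types (x y z : R * R) (l : seq 'I_3) (i j k d : 'I_3) (m n s : nat).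

Definition q i : R * R :=
  match val i with 0%N => (2^-1, Num.sqrt 3 / 2) | 1%N => (0, 0) | _ => (1, 0) end.

Lemma V0E x : V0 x <-> exists j, x = q j.
Proof.
split=> [[[->|->]|->]|[j ->]].
- by exists 0.
- by exists 1.
- by exists (1 + 1).
- by move: j; apply: I3P; [left; left|left; right|right].
Qed.

Lemma F_dbl i x : F i x + F i x = x + q i.
Proof.
case: x => a b; move: i; apply: I3P; rewrite /F /translation /q /=;
  by congr (_, _) => /=; field.
Qed.

Lemma dbl_inj x y : x + x = y + y -> x = y.
Proof.
by case: x y => [a b] [c d] [h1 h2]; congr (_, _); lra.
Qed.

Lemma mulrn_pow_inj m x y : x *+ 2 ^ m = y *+ 2 ^ m -> x = y.
Proof.
elim: m x y => [//|m IHm] x y; rewrite expnS !mulrnA => /IHm.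
by rewrite !mulr2n; exact: dbl_inj.
Qed.

(** The sum of [2 ^ s] times [q] of the [s]-th letter: the translation part of the composed
    contractions after multiplication by [2 ^ size l], free of fractions. *)
Definition S l : R * R := foldr (fun i v => q i + (v + v)) 0 l.

Lemma S_cat l1 l2 : S (l1 ++ l2) = S l1 + S l2 *+ 2 ^ size l1.
Proof.
elim: l1 => [|i l1 IH] /=; first by rewrite add0r.
rewrite IH expnS mulnC mulrnA mulr2n.
by rewrite -[RHS]addrA; congr (_ + _); exact: addrACA.
Qed.

Lemma S_nseq n i : S (nseq n i) + q i = q i *+ 2 ^ n.
Proof.
elim: n => [|n IHn] /=; first by rewrite add0r.
by rewrite expnS mulnC mulrnA -IHn mulr2n addrAC [LHS]addrACA ![q i + _]addrC.
Qed.

Fixpoint zoom (w : nat -> 'I_3) m x := if m is m'.+1 then F (w m') (zoom w m' x) else x.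

Lemma blowupE w m (A : set (R * R)) x : blowup w m A x <-> A (zoom w m x).
Proof. by elim: m A => [//|m IHm] A; rewrite /= IHm. Qed.

Lemma zoomE w m x : zoom w m x *+ 2 ^ m = x + S (mkseq w m).
Proof.
elim: m => [|m IHm]; first by rewrite /= addr0.
rewrite expnS mulrnA [zoom _ _ _]/= mulr2n F_dbl mulrnDl IHm.
by rewrite mkseqS -cats1 S_cat size_mkseq /= !addr0 addrA.
Qed.

Definition address l x := foldl (fun z i => F i z) x l.

Lemma addressE l x : address l x *+ 2 ^ size l = x + S l.
Proof.
elim/last_ind: l => [|l i IHl]; first by rewrite /= addr0.
rewrite /address foldl_rcons size_rcons expnS mulrnA mulr2n F_dbl mulrnDl IHl.
by rewrite -cats1 S_cat /= !addr0 addrA.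
Qed.

Lemma cellE l y : cell l y <-> exists j, y = address l (q j).
Proof.
elim/last_ind: l y => [|l i IHl] y; first exact: V0E.
rewrite /cell foldl_rcons /address; split.
  by move=> [z /IHl[j ->] <-]; exists j; rewrite foldl_rcons.
move=> [j ->]; exists (address l (q j)); last by rewrite foldl_rcons.
by apply/IHl; exists j.
Qed.

Lemma VE m y : V m y <-> exists2 l, size l = m & cell l y.
Proof.
elim: m y => [|m IHm] y; first by split=> [|[[]]] //; exists [::].
split=> [[i _ [z /IHm[l sl cz] <-]]|[l sl cy]].
  by exists (rcons l i); rewrite ?size_rcons ?sl // /cell foldl_rcons; exists z.
move: l sl cy; case/lastP => [//|l i]; rewrite size_rcons => -[sl].
rewrite /cell foldl_rcons => -[z cz <-]; exists i => //; exists z => //.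
by apply/IHm; exists l.
Qed.

Variable w : nat -> 'I_3.

(* [x] is the corner [j] of the cell [l] of the blow-up of level [size l]; the
   equation is this assertion multiplied by [2 ^ size l]. *)
Definition incident x l j := x + S (mkseq w (size l)) = q j + S l.

Lemma blowup_cell x l : blowup w (size l) (@cell R l) x <-> exists j, incident x l j.
Proof.
rewrite blowupE cellE; split=> -[j e]; exists j.
  by rewrite /incident -zoomE -addressE e.
by apply: (@mulrn_pow_inj (size l)); rewrite zoomE addressE.
Qed.

Lemma mkseq_add a b :
  mkseq w (a + b) = mkseq w a ++ mkseq (fun s => w (a + s)%N) b.
Proof. by rewrite /mkseq iotaD map_cat -[X in iota X b]addn0 add0n iotaDl -map_comp. Qed.

(** The appended contractions cancel the new inverse maps of the blow-up, so a cell keeps its place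
    at all higher levels. *)
Lemma incident_extend x l j n : incident x l j ->
  incident x (l ++ mkseq (fun s => w (size l + s)%N) n) j.
Proof.
rewrite /incident size_cat [size (mkseq _ n)]size_mkseq mkseq_add !S_cat size_mkseq !addrA.
by move=> ->.
Qed.

Lemma latticeE x : lattice R w x <-> exists l j, incident x l j.
Proof.
split=> [[m m1]|[l [j xl]]].
  rewrite blowupE => /VE[l sl cz].
  have [j ij] : exists j, incident x l j by apply/blowup_cell; rewrite sl blowupE.
  by exists l, j.
have := incident_extend 1 xl; set l' := _ ++ _ => xl'.
exists (size l'); first by rewrite /= /l' size_cat size_mkseq addn1.
rewrite blowupE; apply/VE; exists l' => //; apply/(blowupE w).
by apply/blowup_cell; exists j.
Qed.

Lemma adjacentE x y : Defs.adjacent w x y <->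
  x <> y /\ exists l j k, incident x l j /\ incident y l k.
Proof.
split=> [[xy [m [m1 [[l sl] [/= bx by_]]]]]|[xy [l [j [k [xl yl]]]]]].
  split=> //; exists l; move: bx by_; rewrite -(eqP sl).
  by move=> /blowup_cell[j xj] /blowup_cell[k yk]; exists j, k.
split=> //; have := incident_extend 1 xl; have := incident_extend 1 yl.
set l' := _ ++ _ => yl' xl'; exists (size l'); split.
  by rewrite /l' size_cat size_mkseq addn1.
by exists (in_tuple l'); split; apply/blowup_cell; [exists j|exists k].
Qed.

Lemma sqrt3_gt0 : 0 < Num.sqrt 3 :> R.
Proof. by rewrite sqrtr_gt0. Qed.

Lemma q_inj : injective q.
Proof.
have s3 := sqrt3_gt0; apply: I3P; apply: I3P => // h; exfalso;
  have := f_equal snd h; have := f_equal fst h; rewrite /q /=; lra.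
Qed.

Lemma q_not_collinear j k d : j != k -> j != d -> q j + q j <> q k + q d.
Proof.
have s3 := sqrt3_gt0; move: j k d; apply: I3P; apply: I3P; apply: I3P => // _ _ h;
  have := f_equal snd h; have := f_equal fst h; rewrite /q /=; lra.
Qed.

(* Through a vertex whose address is not eventually its own corner passes a
   second cell, giving at least three neighbours. *)
Lemma second_cell x l j : incident x l j -> has (predC1 j) l ->
  exists l2 d, incident x l2 d /\ d != j.
Proof.
move=> xl hl; set n := find (predC1 j) l; set d := nth j l n.
have nl : (n < size l)%N by rewrite -has_find.
have dj : d != j by exact: (nth_find j hl).
have lE : l = nseq n j ++ d :: drop n.+1 l.
  rewrite -[LHS](cat_take_drop n) (drop_nth j nl); congr (_ ++ _).
  apply: (@eq_from_nth _ j); first by rewrite size_take nl size_nseq.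
  move=> s; rewrite size_take nl => sn; rewrite nth_take // nth_nseq sn.
  by apply/eqP; have /= /negbFE := before_find j sn.
(* Corner [j] of the cell [j...j d r] is corner [d] of the cell [d...d j r], the point where the
   subcells [d] and [j] of one triangle touch. *)
exists (nseq n d ++ j :: drop n.+1 l), d; split=> //.
rewrite lE in xl; move: (drop n.+1 l) xl => r.
rewrite /incident !size_cat !size_nseq /= => ->.
rewrite !S_cat !size_nseq /= !mulrnDl.
have e i i' t : q i + (S (nseq n i) + (q i' *+ 2 ^ n + t)) = q i *+ 2 ^ n + q i' *+ 2 ^ n + t.
  by rewrite addrA [q i + _]addrC S_nseq addrA.
by rewrite !e [q j *+ _ + _]addrC.
Qed.

End Geometry.

(** * Integer coordinates separate vertices *)

Section LatticeCoordinates.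
Implicit Types (y z : flag) (l : seq 'I_3) (c n m : nat) (i j k : 'I_3).

Fixpoint digits_rec n c : seq 'I_3 :=
  if n is n'.+1 then if c == 0%N then [::] else digit c :: digits_rec n' (parent c)
  else [::].
Definition digits c := digits_rec c.+1 c.

Lemma digits_recE n c : (c < n)%N -> digits_rec n c = digits c.
Proof.
rewrite /digits; move: {-1}(c.+1) (ltnSn c) => m.
elim: n m c => [|n IHn] [|m] c //= cm cn; case: eqP => // c0.
by congr cons; apply: IHn; rewrite /parent; lia.
Qed.

Lemma digits_sub c j : digits (sub c j) =
  if sub c j == 0%N then [::] else j :: digits c.
Proof.
rewrite {1}/digits /=; case: eqP => // c0; rewrite digit_sub parent_sub digits_recE //.
by move: c0; rewrite /sub; lia.
Qed.

Definition code l : nat := foldr (fun k c => sub c k) 0%N l.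

Lemma code_digits c : code (digits c) = c.
Proof.
move: c; apply: cell_ind => // c j IHc; rewrite digits_sub.
by case: eqP => [->|_] //=; rewrite IHc.
Qed.

Definition unit_pt k : nat * nat := (val k == 1%N : nat, val k == 2%N : nat).

Definition posn c : nat * nat :=
  foldr (fun k v => ((unit_pt k).1 + 2 * v.1, (unit_pt k).2 + 2 * v.2)%N) (0, 0)%N (digits c).

Lemma posn_sub c j : posn (sub c j) =
  ((unit_pt j).1 + 2 * (posn c).1, (unit_pt j).2 + 2 * (posn c).2)%N.
Proof.
rewrite {1}/posn digits_sub; case: eqP => // s0.
have c0 : c = 0%N by move: s0; rewrite /sub; lia.
have j0 : j = 0 by apply: val_inj => /=; move: s0; rewrite /sub; lia.
by rewrite c0 j0.
Qed.

(* Integer coordinates of a vertex in the basis of the two sides of the smallest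
   triangle at the boundary point. *)
Definition vert (y : flag) : nat * nat :=
  ((unit_pt y.2).1 + (posn y.1).1, (unit_pt y.2).2 + (posn y.1).2)%N.

Lemma vert_sub c k j : vert (sub c k, j) =
  ((unit_pt j).1 + (unit_pt k).1 + 2 * (posn c).1,
   (unit_pt j).2 + (unit_pt k).2 + 2 * (posn c).2)%N.
Proof. by rewrite /vert posn_sub /= !addnA. Qed.

Lemma vert_lift y : vert (lift y) = (2 * (vert y).1, 2 * (vert y).2)%N.
Proof.
case: y => c j; rewrite vert_sub /vert /=; congr (_, _); lia.
Qed.

Lemma vert_mate y : vert (mate y) = vert y.
Proof.
have mids c k j : j != k -> vert (mate (sub c k, j)) = vert (sub c k, j).
  by move=> jk; rewrite mate_sub (negbTE jk) !vert_sub; congr (_ + _, _ + _)%N; rewrite addnC.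
elim/flag_ind: y => [j|c j IH|c j k jk]; last exact: mids.
- by have [->|j0] := eqVneq j 0; [rewrite mate00|exact: (mids 0%N 0 j j0)].
- by rewrite mate_lift !vert_lift IH.
Qed.

(** The parities of the two coordinates tell whether the vertex is coarse and, if not, on which side
    of its coarse cell it is the midpoint. A coarse vertex is halved and treated by induction. *)
Lemma vert_inj y z : vert y = vert z -> z = y \/ z = mate y.
Proof.
have posn_inj c c' : posn c = posn c' -> c = c'.
  move: c c'; apply: cell_ind => [c'|c k IHc c'].
    move: c'; apply: cell_ind => // c' k' IHc'; rewrite posn_sub => -[].
    move=> /= h1 h2; have k0 : k' = 0 by move: k' h1 h2; apply: I3P => //=; lia.
    have c0 : 0%N = c'.
      by apply: IHc'; rewrite [RHS]surjective_pairing; congr (_, _); lia.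
    by rewrite k0 -c0.
  rewrite -(sub_parent c') !posn_sub => -[h1 h2].
  have [ek ec] : k = digit c' /\ posn c = posn (parent c').
    move: h1 h2; rewrite [posn c]surjective_pairing [posn (parent c')]surjective_pairing /=.
    move: (digit c') k {IHc}; apply: I3P; apply: I3P => /= h1 h2; (split=> //; congr (_, _); lia) || lia.
  by rewrite -ek -(IHc _ ec).
have parity c c' j k j' k' : vert (sub c k, j) = vert (sub c' k', j') ->
    (j = k /\ j' = k') \/
    [/\ j != k, c = c' & (j' = j /\ k' = k) \/ (j' = k /\ k' = j)].
  rewrite !vert_sub => -[h1 h2].
  have : (j = k /\ j' = k') \/ [/\ j != k, posn c = posn c' &
      (j' = j /\ k' = k) \/ (j' = k /\ k' = j)]; last first.
    by move=> [h|[jk /posn_inj cc h]]; [left|right].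
  rewrite [posn c]surjective_pairing [posn c']surjective_pairing.
  move: (posn c).1 (posn c).2 (posn c').1 (posn c').2 h1 h2 => a b a' b'.
  move: j k j' k'; do 4 apply: I3P; rewrite /= => h1 h2;
  first [ by left | by exfalso; lia
        | by right; split=> //; [congr (_, _); lia|left]
        | by right; split=> //; [congr (_, _); lia|right] ].
have step c k j t : (forall z', vert (c, k) = vert z' -> z' = (c, k) \/ z' = mate (c, k)) ->
    vert (sub c k, j) = vert t -> t = (sub c k, j) \/ t = mate (sub c k, j).
  rewrite (surjective_pairing t) -(sub_parent t.1); move: (parent t.1) (digit t.1) t.2.
  move=> c' k' j' IH /[dup] h /parity[[jk jk']|[jk <- [[-> ->]|[-> ->]]]].
  - rewrite jk jk' in h *; rewrite -!/(lift (_, _)) !vert_lift in h *.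
    have /IH[<-|e] : vert (c, k) = vert (c', k').
      by move: h; move: (vert (c, k)) (vert (c', k')) => [a b] [a' b'] /= [h1 h2]; congr (_, _); lia.
    + by left.
    + by right; rewrite mate_lift -e.
  - by left.
  - by right; rewrite mate_sub (negbTE jk).
case: y => c j; move: c j z; apply: cell_ind => [j z|c k IH j z]; last by apply: step => z'; exact: IH.
apply: (step 0%N 0 j z) => z' h; left.
have hp : vert (0%N, 0) = (0, 0)%N by [].
rewrite hp /vert in h; case: h => h1 h2.
have k0 : z'.2 = 0 by move: (z'.2) h1 h2; apply: I3P => //=; lia.
have c0 : z'.1 = 0%N.
  by apply: posn_inj; rewrite [LHS]surjective_pairing; congr (_, _) => /=; lia.
by rewrite (surjective_pairing z') k0 c0.
Qed.

End LatticeCoordinates.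

(** * The plane lattice in the coordinates of the boundary point *)

Section Coordinates.
Variable R : realType.
Implicit Types (x y z : R * R) (l : seq 'I_3) (i j k d : 'I_3) (m n s : nat).
Variable w : nat -> 'I_3.

Definition mkL x (hx : lattice R w x) : lattice R w := SigSub (mem_set hx).

(** If [x] is corner [j] of a cell and a later letter of the word differs from [j], then
    [second_cell] applies: two neighbours in one cell and one in another contradict the count of
    two. *)
Lemma boundary_eventually_constant (x : lattice R w) : boundary_point x ->
  exists i M, forall s, (M <= s)%N -> w s = i.
Proof.
move=> bx; have /latticeE[l [j xl]] := set_valP x.
exists j, (size l) => s ls; apply: contrapT => ws.
pose l1 := l ++ mkseq (fun t => w (size l + t)%N) (s - size l).+1.
have xl1 : incident w (val x) l1 j by exact: incident_extend.
have hl1 : has (predC1 j) l1.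
  rewrite has_cat; apply/orP; right; rewrite mkseqS -cats1 has_cat /= subnKC //.
  by rewrite orbF; apply/orP; right; apply/eqP.
have [l2 [d [xl2 dj]]] := second_cell xl1 hl1.
have nb l' i k y : incident w (val x) l' i -> k != i -> y = val x + q R k - q R i ->
    exists2 v : lattice R w, val v = y & neighbours x v.
  move=> xi ki ->; set y' := _ + _ - _.
  have yk : incident w y' l' k.
    have vx : val x = q R i + S R l' - S R (mkseq w (size l')) by rewrite -xi addrK.
    by rewrite /incident /y' vx; ring.
  have Ly : lattice R w y' by apply/latticeE; exists l', k.
  exists (mkL Ly) => //; apply/adjacentE; split; last by exists l', i, k.
  move=> e; case/eqP: ki; apply: (@q_inj R); apply/eqP; rewrite -subr_eq0.
  by apply/eqP/(@addrI _ (val x)); rewrite addrA addr0; exact: esym e.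
have ne (a b : 'I_3) : a != b -> q R a != q R b by move=> ab; apply: contra ab => /eqP/(@q_inj R)->.
have j1 : j + 1 != j by move: (j); apply: I3P.
have j2 : j + (1 + 1) != j by move: (j); apply: I3P.
have [v1 e1 n1] := nb _ _ _ _ xl1 j1 erefl.
have [v2 e2 n2] := nb _ _ _ _ xl1 j2 erefl.
rewrite eq_sym in dj; have [v3 e3 n3] := nb _ _ _ _ xl2 dj erefl.
have v12 : v1 <> v2.
  move=> /(f_equal val); rewrite e1 e2 => /addIr/addrI/(@q_inj R)/addrI.
  by move/(f_equal val).
have coll k : k != j -> val x + q R k - q R j <> val x + q R j - q R d.
  move=> kj; rewrite -!addrA => /addrI/eqP; rewrite subr_eq addrAC eq_sym subr_eq eq_sym => /eqP.
  by move/esym; apply: q_not_collinear; rewrite // eq_sym.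
have v13 : v1 <> v3 by move=> /(f_equal val); rewrite e1 e3; exact: coll.
have v23 : v2 <> v3 by move=> /(f_equal val); rewrite e2 e3; exact: coll.
have /card_set_bijP[f [fI finj _]] := bx.
have f1 := fI _ n1; have f2 := fI _ n2; have f3 := fI _ n3; rewrite /= in f1 f2 f3.
have f12 : f v1 <> f v2 by move=> e; apply: v12; apply: finj; rewrite ?inE.
have f13 : f v1 <> f v3 by move=> e; apply: v13; apply: finj; rewrite ?inE.
have f23 : f v2 <> f v3 by move=> e; apply: v23; apply: finj; rewrite ?inE.
lia.
Qed.

Section Corner.
Variables (i : 'I_3) (M : nat).
Hypothesis wi : forall s, (M <= s)%N -> w s = i.

Definition edge k : R * R := q R (i + k) - q R i.

Definition vec (t : nat * nat) : R * R := edge 1 *+ t.1 + edge (1 + 1) *+ t.2.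

Lemma edge0 : edge 0 = 0. Proof. by rewrite /edge addr0 subrr. Qed.

Lemma vec_inj : injective vec.
Proof.
have s3 := sqrt3_gt0 R.
have mulrn_fst (z : R * R) n : (z *+ n).1 = z.1 * n%:R.
  by elim: n => [|n IHn]; rewrite ?mulr0 // mulrS /= IHn -[n.+1]add1n natrD mulrDr mulr1.
have mulrn_snd (z : R * R) n : (z *+ n).2 = z.2 * n%:R.
  by elim: n => [|n IHn]; rewrite ?mulr0 // mulrS /= IHn -[n.+1]add1n natrD mulrDr mulr1.
have vE t : vec t = ((edge 1).1 * t.1%:R + (edge (1 + 1)).1 * t.2%:R,
                     (edge 1).2 * t.1%:R + (edge (1 + 1)).2 * t.2%:R).
  rewrite [LHS]surjective_pairing /vec /= !mulrn_fst !mulrn_snd.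
  by [].
move=> [a b] [c d]; rewrite !vE => -[].
have I3add : (1 + (1 + 1) = 0 :> 'I_3) * (1 + 1 + 1 = 0 :> 'I_3) *
  (1 + 1 + (1 + 1) = 1 :> 'I_3) by do !split; apply: val_inj.
have nat_eq (n m : nat) : n%:R = m%:R :> R -> n = m by move/eqP; rewrite eqr_nat => /eqP.
move=> h1 h2; suff [ac bd] : (a%:R = c%:R :> R) /\ (b%:R = d%:R :> R).
  by rewrite (nat_eq _ _ ac) (nat_eq _ _ bd).
have mulS (u v : R) : Num.sqrt 3 * u = Num.sqrt 3 * v -> u = v.
  by apply: mulfI; rewrite gt_eqF.
rewrite /edge in h1 h2; move: (i) h1 h2; apply: I3P; rewrite ?add0r ?I3add /q /= => h1 h2.
- have h3 : a%:R + b%:R = c%:R + d%:R :> R by apply: mulS; lra.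
  by split; lra.
- have h3 : b%:R = d%:R :> R by apply: mulS; lra.
  by split; lra.
- have h3 : a%:R = c%:R :> R by apply: mulS; lra.
  by split; lra.
Qed.

(** The boundary point: corner [i] of the cell with address [i...i] at level [M]. *)
Definition base : R * R := S R (nseq M i) - S R (mkseq w M) + q R i.

Definition point (y : flag) : R * R := base + vec (vert y).

Lemma point_mate (y : flag) : point (mate y) = point y.
Proof. by rewrite /point vert_mate. Qed.

Lemma point_inj (y z : flag) : point y = point z -> z = y \/ z = mate y.
Proof. by move/addrI/vec_inj/vert_inj. Qed.

Lemma vec_add t1 t2 : vec (t1.1 + t2.1, t1.2 + t2.2)%N = vec t1 + vec t2.
Proof. by rewrite /vec /= !mulrnDr; ring. Qed.

Lemma vec_unit k : vec (unit_pt k) = edge k.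
Proof.
move: k; apply: I3P; rewrite /vec /= ?mulr0n ?mulr1n ?addr0 ?add0r //.
by rewrite edge0.
Qed.

Lemma vec_vert (y : flag) : vec (vert y) = edge y.2 + vec (posn y.1).
Proof. by rewrite /vert vec_add vec_unit. Qed.

Lemma vec_step j t :
  vec ((unit_pt j).1 + 2 * t.1, (unit_pt j).2 + 2 * t.2)%N = edge j + (vec t + vec t).
Proof.
rewrite -vec_unit -!vec_add; congr vec; congr (_, _) => /=; lia.
Qed.

(** Relabels letters so that the eventual letter [i] becomes the digit 0; the padding in
    [incident_extend] then only adds most significant zeros, which [code] ignores. *)
Definition shift l := [seq k - i | k <- l].

Lemma S_shift l : S R l - S R (nseq (size l) i) = vec (posn (code (shift l))).
Proof.
elim: l => [|k l IHl] /=; first by rewrite subrr /vec /= !mulr0n addr0.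
rewrite posn_sub vec_step -IHl /edge [i + _]addrC subrK.
by move: (S R l) (S R (nseq (size l) i)) => u v; ring.
Qed.

Lemma incident_point x l j : (M <= size l)%N ->
  incident w x l j <-> x = point (code (shift l), j - i).
Proof.
move=> Ml; rewrite /incident /point vec_vert -S_shift /edge [i + _]addrC subrK.
have mk : mkseq w (size l) = mkseq w M ++ nseq (size l - M) i.
  rewrite -{1}(subnKC Ml) mkseq_add; congr (_ ++ _).
  apply: (@eq_from_nth _ i); rewrite ?size_mkseq ?size_nseq // => s sl.
  by rewrite nth_mkseq // nth_nseq sl wi // leq_addr.
have ns : S R (nseq (size l) i) = S R (nseq M i) + S R (nseq (size l - M) i) *+ 2 ^ M.
  by rewrite -{1}(subnKC Ml) nseqD S_cat size_nseq.
rewrite mk S_cat size_mkseq ns /base /=.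
move: (S R (nseq (size l - M) i) *+ 2 ^ M) (S R (nseq M i)) (S R (mkseq w M)) (S R l).
move=> a b c d; split=> [e|->]; last by ring.
have -> : x = x + (c + a) - (c + a) by ring.
by rewrite e; ring.
Qed.

Lemma code_pad l n : code (l ++ nseq n 0) = code l.
Proof.
rewrite /code foldr_cat; congr foldr; elim: n => //= n ->.
by [].
Qed.

Lemma lattice_point x : lattice R w x <-> exists y : flag, x = point y.
Proof.
split=> [/latticeE[l [j xl]]|[[c k] ->]].
  have := incident_extend M xl; set l' := _ ++ _ => /incident_point e.
  by eexists; apply: e; rewrite /l' size_cat size_mkseq leq_addl.
apply/latticeE; exists ([seq d + i | d <- digits c] ++ nseq M i), (k + i).
apply/incident_point; first by rewrite size_cat size_nseq leq_addl.
rewrite addrK /shift map_cat -map_comp map_nseq subrr code_pad.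
rewrite (eq_map (g := id)) ?map_id ?code_digits // => d /=.
by rewrite addrK.
Qed.

Lemma adjacent_point x x' : Defs.adjacent w x x' <->
  x <> x' /\ exists c j k, x = point (c, j) /\ x' = point (c, k).
Proof.
split=> [/adjacentE[xy [l [j [k [xl yl]]]]]|[xy [c [j [k [xx yy]]]]]].
  split=> //; have := incident_extend M xl; have := incident_extend M yl.
  set l' := _ ++ _ => yl' xl'.
  have Ml : (M <= size l')%N by rewrite /l' size_cat size_mkseq leq_addl.
  exists (code (shift l')), (j - i), (k - i).
  by split; apply/incident_point.
apply/adjacentE; split=> //.
exists ([seq d + i | d <- digits c] ++ nseq M i), (j + i), (k + i).
have e : code (shift ([seq d + i | d <- digits c] ++ nseq M i)) = c.
  rewrite /shift map_cat -map_comp map_nseq subrr code_pad.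
  rewrite (eq_map (g := id)) ?map_id ?code_digits // => d /=.
  by rewrite addrK.
by split; apply/incident_point; rewrite ?xx ?yy ?size_cat ?size_nseq ?leq_addl // e addrK.
Qed.

End Corner.
End Coordinates.

(** * Transport of the Laplacian, the norms and the spectra *)

Section Transport.
Variable R : realType.
Variables (w : nat -> 'I_3) (i : 'I_3) (M : nat).
Hypothesis wi : forall s, (M <= s)%N -> w s = i.
Implicit Types (y z : flag) (x v : lattice R w) (l : R[i]).
Local Notation L := (lattice R w).

Definition prj y : L := mkL (proj2 (lattice_point wi _) (ex_intro _ y erefl)).

Lemma prj_mate y : prj (mate y) = prj y.
Proof. by apply: val_inj; rewrite /= point_mate. Qed.

Lemma prj_inj y z : prj y = prj z -> z = y \/ z = mate y.
Proof. by move/(f_equal val) => /= /point_inj. Qed.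

Lemma prj_surj x : exists y, x = prj y.
Proof.
have /(lattice_point wi)[y e] := set_valP x.
by exists y; apply: val_inj.
Qed.

Definition sec x : flag := xget (0%N, 0) [set y | x = prj y].

Lemma secK x : prj (sec x) = x.
Proof. by rewrite /sec; case: xgetP => [y _ //|] ; have [y e] := prj_surj x => /(_ y). Qed.

Definition around y : seq flag := [:: rot y; rot (rot y); rot (mate y); rot (rot (mate y))].

Lemma same_cell c j k : j != k -> (c, k) = rot (c, j) \/ (c, k) = rot (rot (c, j)).
Proof.
by rewrite /rot /=; move: j k; do 2!apply: I3P; move=> // _;
  (by left; congr (_, _); apply: val_inj) || (by right; congr (_, _); apply: val_inj).
Qed.

Lemma prj_same_cell c j k : prj (c, j) = prj (c, k) -> j = k.
Proof. by move/prj_inj => [[->]|/esym/mate_corner]. Qed.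

Lemma neighbours_prj y v : neighbours (prj y) v <-> exists2 z, z \in around y & v = prj z.
Proof.
rewrite /neighbours /=; split=> [/(adjacent_point wi)[ne [c [j [k [e1 e2]]]]]|].
  have vk : v = prj (c, k) by apply: val_inj.
  have yj : prj y = prj (c, j) by apply: val_inj.
  have jk : j != k.
    by apply/eqP => jk; apply: ne; rewrite e1 e2 jk.
  exists (c, k) => //; have [->|->] := same_cell c jk; have [->|->] := prj_inj yj;
    by rewrite !inE eqxx ?orbT.
have adj z z' : prj z = prj y -> z'.1 = z.1 -> z'.2 != z.2 ->
    Defs.adjacent w (val (prj y)) (val (prj z')).
  move=> zy c1 c2; rewrite -zy; apply/(adjacent_point wi); split.
    move/val_inj; rewrite (surjective_pairing z) (surjective_pairing z') c1 => /prj_same_cell e.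
    by rewrite e eqxx in c2.
  exists z.1, z.2, z'.2; rewrite -{2}c1 -!surjective_pairing.
  by [].
have r1 (z : flag) : (rot z).2 != z.2 by case: z => c; apply: I3P.
have r2 (z : flag) : (rot (rot z)).2 != z.2 by case: z => c; apply: I3P.
move=> [z + ->]; rewrite !inE => /or4P[]/eqP ->.
- exact: (adj y).
- exact: (adj y).
- by apply: (adj (mate y)) => //; exact: prj_mate.
- by apply: (adj (mate y)) => //; exact: prj_mate.
Qed.

(** Excludes coincidences among the neighbours of a vertex that lie in its two different cells. *)
Lemma mate_two_corners c j k : (mate (c, j)).1 = (mate (c, k)).1 -> j = k.
Proof.
rewrite -(sub_parent c) !mate_sub; move: (parent c) (digit c) => d a.
have cross j' k' : j' = a -> k' != a -> (lift (mate (d, j'))).1 <> sub d k'.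
  move=> -> ka; case e: (mate (d, a)) => [d' a'] /= /sub_inj[ed ea].
  by rewrite ed in e; move: (mate_corner e) ka; rewrite ea => ->; rewrite eqxx.
case: eqP => [ja|/eqP ja]; case: eqP => [ka|/eqP ka] /=.
- by rewrite ja ka.
- by move/cross => /(_ ja ka).
- by move/esym/cross => /(_ ka ja).
- by move/sub_inj => [].
Qed.

Lemma prj_eq_cells y z : prj y = prj z -> y.1 = z.1 -> y = z.
Proof.
case: y z => c j [d k] /= + e; rewrite e => /prj_same_cell ->.
by [].
Qed.

Lemma uniq_around y : mate y != y -> uniq (map prj (around y)).
Proof.
move=> my; have I3add : (1 + 1 + 1 = 0 :> 'I_3) by apply: val_inj.
have r12 (z : flag) : prj (rot z) != prj (rot (rot z)).
  apply/eqP => /prj_eq_cells /= /(_ erefl) /(f_equal snd) /=.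
  by case: z => c; apply: I3P.
have cells : y.1 != (mate y).1.
  apply: contraNneq my => e; apply/eqP; apply: prj_eq_cells; last by rewrite -e.
  exact: prj_mate.
have cross (z z' : flag) : z.1 = y.1 -> z'.1 = (mate y).1 -> z.2 != y.2 -> prj z != prj z'.
  move=> zy zy' z2; apply/eqP => /prj_inj[e|e].
    by rewrite -zy -zy' e eqxx in cells.
  case/eqP: z2; apply: (@mate_two_corners y.1).
  by rewrite -{1}zy -!surjective_pairing -e zy'.
have c1 (z : flag) : (rot z).2 != z.2 by case: z => c; apply: I3P.
have c2 (z : flag) : (rot (rot z)).2 != z.2 by case: z => c; apply: I3P.
rewrite /= !inE !negb_or; rewrite !r12 !cross //.
Qed.

Lemma card_uniq_seq (T : choiceType) (s : seq T) : uniq s -> ([set` s] #= `I_(size s))%card.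
Proof.
move=> us; apply/card_set_bijP; exists (index^~ s); split.
- by move=> a /=; rewrite index_mem.
- by move=> a b /set_mem /= ha /set_mem /= hb e; rewrite -(nth_index a ha) e nth_index.
- move=> n /= ns; case: s us ns => [//|a s] us ns.
  by exists (nth a (a :: s) n); rewrite ?mem_nth // index_uniq.
Qed.

(** The cardinality test for boundary points is decided by counting: two neighbours if [mate] fixes
    [y], and four different ones otherwise. *)
Lemma laplacian_prj (f : L -> R[i]) y :
  laplacian f (prj y) = T 0 (f \o prj) y.
Proof.
have fsE (s : seq L) (g : L -> R[i]) : neighbours (prj y) = [set` s] -> uniq s ->
    \sum_(v \in neighbours (prj y)) g v = \sum_(v <- s) g v.
  by move=> -> us; rewrite -fsbig_seq.
rewrite /laplacian /T subr0 cs_rot (cs_rot _ (mate y)).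
have [my|my] := eqVneq (mate y) y.
  have nb : neighbours (prj y) = [set` [:: prj (rot y); prj (rot (rot y))]].
    apply/seteqP; split=> v; rewrite /= ?inE.
      move/neighbours_prj => [z + ->]; rewrite /around my !inE.
      by move=> /or4P[]/eqP ->; rewrite eqxx ?orbT.
    by move=> /orP[]/eqP ->; apply/neighbours_prj; eexists => //; rewrite !inE eqxx ?orbT.
  have us : uniq [:: prj (rot y); prj (rot (rot y))].
    rewrite /= inE andbT; apply/eqP => /prj_eq_cells /= /(_ erefl) /(f_equal snd) /=.
    by case: (y) => c; apply: I3P.
  have bd : boundary_point (prj y).
    by rewrite /boundary_point nb; exact: (card_uniq_seq us).
  have -> : `[< boundary_point (prj y) >] = true by apply/asboolP.
  rewrite (fsE _ (fun v => 2 * f v) nb us) !big_cons big_nil my /=; ring.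
have us := uniq_around my.
have nb : neighbours (prj y) = [set` map prj (around y)].
  apply/seteqP; split=> v; first by move=> /neighbours_prj[z hz ->]; exact: (seq.map_f prj hz).
  by move/(seq.mapP)=> [z hz ->]; apply/neighbours_prj; exists z.
have nbd : ~ boundary_point (prj y).
  rewrite /boundary_point nb => h.
  have := card_uniq_seq us; rewrite card_eq_sym => h'.
  by have /card_eq_II := card_eq_trans h' h.
have -> : `[< boundary_point (prj y) >] = false by apply/asboolP.
rewrite (fsE _ f nb us) !big_cons big_nil /= prj_mate; ring.
Qed.

Lemma shifted_prj l (f : L -> R[i]) y :
  shifted_laplacian l f (prj y) = T l (f \o prj) y.
Proof. by rewrite /shifted_laplacian laplacian_prj /T /=; ring. Qed.

Lemma inv_prj (f : L -> R[i]) : inv (f \o prj).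
Proof. by move=> y /=; rewrite prj_mate. Qed.

Lemma sec_prj (u : flag -> R[i]) : inv u -> (u \o sec) \o prj = u.
Proof.
move=> iu; apply/funext => y /=.
by have /prj_inj[<-|e] := secK (prj y); rewrite // [in RHS]e iu.
Qed.

Section Mass.
Variable p : R.
Hypothesis p1 : 1 <= p.
Let p0 : 0 < p. Proof. exact: lt_le_trans p1. Qed.

Lemma mass_sub_le (f : L -> R[i]) : (mass p f <= mass p (f \o prj))%E.
Proof.
have -> : mass p f = (\esum_(y in range sec) (nrm (f (prj y)) `^ p)%:E)%E.
  rewrite (esum_image [set: L] sec); last first.
    by move=> a b _ _ e; rewrite -(secK a) e secK.
  by apply: eq_esum => x _; rewrite secK.
rewrite esum_mkcond; apply: le_esum => y _.
by case: ifP => // _; rewrite lee_fin powR_ge0.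
Qed.

(** A vertex has the flag chosen by [sec] and at most one other; [prj] is injective on each of the
    two resulting sets of flags. *)
Lemma mass_prj_le (f : L -> R[i]) : (mass p (f \o prj) <= mass p f + mass p f)%E.
Proof.
have le_on (A : set flag) : set_inj A prj ->
    (\esum_(y in A) (nrm (f (prj y)) `^ p)%:E <= mass p f)%E.
  move=> inj; rewrite -(esum_image A prj (fun x => (nrm (f x) `^ p)%:E) inj).
  rewrite esum_mkcond; apply: le_esum => x _.
  by case: ifP => // _; rewrite lee_fin powR_ge0.
pose A := [set y | sec (prj y) = y].
rewrite {1}/mass (esumID A) => [|y _]; last by rewrite lee_fin powR_ge0.
rewrite setTI; apply: leeD; apply: le_on.
  by move=> y z /set_mem ya /set_mem za e; rewrite -ya -za e.
rewrite setTI => y z /set_mem ya /set_mem za e.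
have [//|zy] := prj_inj e.
have /prj_inj[h|h] := secK (prj y); first by case: ya; exact: esym.
by case: za; rewrite /A /= -e zy [in RHS]h mateK.
Qed.

Lemma lp_prj (f : L -> R[i]) : lp p f <-> (mass p (f \o prj) < +oo)%E.
Proof.
have e : lp_norm p f = (mass p f `^ p^-1)%E by [].
rewrite /lp /= e; split=> [h|h].
  have h' : (mass p f < +oo)%E by apply: lty_poweRy h; rewrite invr_neq0 // gt_eqF.
  by apply: le_lt_trans (mass_prj_le f) _; rewrite lte_add_pinfty.
by apply: poweR_lty; exact: le_lt_trans (mass_sub_le f) h.
Qed.

Lemma lp_norm_lt (f : L -> R[i]) (e : R) : 0 < e ->
  (lp_norm p f < e%:E)%E <-> (mass p f < (e `^ p)%:E)%E.
Proof.
move=> e0; have -> : lp_norm p f = (mass p f `^ p^-1)%E by [].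
have m0 := mass_ge0 p f.
have pV : 0 < p^-1 by rewrite invr_gt0.
case: (mass p f) m0 => [r| |] // r0; last first.
  by rewrite poweRyr ?gt_eqF // !ltNge !leey.
rewrite lee_fin in r0; rewrite poweR_EFin !lte_fin.
have eE : e = (e `^ p) `^ p^-1 by rewrite -powRrM mulfV ?powRr1 ?(ltW e0) // gt_eqF.
split=> h; last by rewrite eE gt0_ltr_powR ?nnegrE ?powR_ge0.
rewrite ltNge; apply/negP => h'; move: h; rewrite ltNge => /negP; apply.
by rewrite {1}eE ge0_ler_powR ?nnegrE ?powR_ge0 // ltW.
Qed.

Lemma point_spectrumE l : point_spectrum w p l <-> ~ injX p l.
Proof.
rewrite /point_spectrum /=; apply: not_iff_compat; rewrite /lp_injective; split.
  move=> inj u iu fu Tu y; have e := sec_prj iu.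
  have lpu : lp p (u \o sec) by apply/lp_prj; rewrite e.
  have lp0 : lp p (fun _ : L => 0 : R[i]).
    by apply/lp_prj; rewrite (@mass_ext _ _ _ _ (fun=> 0)) // mass0.
  rewrite -e; suff -> : u \o sec = fun=> 0 by [].
  apply: inj; rewrite ?inE //; apply/funext => x; have [z ->] := prj_surj x.
  by rewrite !shifted_prj e Tu /T !csE /=; ring.
move=> inj f g /set_mem lf /set_mem lg e; apply/funext => x; have [z ->] := prj_surj x.
apply/eqP; rewrite -subr_eq0; apply/eqP.
apply: (inj (fun y => (f \o prj) y - (g \o prj) y)).
- by move=> y; rewrite !inv_prj.
- by apply: (massB_fin p1); apply/lp_prj.
- by move=> y; rewrite T_B -!shifted_prj e subrr.
Qed.

Lemma lp_surjectiveE l : lp_surjective w p l <-> surjX p l.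
Proof.
rewrite /lp_surjective; split=> s.
  move=> g ig fg; have e := sec_prj ig.
  have [|f lf ef] := s (g \o sec); first by apply/lp_prj; rewrite e.
  exists (f \o prj); split; [exact: inv_prj|exact/lp_prj|].
  by move=> y; rewrite -shifted_prj ef -[in RHS]e.
move=> g lg; have [|u [iu fu Tu]] := s (g \o prj) (inv_prj g); first exact/lp_prj.
have e := sec_prj iu; exists (u \o sec); first by apply/lp_prj; rewrite e.
by apply/funext => x; have [z ->] := prj_surj x; rewrite shifted_prj e Tu.
Qed.

Lemma lp_dense_rangeE l : lp_dense_range w p l <-> denseX p l.
Proof.
rewrite /lp_dense_range; split=> d.
  move=> g ig fg e e0; have eg := sec_prj ig.
  (* Half of [e], because passing to flags may double the mass. *)
  have e2 : 0 < e / 2 by lra.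
  have h0 : 0 < (e / 2) `^ p^-1 by exact: powR_gt0.
  have [|f [lf hf]] := d (g \o sec) _ _ h0; first by apply/lp_prj; rewrite eg.
  exists (f \o prj); split; [exact: inv_prj|exact/lp_prj|].
  move/(lp_norm_lt _ h0): hf; rewrite -powRrM mulVf ?gt_eqF // powRr1 ?(ltW e2) // => hf.
  set h := (fun x : L => _) in hf.
  rewrite (@mass_ext _ _ _ _ (h \o prj)) => [|y]; last first.
    by rewrite /h /= shifted_prj -[g in LHS]eg.
  apply: le_lt_trans (mass_prj_le h) _; have -> : e = e / 2 + e / 2 by lra.
  by rewrite EFinD; exact: lteD.
move=> g lg e e0; have h0 : 0 < e `^ p by exact: powR_gt0.
have [|u [iu fu hu]] := d (g \o prj) (inv_prj g) _ _ h0; first exact/lp_prj.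
have eu := sec_prj iu; exists (u \o sec); split; first by apply/lp_prj; rewrite eu.
apply/(lp_norm_lt _ e0); apply: le_lt_trans (mass_sub_le _) _.
rewrite (@mass_ext _ _ _ _ (fun y => T l u y - (g \o prj) y)) // => y /=.
by rewrite shifted_prj eu.
Qed.

End Mass.
End Transport.

(** * Assembly of the three spectra *)

Section Spectra.
Variables (R : realType) (p : R).
Hypothesis p1 : 1 <= p.
Implicit Types l : R[i].

Lemma julia_diff_Sigma5 l : julia R l -> ~ Sigma5 R l ->
  exists x, [/\ l = x%:C%C, bdd x & avoid5 x].
Proof.
move=> /julia_real[x -> bx] n5; exists x; split=> // k xk; apply: n5.
by exists k => //=; rewrite iter_real xk rmorph_nat.
Qed.

Lemma not_injXE l : ~ injX p l <-> Sigma5 R l \/ Sigma6 R l.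
Proof.
split=> [ni|[/(point_Sigma5 p1)|/(point_Sigma6 p1)]//].
apply: contrapT => /not_orP[n5 n6]; apply: ni.
have [/julia_diff_Sigma5|nj] := pselect (julia R l); last exact: (resolvent p1 nj n6).1.
by move=> /(_ n5)[x [-> bx ax]]; exact: injX_julia.
Qed.

Lemma not_surjXE l : (injX p l /\ ~ surjX p l) <-> (julia R l /\ ~ Sigma5 R l).
Proof.
split=> [[il sl]|[jl n5]]; last first.
  by have [x [-> bx ax]] := julia_diff_Sigma5 jl n5; split; [exact: injX_julia|exact: not_surjX_julia].
have ns : ~ (Sigma5 R l \/ Sigma6 R l) by move/not_injXE.
split=> [|n5]; last by apply: ns; left.
apply: contrapT => nj; case: (resolvent p1 nj) => // n6.
by apply: ns; right.
Qed.

End Spectra.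

Section Sigma4.
Variable R : realType.

Lemma Sigma4_julia (l : R[i]) : Sigma4 R l -> julia R l.
Proof.
move=> [k _ /=]; elim: k l => [l /= ->|k IHk l].
  by exists (nrm (4 : R[i])) => k; rewrite iter4.
by rewrite iterSr => /IHk /julia_preimage.
Qed.

(** An orbit through 4 stays at 4, one through 5 stays at 0 from the next step on. *)
Lemma Sigma4_diff_Sigma5 (l : R[i]) : Sigma4 R l -> ~ Sigma5 R l.
Proof.
move=> [k _ /= k4] [m _ /= m5].
have e4 : iter (m.+1 + k) (@decimation R) l = 4 by rewrite iterD k4 iter4.
have : iter (k.+1 + m) (@decimation R) l = 0 by rewrite iterD m5 iter5.
have -> : (k.+1 + m = m.+1 + k)%N by rewrite !addSn addnC.
by rewrite e4 => /eqP; rewrite pnatr_eq0.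
Qed.

Lemma zero_diff_Sigma5 : ~ Sigma5 R 0.
Proof. by move=> [k _ /=]; rewrite iter0 => /esym/eqP; rewrite pnatr_eq0. Qed.

End Sigma4.

Theorem theorem3p3 (R : realType) (omega : nat -> 'I_3)
    (hbd : exists x : lattice R omega, boundary_point x) :
  (forall p : R, 1 < p ->
    [/\ point_spectrum omega p = Sigma5 R `|` Sigma6 R,
        continuous_spectrum omega p = julia R `\` Sigma5 R
      & residual_spectrum omega p = set0])
  /\
  [/\ point_spectrum omega (1 : R) = Sigma5 R `|` Sigma6 R,
      continuous_spectrum omega (1 : R) =
        julia R `\` (Sigma4 R `|` Sigma5 R `|` [set 0])
    & residual_spectrum omega (1 : R) = 0 |` Sigma4 R].
Proof.
have [x /boundary_eventually_constant[i [M wi]]] := hbd.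
have pointE (p : R) : 1 <= p -> point_spectrum omega p = Sigma5 R `|` Sigma6 R.
  move=> p1; apply/seteqP; split=> l.
    by move/(point_spectrumE wi p1)/(not_injXE p1).
  by move/(not_injXE p1)/(point_spectrumE wi p1).
have spectrumE (p : R) l : 1 <= p ->
    ~ point_spectrum omega p l /\ ~ lp_surjective omega p l <->
    julia R l /\ ~ Sigma5 R l.
  move=> p1; rewrite -(not_surjXE p1); split=> -[np ns]; split.
  - by apply: contrapT => /(point_spectrumE wi p1).
  - by move/(lp_surjectiveE wi p1).
  - by move/(point_spectrumE wi p1).
  - by move/(lp_surjectiveE wi p1).
have rangeE (p : R) y : 1 <= p -> denseX p y%:C%C -> lp_dense_range omega p y%:C%C.
  by move=> p1 /(lp_dense_rangeE wi p1).
have le11 : (1 : R) <= 1 by [].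
have dense1 l : julia R l -> ~ Sigma5 R l -> ~ Sigma4 R l -> l <> 0 ->
    lp_dense_range omega 1 l.
  move=> jl n5 n4 n0; have [y [ly bx ax]] := julia_diff_Sigma5 jl n5; rewrite ly.
  apply: rangeE => //; apply: denseX_nonexceptional => //.
    by apply/eqP => y0; apply: n0; rewrite ly y0.
  move=> k yk; apply: n4; exists k => //=.
  by rewrite ly iter_real yk rmorph_nat.
split=> [p p1|].
  have p1w := ltW p1.
  have dense l : julia R l -> ~ Sigma5 R l -> lp_dense_range omega p l.
    move=> jl n5; have [y [-> bx ax]] := julia_diff_Sigma5 jl n5.
    by apply: rangeE => //; exact: denseX_gt1.
  split; first exact: pointE.
  - apply/seteqP; split=> l; first by move=> [np ns _]; apply/(spectrumE p l p1w).
    by move=> [jl n5]; have [np ns] := (spectrumE p l p1w).2 (conj jl n5); split=> //; exact: dense.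
  - apply/seteqP; split=> // l [np ns]; apply.
    by have [jl n5] := (spectrumE p l p1w).1 (conj np ns); exact: dense.
split; first exact: pointE.
- apply/seteqP; split=> l.
    move=> [np ns /(lp_dense_rangeE wi le11) d].
    have [jl n5] := (spectrumE 1 l le11).1 (conj np ns); split=> // -[[l4|//]|l0].
      exact: (not_denseX_Sigma4 l4).
    by apply: (@not_denseX_zero R); rewrite -[0]l0.
  move=> [jl /not_orP[/not_orP[n4 n5] n0]].
  by have [np ns] := (spectrumE 1 l le11).2 (conj jl n5); split=> //; exact: dense1.
- apply/seteqP; split=> l.
    move=> [np ns nd]; have [jl n5] := (spectrumE 1 l le11).1 (conj np ns).
    by apply: contrapT => /not_orP[n0 n4]; apply: nd; exact: dense1.
  move=> l04; have [jl n5] : julia R l /\ ~ Sigma5 R l.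
    case: l04 => [->|l4]; first by split; [exact: julia0|exact: zero_diff_Sigma5].
    by split; [exact: Sigma4_julia|exact: Sigma4_diff_Sigma5].
  have [np ns] := (spectrumE 1 l le11).2 (conj jl n5); split=> //.
  move/(lp_dense_rangeE wi le11); case: l04 => [->|]; first exact: not_denseX_zero.
  exact: not_denseX_Sigma4.
Qed.
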